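(* Let $p\ge 1$, $1/2<\alpha\le 1$, $\alpha p\ge 1$, and let $\{X_{m,n},\, m\ge 1,\, n\ge 1\}$ be a double array of random variables. Assume that the array satisfies Condition $(H_{2q})$ with $q=1$ if $1\le p<2$, and with some $q>(\alpha p-1)/(2\alpha-1)$ if $p\ge 2$. (Sufficiency) If $\{X_{m,n},\, m\ge 1,\, n\ge 1\}$ is stochastically dominated by a random variable $X$ satisfying $$\mathbb{E}\left(|X|^p\log|X|\right)<\infty, \qquad (1)$$ then $$\sum_{m=1}^{\infty}\sum_{n=1}^{\infty}(mn)^{\alpha p-2}\,\mathbb{P}\left(\max_{\substack{1\le u\le m\\ 1\le v\le n}}\left|\sum_{i=1}^{u}\sum_{j=1}^{v}(X_{i,j}-\mathbb{E}X_{i,j})\right|>\varepsilon (mn)^{\alpha}\right)<\infty\quad\text{for all }\varepsilon>0.$$ (Necessity) Conversely, if the random variables $X_{m,n}$, $m\ge1$, $n\ge1$, all have the same distribution as a random variable $X$ and, for some $\mu\in\mathbb{R}$, $$\sum_{m=1}^{\infty}\sum_{n=1}^{\infty}(mn)^{\alpha p-2}\,\mathbb{P}\left(\max_{\substack{1\le u\le m\\ 1\le v\le n}}\left|\sum_{i=1}^{u}\sum_{j=1}^{v}(X_{i,j}-\mu)\right|>\varepsilon (mn)^{\alpha}\right)<\infty\quad\text{for all }\varepsilon>0,$$ then $\mathbb{E}X=\mu$ and (1) holds.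
   Context: Convention: $\log a$ denotes the natural logarithm of $\max\{a,2\}$. Condition $(H_{2q})$: let $q\ge 1$ be a real number. A family of random variables $\{X_\lambda,\lambda\in\Lambda\}$ (on a common probability space) satisfies Condition $(H_{2q})$ if there is a finite constant $C(q)$ depending only on $q$ (in particular not on $I$ or on the functions $f_\lambda$) such that for every finite subset $I\subset\Lambda$ and every family of increasing (i.e. nondecreasing) functions $f_\lambda:\mathbb{R}\to\mathbb{R}$, $\lambda\in I$, $$\mathbb{E}\left|\sum_{\lambda\in I}\left(f_\lambda(X_\lambda)-\mathbb{E}f_\lambda(X_\lambda)\right)\right|^{2q}\le C(q)\left(|I|\max_{\lambda\in I}\mathbb{E}|f_\lambda(X_\lambda)|^{2q}+|I|^{q}\max_{\lambda\in I}\left(\mathbb{E}f_\lambda^2(X_\lambda)\right)^{q}\right),$$ provided the expectations are finite. Here $|I|$ is the cardinality of $I$. Stochastic domination: a family $\{X_\lambda,\lambda\in\Lambda\}$ is stochastically dominated by a random variable $X$ if $\sup_{\lambda\in\Lambda}\mathbb{P}(|X_\lambda|>x)\le\mathbb{P}(|X|>x)$ for all $x\in\mathbb{R}$. *)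

(* Defs.v *)
From HB Require Import structures.
From mathcomp Require Export all_boot all_order all_algebra.
From mathcomp Require Export finmap.
From mathcomp Require Export all_classical all_reals all_analysis.

Set Implicit Arguments.
Unset Strict Implicit.
Unset Printing Implicit Defensive.

Import Order.TTheory GRing.Theory Num.Theory.
Import numFieldNormedType.Exports.

Local Open Scope classical_set_scope.
Local Open Scope ring_scope.

Definition log_max2 (R : realType) (a : R) : R := ln (Num.max a 2).

(* Condition (H_{2q}) for the family (X l), l in D.
   Since 1 <= q in every use and P is a probability, finiteness of the moments
   of order 2q entails finiteness of all the other expectations involved. The
   maxima are over nonnegative quantities, so 0 is a neutral default. *)
Definition condition_H2q d (T : measurableType d) (R : realType)
    (P : probability T R) (L : choiceType) (D : set L)
    (X : L -> {RV P >-> R}) (q : R) : Prop :=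
  exists C : R, forall (I : {fset L}) (f : L -> R -> R),
    (forall l, l \in I -> D l) ->
    (forall l, l \in I -> {homo f l : x y / x <= y}) ->
    (forall l, l \in I ->
      ('E_P[fun w => (`|f l (X l w)| `^ (2 * q))%R] < +oo)%E) ->
    ('E_P[fun w => (`| \sum_(l <- I)
             (f l (X l w) - fine 'E_P[fun w' => f l (X l w')]%E) |
           `^ (2 * q))%R]
     <= C%:E *
        (#|` I|%:R%:E *
           \big[maxe/0]_(l <- I) 'E_P[fun w => (`|f l (X l w)| `^ (2 * q))%R]
         + ((#|` I|%:R `^ q)%R)%:E *
           \big[maxe/0]_(l <- I) ('E_P[fun w => (f l (X l w) ^+ 2)%R] `^ q)))%E.

(* Y may live on a probability space different from that of the family. *)
Definition stochastically_dominated
    d (T : measurableType d) d' (T' : measurableType d') (R : realType)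
    (P : probability T R) (Q : probability T' R) (L : Type) (D : set L)
    (X : L -> {RV P >-> R}) (Y : {RV Q >-> R}) : Prop :=
  forall x : R,
    (ereal_sup [set P [set w | (x < `|X l w|)%R] | l in D]
     <= Q [set w | (x < `|Y w|)%R])%E.

(* Equality of laws is required on measurable sets only: elsewhere the values
   of a measure are unspecified. *)
Definition same_distribution
    d (T : measurableType d) d' (T' : measurableType d') (R : realType)
    (P : probability T R) (Q : probability T' R)
    (X : {RV P >-> R}) (Y : {RV Q >-> R}) : Prop :=
  forall A : set R, measurable A -> distribution P X A = distribution Q Y A.

(* Row and column indices start at 1; entries with a zero index are unused. *)
Definition pos_index : set (nat * nat) :=
  [set mn | (1 <= mn.1)%N /\ (1 <= mn.2)%N].

Definition max_rect_sum (R : realType) (a : nat * nat -> R) (m n : nat) : R :=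
  \big[Num.max/0]_(1 <= u < m.+1) \big[Num.max/0]_(1 <= v < n.+1)
    `| \sum_(1 <= i < u.+1) \sum_(1 <= j < v.+1) a (i, j) |.

(* The double series for the array X centered at the constants c. *)
Definition rate_series d (T : measurableType d) (R : realType)
    (P : probability T R) (X : nat * nat -> {RV P >-> R}) (c : nat * nat -> R)
    (alpha p eps : R) : \bar R :=
  (\sum_(1 <= m <oo) \sum_(1 <= n <oo)
    (((m * n)%:R `^ (alpha * p - 2))%R)%:E *
    P [set w | (eps * (m * n)%:R `^ alpha <
                 max_rect_sum (fun ij => X ij w - c ij) m n)%R])%E.

(* Main.v *)
Require Import Defs.
From mathcomp Require Import measurable_realfun ring lra zify.
Import Order.TTheory GRing.Theory Num.Theory.
Import numFieldNormedType.Exports.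
Local Open Scope classical_set_scope.
Local Open Scope ring_scope.

Set Implicit Arguments.
Unset Strict Implicit.
Unset Printing Implicit Defensive.

(** Both implications are first read on dyadic scales: rows between 2^K and
    2^(K+1) and columns between 2^L and 2^(L+1) are grouped, and the double
    series becomes the sum over (K, L) of 2^((alpha p - 1) N) times the
    probability that the maximum over the rectangle of size 2^K by 2^L exceeds
    eps 2^(alpha N), where N = K + L.

    Sufficiency. Positive and negative parts are treated separately, so the
    variables may be taken nonnegative. Condition (H_2q) only bounds
    moments of full sums, not of maxima, and plain binary chaining would lose logarithms on the
    rare large values. Instead the truncation level follows the chaining (a
    method of Rio): a dyadic rectangle of size 2^a by 2^b is summed after
    truncation at 2^(alpha (a + b)). Since truncations of nonnegative variables
    increase with the level, passing from one level to the next inside a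
    rectangle is controlled by the sums over the full rectangle and by its mean
    ([chaining_in_block], [rect_chaining]), and these means are of smaller order
    than 2^(alpha N) ([weighted_null_sum]). There remain moment bounds for the
    sums over dyadic rectangles, which Condition (H_2q) provides. Summed over
    rectangles and scales ([dyadic_maximal_bound], [nneseries2_convolution])
    they lead to the series over (a, b) of normalised truncated moments of Y at
    level a + b. Since there are r + 1 pairs with a + b = r, this series is of
    the order of E |Y|^p log |Y| ([truncated_terms_le]); second moments are
    summable by the condition on q.

    Necessity. If the maximum is at most eps 2^(alpha N), no entry of the
    rectangle deviates from mu by more than a multiple of it. Condition (H_2q)
    applied to indicators of half-lines, which are monotone, controls the number
    of large entries, and bounds its mean 2^N P(|Y - mu| >= 2^(alpha N)) by a
    multiple of the probability that the maximum is large ([count_mean_le],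
    [expected_count_le]). Summation over (K, L) gives back E |Y - mu|^p log |Y -
    mu| ([moment_le_dyadic]). Then the sufficiency part holds with the true
    mean, and two centrings cannot both give convergent series unless they agree
    ([necessary_mean]). *)

(** * Binary chaining of partial sums *)

Definition dyadic_block (R : realType) (g : nat -> R) (b s t : nat) : R :=
  \sum_(s * 2 ^ b <= i < s * 2 ^ b + t) g i.

Lemma dyadic_block_halves (R : realType) (g : nat -> R) (b s : nat) :
  dyadic_block g b.+1 s (2 ^ b.+1) =
  dyadic_block g b (2 * s) (2 ^ b) + dyadic_block g b (2 * s).+1 (2 ^ b).
Proof.
rewrite /dyadic_block (@big_cat_nat _ _ _ (s * 2 ^ b.+1 + 2 ^ b)%N) /=; [|by rewrite leq_addr|by rewrite leq_add2l leq_exp2l].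
have -> : (2 * s * 2 ^ b = s * 2 ^ b.+1)%N by rewrite expnS; lia.
have -> : ((2 * s).+1 * 2 ^ b = s * 2 ^ b.+1 + 2 ^ b)%N by rewrite expnS; lia.
by rewrite -addnA addnn -mul2n -expnS.
Qed.

(** A lower bound on the entries makes a prefix sum comparable to the sum over
    the whole block, in both directions: the remaining suffix cannot be very
    negative, and neither can the prefix itself. *)
Lemma chain_prefix_step (R : realType) (d : nat -> R) (B zeta : R) (m n t : nat) :
  (forall i, - zeta <= d i) -> 0 <= zeta -> (t <= n)%N ->
  `|\sum_(m <= i < m + n) d i| <= B ->
  `|\sum_(m <= i < m + t) d i| <= B + n%:R * zeta.
Proof.
move=> hd z0 tn.
rewrite (@big_cat_nat _ _ _ (m + t)%N) /= ?leq_addr ?leq_add2l //.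
set x := \sum_(m <= i < m + t) _; set y := \sum_(m + t <= i < m + n) _ => hB.
have hx : - (t%:R * zeta) <= x.
  rewrite -mulrN mulr_natl -[t in leLHS](addKn m t) -sumr_const_nat.
  by apply: ler_sum_nat => i _.
have hy : - ((n - t)%:R * zeta) <= y.
  rewrite -mulrN mulr_natl -[(n - t)%N](@subnDl m) -sumr_const_nat.
  by apply: ler_sum_nat => i _.
have hn : n%:R * zeta = t%:R * zeta + (n - t)%:R * zeta.
  by rewrite -mulrDl -natrD subnKC.
have h1 : 0 <= t%:R * zeta by rewrite mulr_ge0.
have h2 : 0 <= (n - t)%:R * zeta by rewrite mulr_ge0.
by move: hB; rewrite !ler_norml => /andP[? ?]; apply/andP; split; lra.
Qed.

(** Binary chaining in which the summands change with the scale: blocks of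
    length 2^b are only controlled for the b-th sequence. Going from level b to
    b+1 costs one half block at level b, plus the change of sequence; the latter
    is bounded below by - zeta b, so by [chain_prefix_step] its prefixes cost one
    full block and 2^(b+1) zeta b. Because that change is estimated inside a block of
    length 2^(b+1) only, and not over the whole range, its contribution to the
    total is of the order of 2^b zeta b, and no logarithm is lost. *)
Lemma chaining_in_block (R : realType) (g : nat -> nat -> R) (A zeta : nat -> R)
    (L : nat) :
  (forall r, 0 <= zeta r) ->
  (forall r i, g r i - g r.+1 i <= zeta r) ->
  (forall b s, (b <= L)%N -> (s.+1 * 2 ^ b <= 2 ^ L)%N ->
     `|dyadic_block (g b) b s (2 ^ b)| <= A b) ->
  forall b s t, (b <= L)%N -> (s.+1 * 2 ^ b <= 2 ^ L)%N -> (t <= 2 ^ b)%N ->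
    `|dyadic_block (g b) b s t| <=
      \sum_(k < b) 4 * A k + A b + \sum_(k < b) 2 ^+ k.+1 * zeta k.
Proof.
move=> z0 hz hA; have A0 b : (b <= L)%N -> 0 <= A b.
  by move=> bL; apply: le_trans (hA b 0%N bL _); rewrite // mul1n leq_exp2l.
elim=> [|b IH] s t bL sL tb.
  rewrite !big_ord0 addr0 add0r.
  have [->|t1] : t = 0%N \/ t = 1%N by move: tb; rewrite expn0; lia.
    by rewrite /dyadic_block addn0 big_geq // normr0 A0.
  by rewrite t1; exact: hA.
have bL' := ltnW bL.
have s1 : ((2 * s).+1 * 2 ^ b <= 2 ^ L)%N.
  by apply: leq_trans sL; rewrite expnS; lia.
have s2 : ((2 * s).+2 * 2 ^ b <= 2 ^ L)%N.
  by apply: leq_trans sL; rewrite expnS; lia.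
rewrite !(big_ord_recr b) /=.
set U := \sum_(k < b) _; set V := \sum_(k < b) _.
have -> : dyadic_block (g b.+1) b.+1 s t = dyadic_block (g b) b.+1 s t
    + dyadic_block (fun i => g b.+1 i - g b i) b.+1 s t.
  rewrite /dyadic_block -big_split /=.
  by apply: eq_bigr => i _; rewrite addrCA subrr addr0.
(* the block sum of the change is that of level b+1 minus two of level b *)
have hd : `|dyadic_block (fun i => g b.+1 i - g b i) b.+1 s t| <=
    (A b.+1 + 2 * A b) + (2 ^ b.+1)%:R * zeta b.
  apply: chain_prefix_step => //.
    by move=> i; have := hz b i; rewrite lerNl opprB.
  rewrite sumrB; apply: le_trans (ler_normB _ _) _; apply: lerD.
    exact: hA.
  rewrite -/(dyadic_block (g b) b.+1 s (2 ^ b.+1)) dyadic_block_halves.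
  apply: le_trans (ler_normD _ _) _.
  by rewrite mulr_natl mulr2n; apply: lerD; apply: hA.
have hg : `|dyadic_block (g b) b.+1 s t| <= A b + (U + A b + V).
  have [tb'|tb'] := leqP t (2 ^ b).
    have -> : dyadic_block (g b) b.+1 s t = dyadic_block (g b) b (2 * s) t.
      by rewrite /dyadic_block expnS mulnA (mulnC s 2%N).
    by apply: le_trans (IH _ _ bL' s1 tb') _; rewrite lerDr A0.
  have -> : dyadic_block (g b) b.+1 s t = dyadic_block (g b) b (2 * s) (2 ^ b)
      + dyadic_block (g b) b (2 * s).+1 (t - 2 ^ b).
    rewrite /dyadic_block (@big_cat_nat _ _ _ (s * 2 ^ b.+1 + 2 ^ b)%N) /=;
      [|by rewrite leq_addr|by rewrite leq_add2l ltnW].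
    congr (_ + _); congr (bigop.body _ _ _); congr (index_iota _ _);
      move: tb'; rewrite expnS; lia.
  apply: le_trans (ler_normD _ _) _; apply: lerD; first exact: hA.
  by apply: IH => //; move: tb; rewrite expnS; lia.
apply: le_trans (ler_normD _ _) _.
move: hd hg; rewrite natrX; set z := _ * zeta b; have := A0 _ bL'; have := A0 _ bL.
lra.
Qed.

Lemma chaining (R : realType) (g : nat -> nat -> R) (A zeta : nat -> R)
    (L : nat) :
  (forall r, 0 <= zeta r) ->
  (forall r i, g r i - g r.+1 i <= zeta r) ->
  (forall b s, (b <= L)%N -> (s.+1 * 2 ^ b <= 2 ^ L)%N ->
     `|dyadic_block (g b) b s (2 ^ b)| <= A b) ->
  forall t, (t <= 2 ^ L)%N ->
    `|\sum_(i < t) g L i| <=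
      \sum_(k < L.+1) 4 * A k + \sum_(k < L) 2 ^+ k.+1 * zeta k.
Proof.
move=> z0 hz hA t tL.
have := @chaining_in_block _ g A zeta L z0 hz hA L 0%N t (leqnn L).
rewrite /dyadic_block mul1n mul0n add0n big_mkord => /(_ (leqnn _) tL)/le_trans.
apply; rewrite lerD2r big_ord_recr lerD2l /= ler_peMl ?ler1n //.
by apply: le_trans (hA L 0%N _ _); rewrite // mul1n.
Qed.

Definition dyadic_rect (R : realType) (g : nat -> nat -> R) (a b s t : nat) : R :=
  dyadic_block (fun i => dyadic_block (g i) b t (2 ^ b)) a s (2 ^ a).

Lemma dyadic_blockC (R : realType) (g : nat -> nat -> R) (a s m b t n : nat) :
  dyadic_block (fun j => dyadic_block (g^~ j) a s m) b t n =
  dyadic_block (fun i => dyadic_block (g i) b t n) a s m.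
Proof. by rewrite /dyadic_block exchange_big. Qed.

(** Chaining in both directions: a rectangle of size 2^a by 2^b is controlled for
    the sequence of index a + b. One chains over rows with all columns kept,
    where row blocks at level a carry the index a + L, and then over columns
    inside every row block. *)
Lemma rect_chaining (R : realType) (g : nat -> nat -> nat -> R)
    (A : nat -> nat -> R) (zeta : nat -> R) (K L : nat) :
  (forall r, 0 <= zeta r) ->
  (forall r i j, g r i j - g r.+1 i j <= zeta r) ->
  (forall a b s t, (a <= K)%N -> (b <= L)%N ->
     (s.+1 * 2 ^ a <= 2 ^ K)%N -> (t.+1 * 2 ^ b <= 2 ^ L)%N ->
     `|dyadic_rect (g (a + b)%N) a b s t| <= A a b) ->
  forall u v, (u <= 2 ^ K)%N -> (v <= 2 ^ L)%N ->
    `|\sum_(i < u) \sum_(j < v) g (K + L)%N i j| <=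
      16 * (\sum_(a < K.+1) \sum_(b < L.+1) A a b) +
      16 * (\sum_(a < K.+1) \sum_(b < L.+1) 2 ^+ (a + b) * zeta (a + b)%N).
Proof.
move=> z0 hz hA u v uK vL.
pose A' a := \sum_(b < L.+1) 4 * A a b +
  \sum_(b < L) 2 ^+ b.+1 * (2 ^+ a * zeta (a + b)%N).
(* columns: inside a row block of level a the index runs from a to a + L *)
have hA' a s : (a <= K)%N -> (s.+1 * 2 ^ a <= 2 ^ K)%N ->
    `|dyadic_block (fun i => \sum_(j < v) g (a + L)%N i j) a s (2 ^ a)| <= A' a.
  move=> aK sK.
  have -> : dyadic_block (fun i => \sum_(j < v) g (a + L)%N i j) a s (2 ^ a) =
      \sum_(j < v) dyadic_block (fun i => g (a + L)%N i j) a s (2 ^ a).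
    by rewrite /dyadic_block exchange_big.
  apply: (@chaining _
    (fun r j => dyadic_block (fun i => g (a + r)%N i j) a s (2 ^ a))
    (A a) (fun b => 2 ^+ a * zeta (a + b)%N)) => //.
  - by move=> r; rewrite mulr_ge0 // exprn_ge0.
  - move=> r j; rewrite /dyadic_block -sumrB.
    rewrite -[2 ^+ a]natrX mulr_natl -[X in _ *+ X](addKn (s * 2 ^ a)%N).
    by rewrite -sumr_const_nat ler_sum_nat // => i _; rewrite addnS.
  - by move=> b t bL tL; rewrite dyadic_blockC; apply: hA.
have zL a : 0 <= v%:R * zeta a by rewrite mulr_ge0.
(* rows: the index runs from L to K + L *)
have := @chaining R (fun r i => \sum_(j < v) g (r + L)%N i j) A'
  (fun a => v%:R * zeta (a + L)%N) K _ _ hA' u uK.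
move=> /(_ _ _)/le_trans; apply => //.
  move=> r i; rewrite -sumrB mulr_natl -[v in _ *+ v]card_ord -sumr_const.
  by apply: ler_sum => j _; rewrite addSn.
have B0 a b : 0 <= 2 ^+ (a + b) * zeta (a + b)%N by rewrite mulr_ge0 // exprn_ge0.
have h2 : \sum_(k < K) 2 ^+ k.+1 * (v%:R * zeta (k + L)%N) <=
    2 * \sum_(a < K.+1) \sum_(b < L.+1) 2 ^+ (a + b) * zeta (a + b)%N.
  rewrite mulr_sumr big_ord_recr /= -[leLHS]addr0; apply: lerD; last first.
    by rewrite mulr_ge0 // sumr_ge0.
  apply: ler_sum => k _; rewrite big_ord_recr /= mulrDr -[leLHS]add0r.
  apply: lerD; first by rewrite mulr_ge0 // sumr_ge0.
  rewrite exprS -!mulrA ler_pM2l // exprD -mulrA ler_pM2l ?exprn_gt0 //.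
  by rewrite ler_wpM2r // -natrX ler_nat.
have h1 : \sum_(k < K.+1) 4 * A' k <=
    16 * (\sum_(a < K.+1) \sum_(b < L.+1) A a b) +
    8 * (\sum_(a < K.+1) \sum_(b < L.+1) 2 ^+ (a + b) * zeta (a + b)%N).
  rewrite !mulr_sumr -big_split /=; apply: ler_sum => a _.
  rewrite /A' mulrDr -mulr_sumr mulrA -natrM lerD2l.
  have -> : (8 : R) = 4 * 2 by rewrite -natrM.
  rewrite -mulrA ler_pM2l // mulr_sumr [leRHS]big_ord_recr /= -[leLHS]addr0.
  apply: lerD; last by rewrite mulr_ge0.
  by apply: ler_sum => b _; rewrite le_eqVlt exprS exprD; apply/orP; left;
     apply/eqP; ring.
apply: le_trans (lerD h1 h2) _.
have : 0 <= \sum_(a < K.+1) \sum_(b < L.+1) 2 ^+ (a + b) * zeta (a + b)%N.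
  by apply: sumr_ge0 => a _; apply: sumr_ge0.
set x := \sum_(a < K.+1) _; set y := \sum_(a < K.+1) _; lra.
Qed.

(** * Nonnegative series over dyadic scales *)

Lemma powR2D (R : realType) (x y : R) : 2 `^ (x + y) = 2 `^ x * 2 `^ y.
Proof. by rewrite powRD //; apply/implyP. Qed.

Lemma powR2_gt0 (R : realType) (x : R) : 0 < 2 `^ x.
Proof. by rewrite powR_gt0. Qed.

Lemma powR2_nat (R : realType) (n : nat) : 2 `^ n%:R = 2 ^+ n :> R.
Proof. exact: powR_mulrn. Qed.

Lemma ler_powR2 (R : realType) (x y : R) : x <= y -> 2 `^ x <= 2 `^ y.
Proof. by move=> xy; apply: ler_powR => //; rewrite ler1n. Qed.

Lemma powR2_lt1 (R : realType) (x : R) : 0 < x -> 2 `^ (- x) < 1.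
Proof.
move=> x0; rewrite powRN invf_lt1 ?powR2_gt0 //.
by rewrite /powR pnatr_eq0 /= expR_gt1 mulr_gt0 // ln_gt0 // ltr1n.
Qed.

Lemma powR2M (R : realType) (x : R) n : 2 `^ (x * n%:R) = (2 `^ x) ^+ n.
Proof. by rewrite powRrM powR_mulrn // powR_ge0. Qed.

(** The sum of the geometric series of ratio 2^(-g). *)
Definition geo_bound (R : realType) (g : R) : R := (1 - 2 `^ (- g))^-1.

Lemma geo_bound_ge0 (R : realType) (g : R) : 0 < g -> 0 <= geo_bound g.
Proof. by move=> g0; rewrite invr_ge0 subr_ge0 ltW // powR2_lt1. Qed.

Lemma geo_sum_le (R : realType) (g : R) (n : nat) : 0 < g ->
  \sum_(0 <= k < n) 2 `^ (- g * k%:R) <= geo_bound g.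
Proof.
move=> g0; have h := powR2_lt1 g0; have h0 := powR2_gt0 (- g).
under eq_bigr do rewrite powR2M.
rewrite /geo_bound; set x := 2 `^ (- g) in h h0 *.
have h1 : 0 < 1 - x by rewrite subr_gt0.
rewrite -[leRHS]mul1r ler_pdivlMr // mulrC.
suff -> : (1 - x) * \sum_(0 <= k < n) x ^+ k = 1 - x ^+ n.
  by rewrite gerBl exprn_ge0 // ltW.
elim: n => [|n IH]; first by rewrite big_geq // mulr0 expr0 subrr.
by rewrite big_nat_recr //= mulrDr IH exprS; ring.
Qed.

Local Open Scope ereal_scope.

Lemma nneseries_le_of_sums (R : realType) (u : nat -> \bar R) (B : \bar R) m :
  (forall k, 0 <= u k) ->
  (forall n, \sum_(m <= k < n) u k <= B) -> \sum_(m <= k <oo) u k <= B.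
Proof.
move=> u0 uB; apply: lime_le; last by apply: nearW.
by apply: is_cvg_nneseries.
Qed.

Lemma sum_dyadic_blocks (V : nmodType) (f : nat -> V) n :
  (\sum_(1 <= m < 2 ^ n) f m =
   \sum_(0 <= K < n) \sum_(2 ^ K <= m < 2 ^ K.+1) f m)%R.
Proof.
elim: n => [|n IH]; first by rewrite !big_geq.
rewrite big_nat_recr //= -IH -big_cat_nat //= ?expn_gt0 //.
by rewrite leq_exp2l.
Qed.

Lemma nneseries_dyadic (R : realType) (f : nat -> \bar R) :
  (forall m, 0 <= f m) ->
  \sum_(1 <= m <oo) f m =
  \sum_(K <oo) \sum_(2 ^ K <= m < 2 ^ K.+1) f m.
Proof.
move=> f0; apply/eqP; rewrite eq_le; apply/andP; split.
  apply: nneseries_le_of_sums => // n.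
  apply: (@le_trans _ _ (\sum_(1 <= m < 2 ^ n) f m)).
    apply: lee_sum_nneg_natr => //; exact/ltnW/ltn_expl.
  rewrite sum_dyadic_blocks; apply: nneseries_lim_ge => K _ _.
  exact: sume_ge0.
apply: nneseries_le_of_sums => [k|n]; first exact: sume_ge0.
by rewrite -sum_dyadic_blocks; apply: nneseries_lim_ge.
Qed.

Lemma nneseries_convolution (R : realType) (rho : nat -> R) (B : R)
    (h : nat -> \bar R) :
  (forall k, (0 <= rho k)%R) -> (forall k, 0 <= h k) ->
  (forall n, (\sum_(0 <= k < n) rho k <= B)%R) ->
  \sum_(K <oo) \sum_(0 <= a < K.+1) (rho (K - a)%N)%:E * h a <=
  B%:E * \sum_(a <oo) h a.
Proof.
move=> rho0 h0 rhoB.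
have B0 : (0 <= B)%R by have := rhoB 0%N; rewrite big_geq.
apply: nneseries_le_of_sums => [k|n].
  by apply: sume_ge0 => a _; rewrite mule_ge0 // lee_fin.
have -> : \sum_(0 <= K < n) \sum_(0 <= a < K.+1) (rho (K - a)%N)%:E * h a =
    \sum_(0 <= a < n) \sum_(0 <= k < n - a) (rho k)%:E * h a.
  elim: n => [|n IH]; first by rewrite !big_geq.
  rewrite big_nat_recr //= IH -[in RHS]/(iota _ _) [RHS]big_nat_recr //=.
  rewrite subSn // subnn big_nat1 big_nat_recr //= subnn addeA; congr (_ + _).
  rewrite -big_split /= big_nat [RHS]big_nat; apply: eq_bigr => a /andP[_ an].
  by rewrite subSn ?(ltnW an) // big_nat_recr.
apply: (@le_trans _ _ (\sum_(0 <= a < n) B%:E * h a)); last first.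
  rewrite -nneseriesZl //; apply: nneseries_lim_ge => k _ _.
  by rewrite mule_ge0.
apply: lee_sum => a _; rewrite -ge0_sume_distrl; last by move=> k _; rewrite lee_fin.
by rewrite lee_wpmul2r // sumEFin lee_fin.
Qed.

(** The bound obtained for scale (K, L) is a weighted sum over the smaller
    scales (a, b) with geometrically decaying weights; summing over all scales
    then only costs a constant. *)
Lemma nneseries2_convolution (R : realType) (rho : nat -> R) (B : R)
    (h : nat -> nat -> \bar R) :
  (forall k, (0 <= rho k)%R) -> (forall a b, 0 <= h a b) ->
  (forall n, (\sum_(0 <= k < n) rho k <= B)%R) ->
  \sum_(K <oo) \sum_(L <oo) \sum_(0 <= a < K.+1) \sum_(0 <= b < L.+1)
     (rho (K - a)%N * rho (L - b)%N)%:E * h a b <=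
  (B * B)%:E * \sum_(a <oo) \sum_(b <oo) h a b.
Proof.
move=> rho0 h0 rhoB.
have B0 : (0 <= B)%R by have := rhoB 0%N; rewrite big_geq.
have S0 a : 0 <= \sum_(b <oo) h a b by apply: nneseries_ge0.
apply: (@le_trans _ _ (\sum_(K <oo) \sum_(0 <= a < K.+1)
    (rho (K - a)%N)%:E * (B%:E * \sum_(b <oo) h a b))).
  apply: lee_nneseries => K; first by move=> _ _; apply: nneseries_ge0 => L _ _;
    apply: sume_ge0 => a _; apply: sume_ge0 => b _; rewrite mule_ge0 // lee_fin mulr_ge0.
  move=> _; rewrite nneseries_sum_nat; last first.
    by move=> a L; apply: sume_ge0 => b _; rewrite mule_ge0 // lee_fin mulr_ge0.
  apply: lee_sum => a _.
  apply: (@le_trans _ _ (\sum_(L <oo) (rho (K - a)%N)%:E *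
      \sum_(0 <= b < L.+1) (rho (L - b)%N)%:E * h a b)).
    rewrite le_eqVlt; apply/orP; left; apply/eqP; apply: eq_eseriesr => L _.
    rewrite ge0_sume_distrr; last by move=> b _; rewrite mule_ge0 // lee_fin.
    by apply: eq_bigr => b _; rewrite EFinM muleA.
  rewrite nneseriesZl; last first.
    by move=> L _; apply: sume_ge0 => b _; rewrite mule_ge0 // lee_fin.
  by rewrite lee_wpmul2l ?lee_fin //; apply: nneseries_convolution.
apply: le_trans (nneseries_convolution rho0 _ rhoB) _.
  by move=> a; rewrite mule_ge0.
by rewrite nneseriesZl // muleA EFinM.
Qed.

Local Close Scope ereal_scope.

(** * Pointwise comparison of y^p log y with double dyadic sums *)

Lemma ln2_gt0 (R : realType) : 0 < ln 2 :> R.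
Proof. by rewrite ln_gt0 // ltr1n. Qed.

Lemma ln2_le_log_max2 (R : realType) (y : R) : ln 2 <= log_max2 y.
Proof. by rewrite /log_max2 ler_ln ?posrE ?lt_max ?le_max ?lexx ?orbT // ltr0n orbT. Qed.

Lemma log_max2_gt0 (R : realType) (y : R) : 0 < log_max2 y.
Proof. exact: lt_le_trans (ln2_gt0 R) (ln2_le_log_max2 y). Qed.

Lemma ln_le_log_max2 (R : realType) (y : R) : 0 < y -> ln y <= log_max2 y.
Proof.
by move=> y0; rewrite /log_max2 ler_ln ?posrE ?lt_max ?le_max ?lexx ?y0.
Qed.

Lemma powR2E (R : realType) (x : R) : 2 `^ x = expR (x * ln 2).
Proof. by rewrite /powR pnatr_eq0. Qed.

Lemma dyadic_scale (R : realType) (al y : R) : 0 < al -> 1 <= y ->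
  exists n : nat, 2 `^ (al * n%:R) <= y < 2 `^ (al * n.+1%:R).
Proof.
move=> al0 y1; have y0 : 0 < y by apply: lt_le_trans y1.
have h : 0 < al * ln 2 by rewrite mulr_gt0 // ln2_gt0.
have /truncn_itv/andP[h1 h2] : 0 <= ln y / (al * ln 2) by rewrite divr_ge0 ?ln_ge0 // ltW.
exists (Num.truncn (ln y / (al * ln 2))).
rewrite ler_pdivlMr // in h1; rewrite ltr_pdivrMr // in h2.
rewrite !powR2E -[y in _ <= y](lnK y0) -[y in y < _](lnK y0) ler_expR ltr_expR.
by apply/andP; split; [apply: le_trans h1|apply: lt_le_trans h2 _];
  rewrite le_eqVlt; apply/orP; left; apply/eqP; ring.
Qed.

Lemma sum_nat_shift (V : nmodType) (f : nat -> V) n M :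
  \sum_(n <= r < n + M) f r = \sum_(0 <= k < M) f (n + k)%N.
Proof.
by rewrite -{1}[n]add0n big_addn addKn; apply: eq_bigr => k _; rewrite addnC.
Qed.

(** There are r + 1 pairs (a, b) with a + b = r. When t decays
    geometrically only from index n on, the double sum behaves like n times the
    simple sum: with n the dyadic logarithm of y this is where the factor log y
    of the moment condition comes from. *)
Lemma double_tail_sum (R : realType) (t : nat -> R) (A D e : R) (n : nat) :
  0 < e -> (forall r, 0 <= t r) -> 0 <= D ->
  (forall M, \sum_(0 <= r < M) t r <= A) ->
  (forall k, t (n + k)%N <= D * 2 `^ (- e * k%:R)) ->
  (\sum_(a <oo) \sum_(b <oo) (t (a + b)%N)%:E <=
   (n%:R * A + D * geo_bound e ^+ 2)%:E)%E.
Proof.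
move=> e0 t0 D0 tA tD.
have G0 := geo_bound_ge0 e0.
have T0 a : (0 <= \sum_(b <oo) (t (a + b)%N)%:E)%E.
  by apply: nneseries_ge0 => b _ _; rewrite lee_fin.
rewrite (nneseries_split 0%N n) // add0n EFinD; apply: leeD.
  apply: (@le_trans _ _ (\sum_(0 <= a < n) A%:E)%E); last first.
    by rewrite sumEFin lee_fin sumr_const_nat subn0 mulr_natl.
  apply: lee_sum => a _.
  apply: nneseries_le_of_sums => [k|M]; first by rewrite lee_fin.
  rewrite sumEFin lee_fin; apply: le_trans (tA (a + M)%N).
  rewrite [leRHS](@big_cat_nat _ _ _ a) ?leq_addr //= -[leLHS]add0r.
  apply: lerD; first exact: sumr_ge0.
  by rewrite [leRHS]sum_nat_shift.
rewrite -(nneseries_addn n) //.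
apply: (@le_trans _ _ (\sum_(i <oo) (D * geo_bound e)%:E *
    (2 `^ (- e * i%:R))%:E)%E).
  apply: lee_nneseries => [i _ _|i _]; first exact: T0.
  apply: nneseries_le_of_sums => [k|M]; first by rewrite lee_fin.
  rewrite sumEFin -EFinM lee_fin.
  apply: (@le_trans _ _
      (\sum_(0 <= k < M) D * 2 `^ (- e * i%:R) * 2 `^ (- e * k%:R))).
    apply: ler_sum => k _; rewrite -addnA addnCA.
    by apply: le_trans (tD _) _; rewrite natrD mulrDr powR2D mulrA.
  rewrite -mulr_sumr -mulrA [leRHS]mulrAC -!mulrA ler_wpM2l //.
  by rewrite mulrC [leRHS]mulrC ler_wpM2r ?powR_ge0 ?geo_sum_le.
rewrite nneseriesZl; last by move=> i _; rewrite lee_fin powR_ge0.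
rewrite [D * _ ^+ 2]mulrA [leRHS]EFinM lee_wpmul2l ?lee_fin ?mulr_ge0 //.
apply: nneseries_le_of_sums => [k|M]; first by rewrite lee_fin powR_ge0.
by rewrite sumEFin lee_fin geo_sum_le.
Qed.

(** The s-th power of y truncated at 2^(al r), normalised so that its size is
    2^(al p r) below the scale of y, and decays geometrically above it. *)
Definition truncated_term (R : realType) (al p s y : R) (r : nat) : R :=
  2 `^ (- (al * (s - p)) * r%:R) * Num.min y (2 `^ (al * r%:R)) `^ s.

Lemma truncated_terms_le (R : realType) (al p s : R) :
  0 < al -> 0 < p -> p < s ->
  exists2 C : R, 0 <= C & forall y : R, 0 <= y ->
  (\sum_(a <oo) \sum_(b <oo) (truncated_term al p s y (a + b)%N)%:E <=
   (C * (y `^ p * log_max2 y))%:E)%E.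
Proof.
move=> al0 p0 ps.
have s0 : 0 < s by apply: lt_trans ps.
set e := al * (s - p); set f := al * p.
have e0 : 0 < e by rewrite mulr_gt0 // subr_gt0.
have f0 : 0 < f by rewrite mulr_gt0.
have G0 := geo_bound_ge0 e0; have F0 := geo_bound_ge0 f0.
have l2 := ln2_gt0 R.
set A := geo_bound f + geo_bound e.
have A0 : 0 <= A by rewrite addr_ge0.
have i1 : 0 <= (al * ln 2)^-1 by rewrite invr_ge0 mulr_ge0 // ltW.
have i2 : 0 <= (ln 2)^-1 :> R by rewrite invr_ge0 ltW.
exists (((al * ln 2)^-1 + (ln 2)^-1) * A + geo_bound e ^+ 2 / ln 2).
  by rewrite addr_ge0 ?mulr_ge0 ?addr_ge0 ?exprn_ge0.
move=> y y0.
have t0 r : 0 <= truncated_term al p s y r by rewrite mulr_ge0 ?powR_ge0.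
have tle r : truncated_term al p s y r <= 2 `^ (- e * r%:R) * y `^ s.
  rewrite ler_wpM2l ?powR_ge0 // ge0_ler_powR ?nnegrE ?(ltW s0) //.
    by rewrite le_min y0 powR_ge0.
  by rewrite ge_min lexx.
have yp0 := powR_ge0 y p.
have lm := log_max2_gt0 y.
have l1 : 1 <= log_max2 y / ln 2 by rewrite ler_pdivlMr ?mul1r ?ln2_le_log_max2.
have [y1|y1] := ltP y 1.
  apply: (@le_trans _ _ (0%:R * (y `^ p * geo_bound e) + y `^ p * geo_bound e ^+ 2)%:E).
    have h r : truncated_term al p s y r <= y `^ p * 2 `^ (- e * r%:R).
      apply: le_trans (tle r) _; rewrite mulrC ler_wpM2r ?powR_ge0 //.
      move: y0; rewrite le_eqVlt => /predU1P[<-|y0].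
        by rewrite !powR0 // gt_eqF.
      by apply: ger_powR; rewrite ?y0 ltW.
    apply: double_tail_sum => // M.
    apply: (@le_trans _ _ (\sum_(0 <= r < M) y `^ p * 2 `^ (- e * r%:R))).
      by apply: ler_sum.
    by rewrite -mulr_sumr ler_wpM2l // geo_sum_le.
  rewrite lee_fin mul0r add0r mulrC mulrDl -[leLHS]add0r lerD //.
    by rewrite !mulr_ge0 ?addr_ge0 // ltW.
  rewrite -mulrA ler_wpM2l ?exprn_ge0 // mulrCA ler_peMr //.
  by rewrite mulrC.
(* n is the scale of y: the terms grow geometrically up to n and decay after *)
have [n /andP[ny yn]] := dyadic_scale al0 y1.
have yp_lb : 2 `^ (f * n%:R) <= y `^ p.
  have -> : f * n%:R = (al * n%:R) * p by rewrite /f; ring.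
  by rewrite powRrM ge0_ler_powR ?nnegrE ?powR_ge0 // ltW.
have low r : (r <= n)%N -> truncated_term al p s y r <=
    y `^ p * 2 `^ (- f * (n - r)%:R).
  move=> rn; apply: (@le_trans _ _ (2 `^ (f * r%:R))).
    rewrite /truncated_term.
    have -> : f * r%:R = - e * r%:R + (al * r%:R) * s by rewrite /e /f; ring.
    rewrite powR2D ler_wpM2l ?powR_ge0 // [X in _ <= X]powRrM.
    rewrite ge0_ler_powR ?nnegrE ?powR_ge0 ?(ltW s0) //.
      by rewrite le_min y0 powR_ge0.
    by rewrite ge_min lexx orbT.
  have -> : f * r%:R = f * n%:R + - f * (n - r)%:R by rewrite natrB //; ring.
  by rewrite powR2D ler_wpM2r ?powR_ge0.
have high k : truncated_term al p s y (n.+1 + k)%N <=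
    y `^ p * 2 `^ (- e * k%:R).
  apply: le_trans (tle _) _.
  have -> : s = p + (s - p) by ring.
  have ypos : 0 < y by apply: lt_le_trans y1.
  rewrite powRD; last by apply/implyP => _; rewrite gt_eqF.
  rewrite mulrCA ler_wpM2l ?powR_ge0 // natrD mulrDr powR2D mulrAC.
  rewrite -[leRHS]mul1r ler_wpM2r ?powR_ge0 // mulrC.
  have -> : - e * n.+1%:R = - ((al * n.+1%:R) * (s - p)) by rewrite /e; ring.
  rewrite powRN ler_pdivrMr ?mul1r ?powR2_gt0 // powRrM.
  by rewrite ge0_ler_powR ?nnegrE ?powR_ge0 ?subr_ge0 // ltW.
have sums M : \sum_(0 <= r < M) truncated_term al p s y r <= y `^ p * A.
  apply: (@le_trans _ _ (\sum_(0 <= r < n.+1 + M) truncated_term al p s y r)).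
    by rewrite [leRHS](@big_cat_nat _ _ _ M) ?leq_addl //= lerDl sumr_ge0.
  rewrite (@big_cat_nat _ _ _ n.+1) ?leq_addr //= mulrDr; apply: lerD.
    apply: (@le_trans _ _ (\sum_(0 <= r < n.+1) y `^ p * 2 `^ (- f * (n - r)%:R))).
      by apply: ler_sum_nat => r /andP[_ rn]; apply: low.
    rewrite -mulr_sumr ler_wpM2l // big_nat_rev /= add0n.
    apply: le_trans (geo_sum_le n.+1 f0); apply: ler_sum_nat => r /andP[_ rn].
    by rewrite subSS subKn.
  rewrite [leLHS]sum_nat_shift.
  apply: (@le_trans _ _ (\sum_(0 <= r < M) y `^ p * 2 `^ (- e * r%:R))).
    by apply: ler_sum => k _; exact: high.
  by rewrite -mulr_sumr ler_wpM2l // geo_sum_le.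
apply: le_trans (double_tail_sum e0 t0 yp0 sums high) _.
rewrite lee_fin.
have hn : n.+1%:R <= ((al * ln 2)^-1 + (ln 2)^-1) * log_max2 y.
  rewrite -natr1 mulrDl; apply: lerD; last by rewrite mulrC.
  rewrite mulrC ler_pdivlMr ?mulr_gt0 //.
  have ypos : 0 < y by apply: lt_le_trans y1.
  apply: le_trans (ln_le_log_max2 ypos).
  rewrite -ler_expR lnK ?posrE //; apply: le_trans ny; rewrite powR2E ler_expR.
  by rewrite le_eqVlt; apply/orP; left; apply/eqP; ring.
rewrite [leRHS]mulrDl; apply: lerD; rewrite mulrACA.
  by rewrite [A * _]mulrC mulrACA ler_wpM2r ?mulr_ge0.
rewrite mulrC ler_peMr ?mulr_ge0 ?exprn_ge0 //.
by rewrite mulrC.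
Qed.

(** Conversely, at the scale n of z all n + 1 pairs with K + L = n contribute
    2^(al p n), which is z^p up to a constant, and n + 1 is of the order of log z. *)
Lemma moment_le_dyadic (R : realType) (al p : R) : 0 < al -> 0 < p ->
  exists2 C : R, 0 <= C & forall z : R, 0 <= z ->
  ((z `^ p * log_max2 z)%:E <= C%:E + C%:E * \sum_(K <oo) \sum_(L <oo)
     (2 `^ (al * p * (K + L)%:R) * (2 `^ (al * (K + L)%:R) <= z)%R%:R)%:E)%E.
Proof.
move=> al0 p0; have l2 := ln2_gt0 R.
set C := (2 `^ (al * p) * ((1 + al) * ln 2)).
have C0 : 0 <= C by rewrite !mulr_ge0 ?powR_ge0 // ?ltW // addr_gt0.
have lC : ln 2 <= C.
  rewrite /C mulrA -[leLHS]mul1r ler_wpM2r ?(ltW l2) // -[leLHS]mulr1.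
  apply: ler_pM => //; last by rewrite lerDl ltW.
  by have := @ler_powR2 R 0 (al * p); rewrite powRr0; apply; rewrite mulr_ge0 ?ltW.
exists C => // z z0.
set S := (\sum_(K <oo) _)%E.
have t0 K L : (0 <= (2 `^ (al * p * (K + L)%:R) * (2 `^ (al * (K + L)%:R) <= z)%R%:R)%:E)%E.
  by rewrite lee_fin mulr_ge0 ?powR_ge0.
have i0 K : (0 <= \sum_(L <oo)
     (2 `^ (al * p * (K + L)%:R) * (2 `^ (al * (K + L)%:R) <= z)%R%:R)%:E)%E.
  by apply: nneseries_ge0.
have S0 : (0 <= S)%E by apply: nneseries_ge0.
have [z1|z1] := ltP z 1.
  apply: (@le_trans _ _ C%:E); last by rewrite leeDl // mule_ge0.
  rewrite lee_fin; apply: le_trans lC; rewrite /log_max2 max_r; last first.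
    by rewrite (le_trans (ltW z1)) // ler1n.
  rewrite -[leRHS]mul1r ler_wpM2r ?(ltW l2) //.
  move: z0; rewrite le_eqVlt => /predU1P[<-|z0]; first by rewrite powR0 ?gt_eqF.
  rewrite -(powRr0 z); apply: ger_powR; rewrite ?z0 ltW //.
have zp : 0 < z by apply: lt_le_trans z1.
have [n /andP[nz zn]] := dyadic_scale al0 z1.
have hS : ((n.+1%:R * 2 `^ (al * p * n%:R))%:E <= S)%E.
  have : (\sum_(0 <= K < n.+1) \sum_(L <oo)
     (2 `^ (al * p * (K + L)%:R) * (2 `^ (al * (K + L)%:R) <= z)%R%:R)%:E <= S)%E.
    by apply: nneseries_lim_ge.
  apply: le_trans.
  apply: (@le_trans _ _ (\sum_(0 <= K < n.+1) (2 `^ (al * p * n%:R))%:E)%E).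
    by rewrite sumEFin lee_fin sumr_const_nat subn0 mulr_natl.
  rewrite big_nat [leRHS]big_nat; apply: lee_sum => K /andP[_ Kn].
  have : (\sum_(0 <= L < (n - K).+1)
     (2 `^ (al * p * (K + L)%:R) * (2 `^ (al * (K + L)%:R) <= z)%R%:R)%:E <=
     \sum_(L <oo)
     (2 `^ (al * p * (K + L)%:R) * (2 `^ (al * (K + L)%:R) <= z)%R%:R)%:E)%E.
    by apply: nneseries_lim_ge.
  apply: le_trans; rewrite big_nat_recr //= subnKC // nz mulr1.
  by rewrite leeDr // sume_ge0.
apply: (@le_trans _ _ (C%:E * S)%E); last by rewrite leeDr ?lee_fin.
apply: (@le_trans _ _ (C%:E * (n.+1%:R * 2 `^ (al * p * n%:R))%:E)%E); last first.
  by rewrite lee_wpmul2l.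
rewrite -EFinM lee_fin /C.
have -> : 2 `^ (al * p) * ((1 + al) * ln 2) * (n.+1%:R * 2 `^ (al * p * n%:R)) =
  2 `^ (al * p * n.+1%:R) * ((1 + al) * ln 2 * n.+1%:R).
  have -> : al * p * n.+1%:R = al * p + al * p * n%:R by rewrite -natr1; ring.
  by rewrite powR2D; ring.
apply: ler_pM; rewrite ?powR_ge0 //; first exact/ltW/log_max2_gt0.
  have -> : al * p * n.+1%:R = (al * n.+1%:R) * p by ring.
  by rewrite powRrM ge0_ler_powR ?nnegrE ?powR_ge0 // ltW.
have lz : ln z <= al * n.+1%:R * ln 2.
  rewrite -ler_expR lnK ?posrE // -powR2E; exact: ltW.
have n1 : ln 2 <= ln 2 * n.+1%:R :> R by rewrite ler_peMr ?ler1n // ltW.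
apply: (@le_trans _ _ (ln 2 + ln z)); last first.
  by rewrite mulrDl mulrDl mul1r mulrAC lerD.
rewrite /log_max2; have [h|h] := leP z 2.
  by rewrite lerDl ln_ge0.
by rewrite lerDr ltW.
Qed.

(** * Maxima of rectangular partial sums *)

Definition corner_sum (R : realType) (a : nat * nat -> R) (u v : nat) : R :=
  \sum_(i < u) \sum_(j < v) a (i.+1, j.+1).

Lemma corner_sumE (R : realType) (a : nat * nat -> R) u v :
  \sum_(1 <= i < u.+1) \sum_(1 <= j < v.+1) a (i, j) = corner_sum a u v.
Proof.
rewrite big_add1 /= big_mkord; apply: eq_bigr => i _.
by rewrite big_add1 /= big_mkord.
Qed.

Lemma max_rect_sum_ge0 (R : realType) (a : nat * nat -> R) m n :
  0 <= max_rect_sum a m n.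
Proof. exact: bigmax_ge_id. Qed.

Lemma corner_sum_le_max (R : realType) (a : nat * nat -> R) m n u v :
  (u <= m)%N -> (v <= n)%N -> `|corner_sum a u v| <= max_rect_sum a m n.
Proof.
case: u => [|u] um; first by rewrite /corner_sum big_ord0 normr0 max_rect_sum_ge0.
case: v => [|v] vn.
  rewrite /corner_sum big1 ?normr0 ?max_rect_sum_ge0 // => i _.
  by rewrite big_ord0.
rewrite -corner_sumE /max_rect_sum.
apply: (@bigmax_sup_seq _ _ _ _ _ u.+1) => //; first by rewrite mem_index_iota.
by apply: (@bigmax_sup_seq _ _ _ _ _ v.+1) => //; rewrite mem_index_iota.
Qed.

Lemma max_rect_sum_le (R : realType) (a : nat * nat -> R) m n (x : R) :
  0 <= x ->
  (forall u v, (u <= m)%N -> (v <= n)%N -> `|corner_sum a u v| <= x) ->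
  max_rect_sum a m n <= x.
Proof.
move=> x0 h; rewrite /max_rect_sum big_nat; apply: bigmax_le => // u /andP[_ um].
rewrite big_nat; apply: bigmax_le => // v /andP[_ vn].
by rewrite corner_sumE h.
Qed.

Lemma max_rect_sum_mono (R : realType) (a : nat * nat -> R) m n m' n' :
  (m <= m')%N -> (n <= n')%N -> max_rect_sum a m n <= max_rect_sum a m' n'.
Proof.
move=> mm nn; apply: max_rect_sum_le => [|u v um vn]; first exact: max_rect_sum_ge0.
by apply: corner_sum_le_max; [apply: leq_trans mm|apply: leq_trans nn].
Qed.

(** An entry is a combination of four corner sums. *)
Lemma entry_le_max (R : realType) (a : nat * nat -> R) m n i j :
  (i < m)%N -> (j < n)%N -> `|a (i.+1, j.+1)| <= 4 * max_rect_sum a m n.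
Proof.
move=> im jn.
have -> : a (i.+1, j.+1) = corner_sum a i.+1 j.+1 - corner_sum a i j.+1
    - (corner_sum a i.+1 j - corner_sum a i j).
  rewrite /corner_sum !big_ord_recr /= [X in X + _ - _]addrC addrK.
  by rewrite [X in _ - (X - _)]addrC addrK [X in X - _]addrC addrK.
apply: le_trans (ler_normB _ _) _.
have -> : 4 * max_rect_sum a m n = (max_rect_sum a m n + max_rect_sum a m n)
  + (max_rect_sum a m n + max_rect_sum a m n) by ring.
by apply: lerD; apply: le_trans (ler_normB _ _) _; apply: lerD;
  apply: corner_sum_le_max => //; exact: ltnW.
Qed.

Lemma corner_sumD (R : realType) (a b : nat * nat -> R) u v :
  corner_sum (fun ij => a ij + b ij) u v = corner_sum a u v + corner_sum b u v.
Proof.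
by rewrite /corner_sum -big_split; apply: eq_bigr => i _; rewrite -big_split.
Qed.

Lemma max_rect_sumB_le (R : realType) (a b : nat * nat -> R) m n :
  max_rect_sum (fun ij => a ij - b ij) m n <=
  max_rect_sum a m n + max_rect_sum b m n.
Proof.
apply: max_rect_sum_le => [|u v um vn]; first by rewrite addr_ge0 ?max_rect_sum_ge0.
rewrite corner_sumD; apply: le_trans (ler_normD _ _) _.
apply: lerD; first exact: corner_sum_le_max.
have -> : corner_sum (fun ij => - b ij) u v = - corner_sum b u v.
  by rewrite /corner_sum -sumrN; apply: eq_bigr => i _; rewrite sumrN.
by rewrite normrN corner_sum_le_max.
Qed.

Lemma max_rect_sum_ext (R : realType) (a b : nat * nat -> R) m n :
  (forall ij, pos_index ij -> a ij = b ij) ->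
  max_rect_sum a m n = max_rect_sum b m n.
Proof.
move=> ab; rewrite /max_rect_sum; apply: eq_bigr => u _; apply: eq_bigr => v _.
by rewrite !corner_sumE; congr (`| _ |); apply: eq_bigr => i _; apply: eq_bigr => j _; apply: ab.
Qed.

Lemma measurable_max_rect_sum d (T : measurableType d) (R : realType)
    (a : nat * nat -> T -> R) m n :
  (forall ij, measurable_fun setT (a ij)) ->
  measurable_fun setT (fun w => max_rect_sum (fun ij => a ij w) m n).
Proof.
move=> ma.
have mmax (s : seq nat) (f : nat -> T -> R) :
    (forall k, measurable_fun setT (f k)) ->
    measurable_fun setT (fun w => \big[Num.max/0]_(k <- s) f k w).
  move=> mf; elim: s => [|k s IH].
    by under eq_fun do rewrite big_nil; exact: measurable_cst.
  under eq_fun do rewrite big_cons; exact: measurable_maxr.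
apply: (mmax _ (fun u w => _)) => u; apply: (mmax _ (fun v w => _)) => v.
apply: measurableT_comp => //.
apply: measurable_sum => i; apply: measurable_sum => j; exact: ma.
Qed.

(** * Expectations and tail domination *)

Lemma measurable_gt d (T : measurableType d) (R : realType) (f : T -> R) (x : R) :
  measurable_fun setT f -> measurable [set w | x < f w].
Proof.
move=> mf; have := measurable_fun_ltr (measurable_cst x) mf.
move=> /(_ measurableT [set true]); rewrite setTI; exact.
Qed.

Lemma measurable_ge d (T : measurableType d) (R : realType) (f : T -> R) (x : R) :
  measurable_fun setT f -> measurable [set w | x <= f w].
Proof.
move=> mf; have := measurable_fun_ler (measurable_cst x) mf.
move=> /(_ measurableT [set true]); rewrite setTI; exact.
Qed.

Local Open Scope ereal_scope.

Lemma measurable_int_EFin d (T : measurableType d) (R : realType) (f : T -> R) :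
  measurable_fun setT f -> measurable_fun setT (fun w => (f w)%:E).
Proof. by move=> mf; apply/measurable_EFinP. Qed.

Lemma ge0_le_int d (T : measurableType d) (R : realType)
    (P : {measure set T -> \bar R}) (f g : T -> R) :
  measurable_fun setT f -> measurable_fun setT g ->
  (forall w, (0 <= f w)%R) -> (forall w, (f w <= g w)%R) ->
  \int[P]_w (f w)%:E <= \int[P]_w (g w)%:E.
Proof.
move=> mf mg f0 fg; apply: ge0_le_integral => //.
- by move=> w _; rewrite lee_fin.
- exact: measurable_int_EFin.
- exact: measurable_int_EFin.
- by move=> w _; rewrite lee_fin.
Qed.

Lemma int_ge0 d (T : measurableType d) (R : realType)
    (P : {measure set T -> \bar R}) (f : T -> R) :
  (forall w, (0 <= f w)%R) -> 0 <= \int[P]_w (f w)%:E.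
Proof. by move=> f0; apply: integral_ge0 => w _; rewrite lee_fin. Qed.

(** Integrate the tails: the expectation of a nonnegative variable is the integral
    of its complementary distribution function. *)
Lemma int_le_of_tails d (T : measurableType d) d' (T' : measurableType d')
    (R : realType) (P : probability T R) (Q : probability T' R)
    (U : T -> R) (V : T' -> R) :
  measurable_fun setT U -> measurable_fun setT V ->
  (forall w, (0 <= U w)%R) -> (forall w, (0 <= V w)%R) ->
  (forall r : R, (0 <= r)%R ->
     P [set w | (r < U w)%R] <= Q [set w | (r < V w)%R]) ->
  \int[P]_w (U w)%:E <= \int[Q]_w (V w)%:E.
Proof.
move=> mU mV U0 V0 h.
pose U' : {RV P >-> R} := mfun_Sub (mem_set mU).
pose V' : {RV Q >-> R} := mfun_Sub (mem_set mV).
have := @ge0_expectation_ccdf _ _ _ P U' U0; rewrite expectation_def => ->.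
have := @ge0_expectation_ccdf _ _ _ Q V' V0; rewrite expectation_def => ->.
apply: ge0_le_integral => //.
- by apply: measurable_funTS; exact: ccdf_measurable.
- by apply: measurable_funTS; exact: ccdf_measurable.
move=> r /=; rewrite in_itv /= andbT => r0.
have := h r r0; rewrite /ccdf /distribution /pushforward /=.
suff pre (S : Type) (f : S -> R) : f @^-1` `]r, +oo[ = [set w | (r < f w)%R].
  by rewrite !pre.
by apply/seteqP; split => w /=; rewrite in_itv /= andbT.
Qed.

Section domination.
Context d (T : measurableType d) d' (T' : measurableType d') (R : realType).
Context (P : probability T R) (Q : probability T' R).
Variables (W : T -> R) (Z : T' -> R).
Hypotheses (mW : measurable_fun setT W) (mZ : measurable_fun setT Z).
Hypotheses (W0 : forall w, (0 <= W w)%R) (Z0 : forall w, (0 <= Z w)%R).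
Hypothesis dom : forall x : R, (0 <= x)%R ->
  P [set w | (x < W w)%R] <= Q [set w | (x < Z w)%R].

Lemma dominated_excess (c : R) : (0 <= c)%R ->
  \int[P]_w (Num.max (W w - c) 0)%:E <= \int[Q]_w (Num.max (Z w - c) 0)%:E.
Proof.
move=> c0; apply: int_le_of_tails.
- by apply: measurable_maxr => //; exact: measurable_funB.
- by apply: measurable_maxr => //; exact: measurable_funB.
- by move=> w; rewrite le_max lexx orbT.
- by move=> w; rewrite le_max lexx orbT.
move=> r r0; have := dom (addr_ge0 r0 c0).
suff pre (S : Type) (f : S -> R) :
    [set w | (r < Num.max (f w - c) 0)%R] = [set w | (r + c < f w)%R].
  by rewrite !pre.
by apply/seteqP; split => w /=; rewrite lt_max [(r < 0)%R]ltNge r0 orbF ltrBrDr.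
Qed.

Lemma dominated_truncated_moment (c s : R) : (0 <= c)%R -> (0 < s)%R ->
  \int[P]_w (Num.min (W w) c `^ s)%:E <= \int[Q]_w (Num.min (Z w) c `^ s)%:E.
Proof.
move=> c0 s0; apply: int_le_of_tails.
- by apply: (measurableT_comp (measurable_powR _)) => //; exact: measurable_minr.
- by apply: (measurableT_comp (measurable_powR _)) => //; exact: measurable_minr.
- by move=> w; rewrite powR_ge0.
- by move=> w; rewrite powR_ge0.
move=> r r0.
have pre (S : Type) (f : S -> R) : (forall w, 0 <= f w)%R ->
    [set w | (r < Num.min (f w) c `^ s)%R] =
    [set w | ((r `^ s^-1 < f w) && (r `^ s^-1 < c))%R].
  move=> f0; have h w : (r < Num.min (f w) c `^ s)%R = (r `^ s^-1 < Num.min (f w) c)%R.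
    have m0 : (0 <= Num.min (f w) c)%R by rewrite le_min f0.
    have rs : ((r `^ s^-1) `^ s = r)%R by rewrite -powRrM mulVf ?gt_eqF ?powRr1.
    apply/idP/idP => hr.
      rewrite ltNge; apply/negP => hle; move: hr; rewrite ltNge => /negP; apply.
      by rewrite -rs ge0_ler_powR ?nnegrE ?powR_ge0 // ltW.
    by rewrite -rs gt0_ltr_powR ?nnegrE ?powR_ge0.
  by apply/seteqP; split => w /=; rewrite h lt_min.
rewrite !pre //; have [rc|rc] := ltP (r `^ s^-1)%R c.
  by under eq_fun do rewrite andbT; under [X in _ <= Q X]eq_fun do rewrite andbT;
     apply: dom; exact: powR_ge0.
under eq_fun do rewrite andbF; under [X in _ <= Q X]eq_fun do rewrite andbF.
have e0 (S : Type) : [set _ : S | false] = set0 by apply/seteqP; split.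
by rewrite !e0 !measure0.
Qed.

End domination.

Local Close Scope ereal_scope.

(** * Consequences of the moment hypotheses *)

(** The inequality of Condition (H_2q) in the form used below: one function f for
    all indices, explicit bounds M and V in place of the maxima, a nonnegative
    constant. For nonincreasing f it is applied to - f; this is how the
    negative parts of the variables are reached. *)
Lemma condition_H2q_bound d (T : measurableType d) (R : realType)
    (P : probability T R) (L : choiceType) (D : set L) (X : L -> {RV P >-> R})
    (q : R) :
  1 <= q -> condition_H2q D X q ->
  exists2 C : R, 0 <= C & forall (I : {fset L}) (f : R -> R) (M V : R),
    (forall l, l \in I -> D l) ->
    ({homo f : x y / x <= y} \/ {homo f : x y /~ x <= y}) ->
    (forall x, 0 <= f x) -> 0 <= M -> 0 <= V ->
    (forall l, l \in I -> (\int[P]_w (f (X l w) `^ (2 * q))%:E <= M%:E)%E) ->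
    (forall l, l \in I -> (\int[P]_w (f (X l w) ^+ 2)%:E <= V%:E)%E) ->
    (\int[P]_w (`|\sum_(l <- I) (f (X l w) - fine (\int[P]_w' (f (X l w'))%:E))|
       `^ (2 * q))%:E
     <= (C * (#|` I|%:R * M + #|` I|%:R `^ q * V `^ q))%:E)%E.
Proof.
move=> q1 [C HC]; exists (Num.max C 0); first by rewrite le_max lexx orbT.
have q0 : 0 <= q by apply: le_trans q1.
move=> I f M V ID fmon f0 M0 V0 hM hV.
have key (g : R -> R) : {homo g : x y / x <= y} -> (forall x, `|g x| = f x) ->
    (forall x, g x ^+ 2 = f x ^+ 2) ->
    (\int[P]_w (`|\sum_(l <- I) (g (X l w) - fine (\int[P]_w' (g (X l w'))%:E))|
       `^ (2 * q))%:E
     <= (Num.max C 0 * (#|` I|%:R * M + #|` I|%:R `^ q * V `^ q))%:E)%E.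
  move=> gmon gf gf2.
  have eqM l : ('E_P[fun w => (`|g (X l w)| `^ (2 * q))%R] =
      \int[P]_w (f (X l w) `^ (2 * q))%:E)%E.
    by rewrite unlock; under eq_integral do rewrite gf.
  have eqV l : ('E_P[fun w => (g (X l w) ^+ 2)%R] =
      \int[P]_w (f (X l w) ^+ 2)%:E)%E.
    by rewrite unlock; under eq_integral do rewrite gf2.
  have := HC I (fun=> g) ID (fun _ _ => gmon).
  have -> : 'E_P[fun w : T => (`|\sum_(l <- I) (g (X l w) - fine 'E_P[fun w' => g (X l w')]%E)|
      `^ (2 * q))%R]%E = (\int[P]_w (`|\sum_(l <- I) (g (X l w) -
        fine (\int[P]_w' (g (X l w'))%:E))| `^ (2 * q))%:E)%E by rewrite unlock.
  move=> h; apply: le_trans (h _) _.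
    by move=> l lI; rewrite eqM; apply: le_lt_trans (hM l lI) _; rewrite ltry.
  have B1 : (\big[maxe/0]_(l <- I) 'E_P[fun w : T => (`|g (X l w)| `^ (2 * q))%R] <= M%:E)%E.
    rewrite big_seq; apply: bigmax_le => [|l lI]; first by rewrite lee_fin.
    by rewrite eqM hM.
  have B2 : (\big[maxe/0]_(l <- I) ('E_P[fun w : T => (g (X l w) ^+ 2)%R] `^ q)
      <= (V `^ q)%:E)%E.
    rewrite big_seq; apply: bigmax_le => [|l lI]; first by rewrite lee_fin powR_ge0.
    rewrite eqV -poweR_EFin; apply: gt0_ler_poweR => //.
    - by rewrite in_itv /= leey andbT int_ge0 // => w; rewrite sqr_ge0.
    - by rewrite in_itv /= leey andbT lee_fin.
    - exact: hV.
  have B1' : (0 <= \big[maxe/0]_(l <- I) 'E_P[fun w : T => (`|g (X l w)| `^ (2 * q))%R])%E.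
    exact: bigmax_ge_id.
  have B2' : (0 <= \big[maxe/0]_(l <- I) ('E_P[fun w : T => (g (X l w) ^+ 2)%R] `^ q))%E.
    exact: bigmax_ge_id.
  rewrite EFinM EFinD !EFinM.
  have n0 : (0 <= #|` I|%:R%:E :> \bar R)%E by rewrite lee_fin.
  have nq0 : (0 <= (#|` I|%:R `^ q)%:E :> \bar R)%E by rewrite lee_fin powR_ge0.
  apply: (@le_trans _ _ ((Num.max C 0)%:E * (#|` I|%:R%:E *
           \big[maxe/0]_(l <- I) 'E_P[fun w => (`|g (X l w)| `^ (2 * q))%R]
         + ((#|` I|%:R `^ q)%R)%:E *
           \big[maxe/0]_(l <- I) ('E_P[fun w => (g (X l w) ^+ 2)%R] `^ q)))%E).
    apply: lee_wpmul2r; last by rewrite lee_fin le_max lexx.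
    by rewrite adde_ge0 ?mule_ge0.
  apply: lee_wpmul2l; first by rewrite lee_fin le_max lexx orbT.
  by apply: leeD; apply: lee_wpmul2l.
case: fmon => fmon.
  by apply: key => // x; rewrite ger0_norm.
have h := key (fun x => - f x).
have eN l : fine (\int[P]_w' (- f (X l w'))%:E) = - fine (\int[P]_w' (f (X l w'))%:E).
  rewrite (_ : (\int[P]_w' (- f (X l w'))%:E)%E = (- \int[P]_w' (f (X l w'))%:E)%E).
    by rewrite fineN.
  by rewrite -integral_ge0N // => x _; rewrite lee_fin.
rewrite (_ : (\int[P]_w _)%E = (\int[P]_w (`|\sum_(l <- I)
    (- f (X l w) - fine (\int[P]_w' (- f (X l w'))%:E))| `^ (2 * q))%:E)%E).
  apply: h => [x y xy|x|x]; first by rewrite lerN2 fmon.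
    by rewrite normrN ger0_norm.
  by rewrite sqrrN.
apply: eq_integral => w _; rewrite -normrN -sumrN.
by under eq_bigr do rewrite opprB addrC -[fine _]opprK -eN.
Qed.

Lemma powR2_unbounded (R : realType) (e x : R) : 0 < e ->
  exists n0 : nat, forall n, (n0 <= n)%N -> x <= 2 `^ (e * n%:R).
Proof.
move=> e0; have x1 : 1 <= Num.max 1 x by rewrite le_max lexx.
have [n /andP[_ hn]] := dyadic_scale e0 x1.
exists n.+1 => m nm; apply: (@le_trans _ _ (2 `^ (e * n.+1%:R))).
  by apply: le_trans (ltW hn); rewrite le_max lexx orbT.
by rewrite ler_powR2 // ler_pM2l // ler_nat.
Qed.

(** The mean excess of Z over 2^(al r) is o(2^((al - 1) r)): where Z exceeds this
    level, 2^((1 - al) r) is at most Z^(p-1) because 1 - al <= al (p - 1), so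
    that Z^p dominates, and the excess vanishes pointwise as r grows. *)
Section excess.
Context d (T : measurableType d) (R : realType) (Q : probability T R).
Variables (Z : T -> R) (al p : R).
Hypotheses (mZ : measurable_fun setT Z) (Z0 : forall w, 0 <= Z w).
Hypotheses (al0 : 0 < al) (alp : 1 <= al * p) (p1 : 1 <= p).
Hypothesis Zp : (\int[Q]_w (Z w `^ p)%:E < +oo)%E.

Let f (r : nat) (w : T) : R :=
  2 `^ ((1 - al) * r%:R) * Num.max (Z w - 2 `^ (al * r%:R)) 0.

Let f0 r w : 0 <= f r w.
Proof. by rewrite mulr_ge0 ?powR_ge0 // le_max lexx orbT. Qed.

Let mexcess r : measurable_fun setT (fun w => Num.max (Z w - 2 `^ (al * r%:R)) 0).
Proof. by apply: measurable_maxr => //; exact: measurable_funB. Qed.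

Let mf r : measurable_fun setT (f r).
Proof. exact: measurable_funM. Qed.

Let mZp : measurable_fun setT (fun w => Z w `^ p).
Proof. exact: (measurableT_comp (measurable_powR _)). Qed.

Let f_le r w : f r w <= Z w `^ p.
Proof.
have p0 : 0 < p by apply: lt_le_trans p1.
rewrite /f; set c := 2 `^ (al * r%:R).
have c0 : 0 < c := powR2_gt0 _.
have [h|h] := leP (Z w - c) 0; first by rewrite mulr0 powR_ge0.
have cZ : c < Z w by rewrite -subr_gt0.
have h1 : 2 `^ ((1 - al) * r%:R) <= Z w `^ (p - 1).
  apply: (@le_trans _ _ (c `^ (p - 1))).
    rewrite /c -powRrM ler_powR2 // mulrAC ler_wpM2r //.
    by rewrite mulrBr mulr1 lerD2r.
  by rewrite ge0_ler_powR ?nnegrE ?subr_ge0 // ltW.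
rewrite -(mulr_powRB1 (Z0 w) p0) mulrC; apply: ler_pM; rewrite ?powR_ge0 //.
  exact: ltW.
by rewrite lerBlDr lerDl ltW.
Qed.

Let scaled_excess r :
  (\int[Q]_w (f r w)%:E = (2 `^ ((1 - al) * r%:R))%:E *
     \int[Q]_w (Num.max (Z w - 2 `^ (al * r%:R)) 0)%:E)%E.
Proof.
rewrite -ge0_integralZl_EFin ?powR_ge0 //.
- by move=> w _; rewrite lee_fin le_max lexx orbT.
- exact: measurable_int_EFin.
Qed.

Lemma excess_fin_num r :
  (\int[Q]_w (Num.max (Z w - 2 `^ (al * r%:R)) 0)%:E)%E \is a fin_num.
Proof.
have e0 : (0 <= \int[Q]_w (Num.max (Z w - 2 `^ (al * r%:R)) 0)%:E)%E.
  by apply: int_ge0 => w; rewrite le_max lexx orbT.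
have h : (\int[Q]_w (f r w)%:E < +oo)%E.
  by apply: le_lt_trans Zp; apply: ge0_le_int.
rewrite ge0_fin_numE //; move: h e0; rewrite scaled_excess.
case: (integral _ _ _) => [x _ _| |//]; first exact: ltry.
by rewrite gt0_muley ?lte_fin ?powR2_gt0.
Qed.

Let E (r : nat) : R := fine (\int[Q]_w (Num.max (Z w - 2 `^ (al * r%:R)) 0)%:E)%E.

Lemma excess_ge0 r : 0 <= E r.
Proof.
by apply: fine_ge0; apply: int_ge0 => w; rewrite le_max lexx orbT.
Qed.

Let scaledE r : (\int[Q]_w (f r w)%:E)%E = (2 `^ ((1 - al) * r%:R) * E r)%:E.
Proof. by rewrite scaled_excess EFinM /E fineK // excess_fin_num. Qed.

Lemma excess_bounded r :
  2 `^ ((1 - al) * r%:R) * E r <= fine (\int[Q]_w (Z w `^ p)%:E)%E.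
Proof.
rewrite -lee_fin fineK; last first.
  by rewrite ge0_fin_numE // int_ge0 // => w; rewrite powR_ge0.
by rewrite -scaledE; apply: ge0_le_int.
Qed.

Lemma excess_limit : (fun r : nat => 2 `^ ((1 - al) * r%:R) * E r) @ \oo --> (0 : R).
Proof.
have : (fun r : nat => \int[Q]_w (f r w)%:E)%E @ \oo --> (\int[Q]_w (0 : R)%:E)%E.
  apply: (@dominated_cvg _ _ _ Q setT measurableT _ _ (fun w => (Z w `^ p)%:E)).
  - by move=> r; exact: measurable_int_EFin.
  - move=> w _; apply: cvg_near_cst.
    have [n0 hn] := powR2_unbounded (Z w) al0.
    exists n0 => // r /= nr; rewrite /f max_r ?mulr0 // subr_le0.
    exact: hn.
  - by [].
  - apply/integrableP; split; first exact: measurable_int_EFin.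
    by under eq_integral do rewrite gee0_abs ?lee_fin ?powR_ge0 //.
  - by move=> r w _; rewrite gee0_abs ?lee_fin.
rewrite integral0.
under eq_fun do rewrite scaledE.
by move/fine_cvgP => [_].
Qed.

End excess.

Lemma geo_sum_up_le (R : realType) (e : R) (K : nat) : 0 < e ->
  \sum_(0 <= a < K.+1) 2 `^ (e * a%:R) <= geo_bound e * 2 `^ (e * K%:R).
Proof.
move=> e0; rewrite mulrC.
apply: (@le_trans _ _ (2 `^ (e * K%:R) * \sum_(0 <= k < K.+1) 2 `^ (- e * k%:R))).
  rewrite big_nat_rev /= add0n mulr_sumr; apply: ler_sum_nat => a /andP[_ aK].
  rewrite subSS natrB // mulrBr powR2D.
  by rewrite le_eqVlt -powR2D; apply/orP; left; apply/eqP; rewrite -powR2D; congr (2 `^ _); ring.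
by rewrite ler_wpM2l ?powR_ge0 // geo_sum_le.
Qed.

Lemma geo_sum2_up_le (R : realType) (e : R) (K L : nat) : 0 < e ->
  \sum_(0 <= a < K.+1) \sum_(0 <= b < L.+1) 2 `^ (e * (a + b)%:R) <=
  geo_bound e ^+ 2 * 2 `^ (e * (K + L)%:R).
Proof.
move=> e0.
have -> : \sum_(0 <= a < K.+1) \sum_(0 <= b < L.+1) 2 `^ (e * (a + b)%:R) =
    (\sum_(0 <= a < K.+1) 2 `^ (e * a%:R)) * (\sum_(0 <= b < L.+1) 2 `^ (e * b%:R)).
  rewrite big_distrl /=; apply: eq_bigr => a _; rewrite big_distrr /=.
  by apply: eq_bigr => b _; rewrite natrD mulrDr powR2D.
rewrite natrD mulrDr powR2D expr2 mulrACA.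
by apply: ler_pM; rewrite ?sumr_ge0 ?geo_sum_up_le // => ? _; rewrite powR_ge0.
Qed.

(** The price of changing truncation levels in [rect_chaining] is negligible:
    with psi r = 2^((1 - al) r) zeta r, the sum is that of 2^(al (a + b)) psi(a + b),
    a geometric sum dominated by its last terms, and psi tends to 0. *)
Lemma weighted_null_sum (R : realType) (al : R) (zeta : nat -> R) (B : R) :
  0 < al -> (forall r, 0 <= zeta r) ->
  (forall r, 2 `^ ((1 - al) * r%:R) * zeta r <= B) ->
  (fun r : nat => 2 `^ ((1 - al) * r%:R) * zeta r) @ \oo --> (0 : R) ->
  forall del : R, 0 < del -> exists N0 : nat, forall K L, (N0 <= K + L)%N ->
    \sum_(0 <= a < K.+1) \sum_(0 <= b < L.+1) 2 ^+ (a + b) * zeta (a + b)%N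
    <= del * 2 `^ (al * (K + L)%:R).
Proof.
move=> al0 z0 zB zlim del del0.
have B0 : 0 <= B by apply: le_trans (zB 0%N); rewrite mulr_ge0 ?powR_ge0.
have h0 : 0 < al / 2 by rewrite divr_gt0.
set G := geo_bound al; set H := geo_bound (al / 2).
have G0 : 0 <= G ^+ 2 by rewrite exprn_ge0 // geo_bound_ge0.
have H0 : 0 <= H ^+ 2 by rewrite exprn_ge0 // geo_bound_ge0.
set d1 := del / 2 / (G ^+ 2 + 1).
have d10 : 0 < d1 by rewrite !divr_gt0 // ltr_wpDl.
have [r0 _ hr0] : \forall r \near \oo, 2 `^ ((1 - al) * r%:R) * zeta r <= d1.
  have := cvgr_le 0 zlim; apply; exact: d10.
set B' := B * 2 `^ (al / 2 * r0%:R).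
have B'0 : 0 <= B' by rewrite mulr_ge0 ?powR_ge0.
(* small for large r; for small r the bound B is absorbed in a lower power *)
have zb r : 2 ^+ r * zeta r <= d1 * 2 `^ (al * r%:R) + B' * 2 `^ (al / 2 * r%:R).
  have -> : 2 ^+ r * zeta r = 2 `^ (al * r%:R) * (2 `^ ((1 - al) * r%:R) * zeta r).
    by rewrite mulrA -powR2D -mulrDl addrC subrK mul1r powR2_nat.
  have [rr|rr] := leqP r0 r.
    rewrite -[leLHS]addr0; apply: lerD; last by rewrite mulr_ge0 ?powR_ge0.
    rewrite mulrC ler_wpM2r ?powR_ge0 //; exact: hr0.
  rewrite -[leLHS]add0r; apply: lerD; first by rewrite mulr_ge0 ?powR_ge0 // ltW.
  rewrite mulrC; apply: (@le_trans _ _ (B * 2 `^ (al * r%:R))).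
    by rewrite ler_wpM2r ?powR_ge0.
  rewrite /B' -mulrA ler_wpM2l // -powR2D ler_powR2 //.
  have -> : al * r%:R = al / 2 * r%:R + al / 2 * r%:R by field.
  by rewrite lerD2r ler_pM2l // ler_nat ltnW.
have [N0 hN] := powR2_unbounded (2 * (B' * H ^+ 2) / del) h0.
exists N0 => K L /hN hKL.
apply: (@le_trans _ _ (\sum_(0 <= a < K.+1) \sum_(0 <= b < L.+1)
   (d1 * 2 `^ (al * (a + b)%:R) + B' * 2 `^ (al / 2 * (a + b)%:R)))).
  by apply: ler_sum => a _; apply: ler_sum => b _.
under eq_bigr do rewrite big_split /= -!mulr_sumr.
rewrite big_split /= -!mulr_sumr.
set N := (K + L)%N in hKL *.
have -> : del * 2 `^ (al * N%:R) = del / 2 * 2 `^ (al * N%:R) + del / 2 * 2 `^ (al * N%:R).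
  by field.
apply: lerD.
  apply: (@le_trans _ _ (d1 * (G ^+ 2 * 2 `^ (al * N%:R)))).
    by rewrite ler_pM2l // geo_sum2_up_le.
  rewrite mulrA ler_wpM2r ?powR_ge0 // /d1 mulrAC ler_pdivrMr ?ltr_wpDl //.
  by rewrite ler_pM2l ?divr_gt0 // lerDl.
apply: (@le_trans _ _ (B' * (H ^+ 2 * 2 `^ (al / 2 * N%:R)))).
  by rewrite ler_wpM2l // geo_sum2_up_le.
have -> : al * N%:R = al / 2 * N%:R + al / 2 * N%:R by field.
rewrite powR2D !mulrA ler_wpM2r ?powR_ge0 //.
move: hKL; rewrite ler_pdivrMr // expr2; lra.
Qed.

(** * Maximal bound for one dyadic rectangle *)

Definition rect_seq (i0 n1 j0 n2 : nat) : seq (nat * nat) :=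
  [seq (i.+1, j.+1) | i <- index_iota i0 (i0 + n1), j <- index_iota j0 (j0 + n2)].

Definition rect_index (i0 n1 j0 n2 : nat) : {fset nat * nat} :=
  seq_fset tt (rect_seq i0 n1 j0 n2).

Lemma rect_seq_uniq i0 n1 j0 n2 : uniq (rect_seq i0 n1 j0 n2).
Proof. by apply: allpairs_uniq; rewrite ?iota_uniq // => -[a b] [a' b'] _ _ [-> ->]. Qed.

Lemma big_rect_index (V : nmodType) (F : nat * nat -> V) i0 n1 j0 n2 :
  \sum_(l <- rect_index i0 n1 j0 n2) F l =
  \sum_(i0 <= i < i0 + n1) \sum_(j0 <= j < j0 + n2) F (i.+1, j.+1).
Proof.
rewrite (perm_big _ (seq_fset_perm _ _)) undup_id ?rect_seq_uniq //.
by rewrite big_allpairs_dep.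
Qed.

Lemma card_rect_index i0 n1 j0 n2 : #|` rect_index i0 n1 j0 n2| = (n1 * n2)%N.
Proof.
rewrite size_seq_fset undup_id ?rect_seq_uniq // size_allpairs.
by rewrite !size_iota !addKn.
Qed.

Lemma rect_index_pos i0 n1 j0 n2 l : l \in rect_index i0 n1 j0 n2 -> pos_index l.
Proof. by rewrite seq_fsetE => /allpairsP[[i j] [_ _ ->]]. Qed.

Lemma int_sum_le d (T : measurableType d) (R : realType)
    (P : {measure set T -> \bar R}) (I : Type) (s : seq I) (F : I -> T -> R)
    (B : I -> R) :
  (forall i, measurable_fun setT (F i)) -> (forall i w, 0 <= F i w) ->
  (forall i, (\int[P]_w (F i w)%:E <= (B i)%:E)%E) ->
  (\int[P]_w (\sum_(i <- s) F i w)%:E <= (\sum_(i <- s) B i)%:E)%E.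
Proof.
move=> mF F0 FB; under eq_integral do rewrite -sumEFin.
rewrite ge0_integral_sum //; last first.
- by move=> i w _; rewrite lee_fin.
- by move=> i; exact: measurable_int_EFin.
by rewrite -sumEFin; apply: lee_sum => i _.
Qed.

Lemma prob_le_int d (T : measurableType d) (R : realType)
    (P : probability T R) (E : set T) (G : T -> R) :
  measurable E -> measurable_fun setT G -> (forall w, 0 <= G w) ->
  (forall w, E w -> 1 <= G w) -> (P E <= \int[P]_w (G w)%:E)%E.
Proof.
move=> mE mG G0 G1.
have -> : P E = (\int[P]_w (\1_E w)%:E)%E by rewrite integral_indic // setIT.
apply: ge0_le_int => // w.
by rewrite indicE; case: (boolP (w \in E)) => // /set_mem /G1.
Qed.

Lemma powR_div (R : realType) (x l s : R) : 0 <= x -> 0 < l ->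
  (x / l) `^ s = x `^ s / l `^ s.
Proof.
move=> x0 l0; rewrite powRM ?invr_ge0 ?(ltW l0) //; congr (_ * _).
by rewrite -powR_inv1 ?(ltW l0) // -powRrM mulN1r powRN.
Qed.

Lemma int_divr_le d (T : measurableType d) (R : realType)
    (P : {measure set T -> \bar R}) (f : T -> R) (B k : R) :
  measurable_fun setT f -> (forall w, 0 <= f w) -> 0 < k ->
  (\int[P]_w (f w)%:E <= B%:E)%E -> (\int[P]_w (f w / k)%:E <= (B / k)%:E)%E.
Proof.
move=> mf f0 k0 fB.
have -> : (\int[P]_w (f w / k)%:E = (k^-1)%:E * \int[P]_w (f w)%:E)%E.
  rewrite -ge0_integralZl_EFin ?invr_ge0 ?(ltW k0) //.
  - by under [RHS]eq_integral do rewrite -EFinM mulrC.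
  - by move=> w _; rewrite lee_fin.
  - exact: measurable_int_EFin.
by rewrite mulrC EFinM lee_wpmul2l // lee_fin invr_ge0 ltW.
Qed.

(** Throughout this section W is a nonnegative array whose truncations at the levels
    2^(al r) satisfy a moment inequality with parameters M r and V r, and
    whose truncated means vary by at most zeta r. In [rect_chaining], rectangles
    of size 2^a by 2^b are summed with truncation level 2^(al (a + b)). *)
Section truncated_array.
Context d (T : measurableType d) (R : realType) (P : probability T R).
Variables (W : nat * nat -> T -> R) (al p q C : R) (M V zeta : nat -> R).
Hypotheses (mW : forall l, measurable_fun setT (W l)) (W0 : forall l w, 0 <= W l w).
Hypotheses (al0 : 0 < al) (q1 : 1 <= q) (ps : p < 2 * q).
Hypotheses (C0 : 0 <= C) (M0 : forall r, 0 <= M r) (z0 : forall r, 0 <= zeta r).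

Definition truncation (r : nat) (x : R) : R := Num.min x (2 `^ (al * r%:R)).

Definition truncated_mean (r : nat) (l : nat * nat) : R :=
  fine (\int[P]_w (truncation r (W l w))%:E).

Definition full_mean (l : nat * nat) : R := fine (\int[P]_w (W l w)%:E).

Hypothesis moments : forall (I : {fset nat * nat}) r,
  (forall l, l \in I -> pos_index l) ->
  (\int[P]_w (`|\sum_(l <- I) (truncation r (W l w) - truncated_mean r l)| `^ (2 * q))%:E
   <= (C * (#|` I|%:R * M r + #|` I|%:R `^ q * V r `^ q))%:E)%E.
Hypothesis moment1 : forall l r, pos_index l ->
  (\int[P]_w (truncation r (W l w) `^ (2 * q))%:E <= (M r)%:E)%E.
Hypothesis mean_step : forall l r, pos_index l ->
  truncated_mean r.+1 l - truncated_mean r l <= zeta r.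
Hypothesis mean_tail : forall l r, pos_index l ->
  `|full_mean l - truncated_mean r l| <= zeta r.

Let gam := al * (2 * q - p) / 2.
Let bet := gam / (2 * q).
Let G := geo_bound bet.

Let q0 : 0 < q. Proof. exact: lt_le_trans q1. Qed.
Let gam0 : 0 < gam.
Proof. by rewrite divr_gt0 // mulr_gt0 // subr_gt0. Qed.
Let bet0 : 0 < bet. Proof. by rewrite divr_gt0 // mulr_gt0. Qed.

Let g (w : T) (r i j : nat) : R :=
  truncation r (W (i.+1, j.+1) w) - truncated_mean r (i.+1, j.+1).

Let mtrunc r l : measurable_fun setT (fun w => truncation r (W l w)).
Proof. exact: measurable_minr. Qed.

Let mg r i j : measurable_fun setT (fun w => g w r i j).
Proof. exact: measurable_funB. Qed.

Lemma truncation_ge0 r x : 0 <= x -> 0 <= truncation r x.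
Proof. by move=> x0; rewrite le_min x0 powR_ge0. Qed.

Let mrect r a b s t :
  measurable_fun setT (fun w => dyadic_rect (g w r) a b s t).
Proof. by apply: measurable_sum => i; apply: measurable_sum => j; exact: mg. Qed.

Let rect_moment r a b s t :
  (\int[P]_w (`|dyadic_rect (g w r) a b s t| `^ (2 * q))%:E
   <= (C * (2 `^ (a + b)%:R * M r + 2 `^ (q * (a + b)%:R) * V r `^ q))%:E)%E.
Proof.
have := @moments (rect_index (s * 2 ^ a) (2 ^ a) (t * 2 ^ b) (2 ^ b)) r
  (@rect_index_pos _ _ _ _).
under eq_integral do rewrite big_rect_index.
rewrite card_rect_index -expnD natrX.
suff -> : (2 ^+ (a + b)) `^ q = 2 `^ (q * (a + b)%:R) :> R by rewrite powR2_nat.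
by rewrite -powR2_nat -powRrM mulrC.
Qed.

Variable eps : R.
Hypothesis eps0 : 0 < eps.

Let eta := eps / (32 * (G ^+ 2 + 1)).

Let G2 : 0 <= G ^+ 2. Proof. by rewrite exprn_ge0 // geo_bound_ge0. Qed.

Let eta0 : 0 < eta.
Proof. by rewrite divr_gt0 // mulr_gt0 // ltr_wpDl. Qed.

(** The threshold for rectangles with a + b = r: geometrically smaller than
   2^(al N) as r decreases, so that the sum over all (a, b) stays below
   eps 2^(al N), but slowly enough for the moment bounds to stay summable. *)
Let level (N r : nat) : R := eta * 2 `^ (al * N%:R - bet * (N%:R - r%:R)).

Let level0 N r : 0 < level N r.
Proof. by rewrite mulr_gt0 // powR2_gt0. Qed.

Let level_sum K L :
  16 * (\sum_(0 <= a < K.+1) \sum_(0 <= b < L.+1) level (K + L) (a + b))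
  <= eps / 2 * 2 `^ (al * (K + L)%:R).
Proof.
set N := (K + L)%N.
have -> : \sum_(0 <= a < K.+1) \sum_(0 <= b < L.+1) level N (a + b) =
    eta * 2 `^ (al * N%:R - bet * N%:R) *
    \sum_(0 <= a < K.+1) \sum_(0 <= b < L.+1) 2 `^ (bet * (a + b)%:R).
  rewrite mulr_sumr; apply: eq_bigr => a _; rewrite mulr_sumr.
  apply: eq_bigr => b _; rewrite /level -mulrA -powR2D.
  by congr (_ * 2 `^ _); ring.
have h := geo_sum2_up_le K L bet0; rewrite -/N -/G in h.
apply: (@le_trans _ _ (16 * (eta * 2 `^ (al * N%:R - bet * N%:R) *
   (G ^+ 2 * 2 `^ (bet * N%:R))))).
  by rewrite ler_pM2l // ler_pM2l // mulr_gt0 // powR2_gt0.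
have -> : 16 * (eta * 2 `^ (al * N%:R - bet * N%:R) * (G ^+ 2 * 2 `^ (bet * N%:R))) =
   16 * (eta * G ^+ 2) * 2 `^ (al * N%:R).
  have -> : 2 `^ (al * N%:R) = 2 `^ (al * N%:R - bet * N%:R) * 2 `^ (bet * N%:R) :> R.
    by rewrite -powR2D subrK.
  by ring.
rewrite ler_wpM2r ?powR_ge0 // /eta.
have h1 : 0 < G ^+ 2 + 1 by rewrite ltr_wpDl.
have -> : 16 * (eps / (32 * (G ^+ 2 + 1)) * G ^+ 2) = eps / 2 * (G ^+ 2 / (G ^+ 2 + 1)).
  by field; rewrite gt_eqF.
by rewrite ler_piMr ?divr_ge0 ?(ltW eps0) // ler_pdivrMr // mul1r lerDl.
Qed.

(** If the maximum is large then some term of this sum is at least 1: either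
   a rectangle exceeds its threshold, or an entry exceeds the top truncation
   level. Integrating it replaces a union bound followed by the Markov inequality. *)
Let Gfun (K L : nat) (w : T) : R :=
  \sum_(0 <= a < K.+1) \sum_(0 <= b < L.+1)
    \sum_(0 <= s < 2 ^ (K - a)) \sum_(0 <= t < 2 ^ (L - b))
      (`|dyadic_rect (g w (a + b)%N) a b s t| / level (K + L) (a + b)) `^ (2 * q)
  + \sum_(0 <= i < 2 ^ K) \sum_(0 <= j < 2 ^ L)
      (truncation (K + L) (W (i.+1, j.+1) w) / 2 `^ (al * (K + L)%:R)) `^ (2 * q).

Let tq0 : 0 < 2 * q. Proof. by rewrite mulr_gt0. Qed.

Let powR_lt1 (x : R) : 0 <= x -> x `^ (2 * q) < 1 -> x < 1.
Proof.
move=> x0; apply: contraTT; rewrite -!leNgt => x1.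
apply: (@le_trans _ _ (1 `^ (2 * q))); first by rewrite powR1.
by rewrite ge0_ler_powR ?nnegrE // ltW.
Qed.

Let event_le (K L : nat) w :
  16 * (\sum_(0 <= a < K.+1) \sum_(0 <= b < L.+1) 2 ^+ (a + b) * zeta (a + b)%N)
    + 2 ^+ (K + L) * zeta (K + L)%N <= eps / 2 * 2 `^ (al * (K + L)%:R) ->
  eps * 2 `^ (al * (K + L)%:R) <
     max_rect_sum (fun ij => W ij w - full_mean ij) (2 ^ K) (2 ^ L) ->
  1 <= Gfun K L w.
Proof.
move=> small; apply: contraTT; rewrite -!ltNge -leNgt => G1.
set N := (K + L)%N in small *.
have nn1 a b s t : 0 <= (`|dyadic_rect (g w (a + b)%N) a b s t| / level N (a + b)) `^ (2 * q).
  exact: powR_ge0.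
have nn2 i j : 0 <= (truncation N (W (i.+1, j.+1) w) / 2 `^ (al * N%:R)) `^ (2 * q).
  exact: powR_ge0.
have sum_lt (F : nat -> R) n k x : (forall i, 0 <= F i) -> (k < n)%N ->
    \sum_(0 <= i < n) F i < x -> F k < x.
  move=> F0 kn; apply: le_lt_trans.
  by rewrite (big_rem k) ?mem_index_iota //= lerDl sumr_ge0.
have [Ga Gb] : \sum_(0 <= a < K.+1) \sum_(0 <= b < L.+1)
    \sum_(0 <= s < 2 ^ (K - a)) \sum_(0 <= t < 2 ^ (L - b))
      (`|dyadic_rect (g w (a + b)%N) a b s t| / level N (a + b)) `^ (2 * q) < 1 /\
  \sum_(0 <= i < 2 ^ K) \sum_(0 <= j < 2 ^ L)
      (truncation N (W (i.+1, j.+1) w) / 2 `^ (al * N%:R)) `^ (2 * q) < 1.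
  split; apply: le_lt_trans G1.
    by rewrite lerDl sumr_ge0 // => i _; rewrite sumr_ge0.
  rewrite lerDr sumr_ge0 // => a _; rewrite sumr_ge0 // => b _.
  by rewrite sumr_ge0 // => s _; rewrite sumr_ge0.
have Wsmall i j : (i < 2 ^ K)%N -> (j < 2 ^ L)%N ->
    truncation N (W (i.+1, j.+1) w) = W (i.+1, j.+1) w.
  move=> iK jL.
  have h1 := sum_lt _ _ i _ (fun i => sumr_ge0 _ (fun j _ => nn2 i j)) iK Gb.
  have /powR_lt1 := sum_lt _ _ j _ (nn2 i) jL h1.
  rewrite divr_ge0 ?truncation_ge0 ?powR_ge0 // => /(_ isT).
  rewrite ltr_pdivrMr ?powR2_gt0 // mul1r /truncation gt_min ltxx orbF => h.
  by rewrite min_l // ltW.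
have rsmall a b s t : (a <= K)%N -> (b <= L)%N ->
     (s.+1 * 2 ^ a <= 2 ^ K)%N -> (t.+1 * 2 ^ b <= 2 ^ L)%N ->
     `|dyadic_rect (g w (a + b)%N) a b s t| <= level N (a + b).
  move=> aK bL sK tL.
  have sK' : (s < 2 ^ (K - a))%N.
    by rewrite -(@leq_pmul2r (2 ^ a)) ?expn_gt0 // -expnD subnK.
  have tL' : (t < 2 ^ (L - b))%N.
    by rewrite -(@leq_pmul2r (2 ^ b)) ?expn_gt0 // -expnD subnK.
  have h1 := sum_lt _ K.+1 a _ (fun a => sumr_ge0 _ (fun b _ =>
    sumr_ge0 _ (fun s _ => sumr_ge0 _ (fun t _ => nn1 a b s t)))) aK Ga.
  have h2 := sum_lt _ L.+1 b _ (fun b =>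
    sumr_ge0 _ (fun s _ => sumr_ge0 _ (fun t _ => nn1 a b s t))) bL h1.
  have h3 := sum_lt _ _ s _ (fun s => sumr_ge0 _ (fun t _ => nn1 a b s t)) sK' h2.
  have /powR_lt1 := sum_lt _ _ t _ (nn1 a b s) tL' h3.
  rewrite divr_ge0 ?(ltW (level0 _ _)) // => /(_ isT).
  by rewrite ltr_pdivrMr // mul1r => /ltW.
have gstep r i j : g w r i j - g w r.+1 i j <= zeta r.
  rewrite /g; have := @mean_step (i.+1, j.+1) r (conj isT isT).
  have : truncation r (W (i.+1, j.+1) w) <= truncation r.+1 (W (i.+1, j.+1) w).
    rewrite /truncation le_min !ge_min lexx /=.
    by rewrite ler_powR2 ?orbT // ler_pM2l // ler_nat.
  by set x := truncation r _; set y := truncation r.+1 _; lra.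
apply: max_rect_sum_le => [|u v uK vL].
  by rewrite mulr_ge0 ?powR_ge0 // ltW.
have h1 := @rect_chaining R (g w) (fun a b => level N (a + b)) zeta K L z0 gstep rsmall u v uK vL.
have h2 : `|corner_sum (fun ij => truncated_mean N ij - full_mean ij) u v| <= 2 ^+ N * zeta N.
  apply: (@le_trans _ _ (\sum_(i < u) \sum_(j < v) zeta N)).
    apply: le_trans (ler_norm_sum _ _ _) _; apply: ler_sum => i _.
    apply: le_trans (ler_norm_sum _ _ _) _; apply: ler_sum => j _.
    by rewrite distrC; apply: mean_tail.
  rewrite !sumr_const !card_ord -mulrnA -[leLHS]mulr_natl ler_wpM2r //.
  by rewrite -natrX ler_nat /N expnD mulnC leq_mul.
have -> : corner_sum (fun ij => W ij w - full_mean ij) u v =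
    \sum_(i < u) \sum_(j < v) g w N i j +
    corner_sum (fun ij => truncated_mean N ij - full_mean ij) u v.
  rewrite /corner_sum -big_split /=; apply: eq_bigr => i _.
  rewrite -big_split /=; apply: eq_bigr => j _; rewrite /g Wsmall.
  - by rewrite addrA subrK.
  - exact: leq_trans (ltn_ord i) uK.
  - exact: leq_trans (ltn_ord j) vL.
apply: le_trans (ler_normD _ _) _.
have h3 := level_sum K L; rewrite -/N in h3.
move: h1 h2 h3 small.
rewrite !big_mkord; under [in X in _ -> _ -> X -> _]eq_bigr do rewrite big_mkord.
under [in X in _ -> _ -> _ -> X -> _]eq_bigr do rewrite big_mkord.
set x1 := `| _ |; set x2 := `| _ |; set x3 := \sum_(a < K.+1) _.
set x4 := \sum_(a < K.+1) _; set x5 := 2 ^+ N * _; set x6 := 2 `^ _.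
lra.
Qed.

(** The contribution of rectangles with a + b = r to the weighted series, freed of
    the dependence on the ambient rectangle, which is carried by [decay]. *)
Definition level_weight (r : nat) : R :=
  2 `^ (- (al * (2 * q - p)) * r%:R) * M r +
  2 `^ (- (q * (2 * al - 1) - (al * p - 1)) * r%:R) * V r `^ q.

Definition decay (k : nat) : R := 2 `^ (- (al * (2 * q - p) / 2) * k%:R).

Definition maximal_const : R := C / eta `^ (2 * q) + 1.

Lemma maximal_const_ge0 : 0 <= maximal_const.
Proof. by rewrite addr_ge0 // divr_ge0 // powR_ge0. Qed.

Lemma level_weight_ge0 r : 0 <= level_weight r.
Proof. by rewrite addr_ge0 // mulr_ge0 ?powR_ge0. Qed.

Let mGrect K L : measurable_fun setT (Gfun K L).
Proof.
apply: measurable_funD.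
  do 4! apply: measurable_sum => ?.
  apply: (measurableT_comp (measurable_powR _)); apply: measurable_funM => //.
  exact: measurableT_comp.
do 2! apply: measurable_sum => ?.
by apply: (measurableT_comp (measurable_powR _)); exact: measurable_funM.
Qed.

Let Gfun_ge0 K L w : 0 <= Gfun K L w.
Proof.
rewrite addr_ge0 //; first by do 4! (apply: sumr_ge0 => ? _); exact: powR_ge0.
by do 2! (apply: sumr_ge0 => ? _); exact: powR_ge0.
Qed.

Let rect_bound (N r : nat) : R :=
  C * (2 `^ r%:R * M r + 2 `^ (q * r%:R) * V r `^ q) / level N r `^ (2 * q).

Let Gfun_int K L :
  (\int[P]_w (Gfun K L w)%:E <=
   (\sum_(0 <= a < K.+1) \sum_(0 <= b < L.+1)
     (2 ^ (K - a) * 2 ^ (L - b))%:R * rect_bound (K + L) (a + b)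
    + 2 ^+ (K + L) * (M (K + L)%N / (2 `^ (al * (K + L)%:R)) `^ (2 * q)))%:E)%E.
Proof.
set N := (K + L)%N.
pose F1 (a b s t : nat) (w : T) :=
  (`|dyadic_rect (g w (a + b)%N) a b s t| / level N (a + b)) `^ (2 * q).
pose F2 (i j : nat) (w : T) :=
  (truncation N (W (i.+1, j.+1) w) / 2 `^ (al * N%:R)) `^ (2 * q).
have mF1 a b s t : measurable_fun setT (F1 a b s t).
  apply: (measurableT_comp (measurable_powR _)); apply: measurable_funM => //.
  exact: measurableT_comp.
have mF2 i j : measurable_fun setT (F2 i j).
  by apply: (measurableT_comp (measurable_powR _)); exact: measurable_funM.
have F10 a b s t w : 0 <= F1 a b s t w by exact: powR_ge0.
have F20 i j w : 0 <= F2 i j w by exact: powR_ge0.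
have F1B a b s t : (\int[P]_w (F1 a b s t w)%:E <= (rect_bound N (a + b))%:E)%E.
  rewrite /F1; under eq_integral do rewrite powR_div ?level0 //.
  apply: int_divr_le; last exact: rect_moment.
  - by apply: (measurableT_comp (measurable_powR _)); exact: measurableT_comp.
  - by move=> w; exact: powR_ge0.
  - by rewrite powR_gt0 // level0.
have F2B i j : (\int[P]_w (F2 i j w)%:E <=
    (M N / (2 `^ (al * N%:R)) `^ (2 * q))%:E)%E.
  rewrite /F2; under eq_integral do rewrite powR_div ?truncation_ge0 ?powR2_gt0 //.
  apply: int_divr_le; last exact: moment1.
  - by apply: (measurableT_comp (measurable_powR _)).
  - by move=> w; exact: powR_ge0.
  - by rewrite powR_gt0 // powR2_gt0.
have s2 i w : 0 <= \sum_(0 <= j < 2 ^ L) F2 i j w by exact: sumr_ge0.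
have s1 a b s w : 0 <= \sum_(0 <= t < 2 ^ (L - b)) F1 a b s t w by exact: sumr_ge0.
have s1' a b w : 0 <= \sum_(0 <= s < 2 ^ (K - a))
  \sum_(0 <= t < 2 ^ (L - b)) F1 a b s t w by exact: sumr_ge0.
have s1'' a w : 0 <= \sum_(0 <= b < L.+1) \sum_(0 <= s < 2 ^ (K - a))
  \sum_(0 <= t < 2 ^ (L - b)) F1 a b s t w by exact: sumr_ge0.
have GE w : Gfun K L w = \sum_(0 <= a < K.+1) \sum_(0 <= b < L.+1)
    \sum_(0 <= s < 2 ^ (K - a)) \sum_(0 <= t < 2 ^ (L - b)) F1 a b s t w
  + \sum_(0 <= i < 2 ^ K) \sum_(0 <= j < 2 ^ L) F2 i j w by [].
under eq_integral do rewrite GE EFinD.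
rewrite ge0_integralD //; last first.
- by apply/measurable_int_EFin; do 2! apply: measurable_sum => ?.
- by move=> w _; rewrite lee_fin sumr_ge0.
- by apply/measurable_int_EFin; do 4! apply: measurable_sum => ?.
- by move=> w _; rewrite lee_fin sumr_ge0.
rewrite EFinD; apply: leeD.
  apply: int_sum_le => // a; first by do 3! apply: measurable_sum => ?.
  apply: int_sum_le => // b; first by do 2! apply: measurable_sum => ?.
  have -> : (2 ^ (K - a) * 2 ^ (L - b))%:R * rect_bound N (a + b) =
      \sum_(0 <= s < 2 ^ (K - a)) \sum_(0 <= t < 2 ^ (L - b)) rect_bound N (a + b).
    by rewrite !sumr_const_nat !subn0 -mulrnA mulr_natl mulnC.
  apply: int_sum_le => // s; first by apply: measurable_sum => ?.
  by apply: int_sum_le.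
have -> : 2 ^+ N * (M N / (2 `^ (al * N%:R)) `^ (2 * q)) =
    \sum_(0 <= i < 2 ^ K) \sum_(0 <= j < 2 ^ L) (M N / (2 `^ (al * N%:R)) `^ (2 * q)).
  by rewrite !sumr_const_nat !subn0 -mulrnA -natrX mulr_natl mulnC -expnD.
apply: int_sum_le => // i; first by apply: measurable_sum => ?.
by apply: int_sum_le.
Qed.

(** There are 2^(K - a) 2^(L - b) rectangles of size 2^a by 2^b. Up to constants
    each contributes its moment bound divided by the 2q-th power of its threshold. With
    gam = al (2q - p) / 2 and N = K + L all powers of 2 combine to the factor
    2^(- gam (N - a - b)) times [level_weight (a + b)]. The entries above the top
    truncation level contribute a part of the term a = K, b = L. *)
Lemma dyadic_maximal_bound (K L : nat) :
  16 * (\sum_(0 <= a < K.+1) \sum_(0 <= b < L.+1) 2 ^+ (a + b) * zeta (a + b)%N)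
    + 2 ^+ (K + L) * zeta (K + L)%N <= eps / 2 * 2 `^ (al * (K + L)%:R) ->
  ((2 `^ ((al * p - 1) * (K + L)%:R))%:E *
    P [set w | (eps * 2 `^ (al * (K + L)%:R) <
      max_rect_sum (fun ij => W ij w - full_mean ij) (2 ^ K) (2 ^ L))%R]
   <= (\sum_(0 <= a < K.+1) \sum_(0 <= b < L.+1)
        (decay (K - a) * decay (L - b)) * (maximal_const * level_weight (a + b)))%:E)%E.
Proof.
move=> small; set N := (K + L)%N in small *.
apply: (@le_trans _ _ ((2 `^ ((al * p - 1) * N%:R))%:E * \int[P]_w (Gfun K L w)%:E)%E).
  apply: lee_wpmul2l; first by rewrite lee_fin powR_ge0.
  apply: prob_le_int => // [|w]; last exact: event_le.
  apply: measurable_gt; apply: (measurable_max_rect_sum (a := fun ij w => _)) => ij.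
  exact: measurable_funB.
apply: le_trans (lee_wpmul2l _ (Gfun_int K L)) _; first by rewrite lee_fin powR_ge0.
rewrite -EFinM lee_fin -/N mulrDr.
have -> : \sum_(0 <= a < K.+1) \sum_(0 <= b < L.+1)
        (decay (K - a) * decay (L - b)) * (maximal_const * level_weight (a + b)) =
  \sum_(0 <= a < K.+1) \sum_(0 <= b < L.+1)
        (decay (K - a) * decay (L - b)) * (C / eta `^ (2 * q) * level_weight (a + b))
  + \sum_(0 <= a < K.+1) \sum_(0 <= b < L.+1)
        (decay (K - a) * decay (L - b)) * level_weight (a + b).
  rewrite -big_split; apply: eq_bigr => a _; rewrite -big_split; apply: eq_bigr => b _ /=.
  by rewrite /maximal_const; ring.
have dec a b : (a <= K)%N -> (b <= L)%N ->
    decay (K - a) * decay (L - b) = 2 `^ (- gam * (N%:R - (a + b)%:R)).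
  move=> aK bL; rewrite /decay -powR2D !natrB // !natrD /gam.
  by congr (2 `^ _); ring.
apply: lerD; last first.
  rewrite big_nat_recr //= -[leLHS]add0r; apply: lerD.
    by do 2! (apply: sumr_ge0 => ? _); rewrite !mulr_ge0 ?powR_ge0 // level_weight_ge0.
  rewrite big_nat_recr //= -[leLHS]add0r; apply: lerD.
    by apply: sumr_ge0 => ? _; rewrite !mulr_ge0 ?powR_ge0 // level_weight_ge0.
  rewrite dec // subrr mulr0 powRr0 mul1r /level_weight -[leLHS]addr0.
  apply: lerD; last by rewrite mulr_ge0 ?powR_ge0.
  rewrite !mulrA mulrAC ler_wpM2r // -powR2_nat -powRrM -powRN -!powR2D.
  rewrite le_eqVlt; apply/orP; left; apply/eqP; congr (2 `^ _). rewrite -/N; ring.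
rewrite mulr_sumr big_nat [leRHS]big_nat; apply: ler_sum => a /andP[_ aK].
rewrite mulr_sumr big_nat [leRHS]big_nat; apply: ler_sum => b /andP[_ bL].
rewrite dec // /rect_bound /level.
set r := (a + b)%N.
rewrite powRM ?powR_ge0 ?(ltW eta0) // -powRrM natrM !natrX -!powR2_nat !natrB //.
set e := (_ - _) * (2 * q).
have -> : (C * (2 `^ r%:R * M r + 2 `^ (q * r%:R) * V r `^ q) / (eta `^ (2 * q) * 2 `^ e)) =
   C / eta `^ (2 * q) * ((2 `^ r%:R * M r + 2 `^ (q * r%:R) * V r `^ q) * 2 `^ (- e)).
  rewrite powRN; field; rewrite !gt_eqF ?powR_gt0 //.
rewrite (mulrCA (2 `^ (K%:R - a%:R) * _)) [leLHS]mulrCA [leRHS]mulrCA.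
rewrite ler_wpM2l ?divr_ge0 ?powR_ge0 //.
set x := M r; set y := V r `^ q.
have bq : bet * (2 * q) = gam by rewrite /bet divfK // gt_eqF.
have he : e = al * N%:R * (2 * q) - gam * (N%:R - r%:R).
  by rewrite /e mulrBl -bq; ring.
rewrite /level_weight -/x -/y.
set A := 2 `^ _; set B := 2 `^ _; set D := 2 `^ _; set E := 2 `^ (- e).
have -> : A * (B * D * ((2 `^ r%:R * x + 2 `^ (q * r%:R) * y) * E)) =
    A * (B * D) * 2 `^ r%:R * E * x + A * (B * D) * 2 `^ (q * r%:R) * E * y by ring.
rewrite mulrDr !mulrA -!powR2D he.
rewrite le_eqVlt; apply/orP; left; apply/eqP.
by congr (2 `^ _ * _ + 2 `^ _ * _); rewrite /gam /N /r !natrD; field.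
Qed.

(** [dyadic_maximal_bound] needs K + L to be large; in the finitely many other cases
    the probability is at most 1, and the weight is bounded by a
    multiple of 2^(- K - L), which is summable. *)
Lemma dyadic_maximal_series :
  0 < p ->
  (forall del : R, 0 < del -> exists N0 : nat, forall K L, (N0 <= K + L)%N ->
    \sum_(0 <= a < K.+1) \sum_(0 <= b < L.+1) 2 ^+ (a + b) * zeta (a + b)%N
    <= del * 2 `^ (al * (K + L)%:R)) ->
  (\sum_(a <oo) \sum_(b <oo) (level_weight (a + b))%:E < +oo)%E ->
  (\sum_(K <oo) \sum_(L <oo) ((2 `^ ((al * p - 1) * (K + L)%:R))%:E *
    P [set w | (eps * 2 `^ (al * (K + L)%:R) <
      max_rect_sum (fun ij => W ij w - full_mean ij) (2 ^ K) (2 ^ L))%R]) < +oo)%E.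
Proof.
move=> p0 small summable.
have e34 : 0 < eps / 34 by rewrite divr_gt0.
have [N0 hN0] := small _ e34.
pose ev (K L : nat) := P [set w | (eps * 2 `^ (al * (K + L)%:R) <
      max_rect_sum (fun ij => W ij w - full_mean ij) (2 ^ K) (2 ^ L))%R].
pose G1 (K L : nat) : \bar R := (\sum_(0 <= a < K.+1) \sum_(0 <= b < L.+1)
  (decay (K - a) * decay (L - b))%:E * (maximal_const * level_weight (a + b))%:E)%E.
pose X : R := 2 `^ (al * p * N0%:R).
pose t (r : nat) : R := X * 2 `^ (- 1 * r%:R).
have cl0 a b : 0 <= maximal_const * level_weight (a + b).
  by rewrite mulr_ge0 ?maximal_const_ge0 ?level_weight_ge0.
have t0 r : 0 <= t r by rewrite mulr_ge0 ?powR_ge0.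
have G10 K L : (0 <= G1 K L)%E.
  apply: sume_ge0 => a _; apply: sume_ge0 => b _.
  by apply: mule_ge0; rewrite lee_fin // mulr_ge0 // powR_ge0.
have mev K L : measurable [set w | (eps * 2 `^ (al * (K + L)%:R) <
      max_rect_sum (fun ij => W ij w - full_mean ij) (2 ^ K) (2 ^ L))%R].
  apply: measurable_gt; apply: (measurable_max_rect_sum (a := fun ij w => _)) => ij.
  exact: measurable_funB.
have term K L : ((2 `^ ((al * p - 1) * (K + L)%:R))%:E * ev K L <=
    G1 K L + (t (K + L)%N)%:E)%E.
  have [NKL|NKL] := leqP N0 (K + L).
    rewrite -[leLHS]adde0; apply: leeD; last by rewrite lee_fin.
    have -> : G1 K L = (\sum_(0 <= a < K.+1) \sum_(0 <= b < L.+1)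
        (decay (K - a) * decay (L - b)) * (maximal_const * level_weight (a + b)))%:E.
      by rewrite -sumEFin; apply: eq_bigr => a _; rewrite -sumEFin.
    apply: dyadic_maximal_bound.
    have h := hN0 K L NKL.
    set S := \sum_(0 <= a < K.+1) _ in h *.
    have hS : 2 ^+ (K + L) * zeta (K + L)%N <= S.
      rewrite /S big_nat_recr //= -[leLHS]add0r; apply: lerD.
        by do 2! (apply: sumr_ge0 => ? _); rewrite mulr_ge0 ?exprn_ge0.
      rewrite big_nat_recr //= -[leLHS]add0r; apply: lerD => //.
      by apply: sumr_ge0 => ? _; rewrite mulr_ge0 ?exprn_ge0.
    by move: h hS; set x := 2 ^+ _ * _; set y := 2 `^ _; lra.
  rewrite -[leLHS]add0e; apply: leeD => //.
  apply: (@le_trans _ _ (2 `^ ((al * p - 1) * (K + L)%:R))%:E).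
    rewrite -[leRHS]mule1 lee_wpmul2l ?lee_fin ?powR_ge0 //.
    exact: probability_le1.
  rewrite lee_fin /t /X -powR2D ler_powR2 //.
  rewrite mulrBl mul1r mulN1r lerD2r ler_wpM2l ?mulr_ge0 ?(ltW al0) ?(ltW p0) //.
  by rewrite ler_nat ltnW.
have ev0 K L : (0 <= (2 `^ ((al * p - 1) * (K + L)%:R))%:E * ev K L)%E.
  by rewrite mule_ge0 // lee_fin powR_ge0.
apply: (@le_lt_trans _ _ (\sum_(K <oo) \sum_(L <oo) (G1 K L + (t (K + L)%N)%:E))%E).
  apply: lee_nneseries => [K _ _|K _]; first exact: nneseries_ge0.
  by apply: lee_nneseries.
have -> : (\sum_(K <oo) \sum_(L <oo) (G1 K L + (t (K + L)%N)%:E) =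
    \sum_(K <oo) (\sum_(L <oo) G1 K L + \sum_(L <oo) (t (K + L)%N)%:E))%E.
  apply: eq_eseriesr => K _; rewrite nneseriesD // => L _ _.
  by rewrite lee_fin.
rewrite nneseriesD; last 2 first.
- by move=> K _ _; apply: nneseries_ge0.
- by move=> K _ _; apply: nneseries_ge0 => L _ _; rewrite lee_fin.
apply: lte_add_pinfty.
  apply: le_lt_trans (nneseries2_convolution (B := geo_bound gam) _ _ _) _.
  - by move=> k; exact: powR_ge0.
  - by move=> a b; rewrite lee_fin.
  - by move=> n; rewrite /decay -/gam; exact: geo_sum_le.
  have -> : (\sum_(a <oo) \sum_(b <oo) (maximal_const * level_weight (a + b))%:E =
      maximal_const%:E * \sum_(a <oo) \sum_(b <oo) (level_weight (a + b))%:E)%E.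
    rewrite -nneseriesZl; last first.
      by move=> a _; apply: nneseries_ge0 => b _ _; rewrite lee_fin level_weight_ge0.
    apply: eq_eseriesr => a _; rewrite -nneseriesZl //.
    by move=> b _; rewrite lee_fin level_weight_ge0.
  rewrite muleA -EFinM lte_mul_pinfty // lee_fin !mulr_ge0 ?geo_bound_ge0 //.
  exact: maximal_const_ge0.
apply: le_lt_trans (double_tail_sum (n := 0) (A := X * geo_bound 1)
  (D := X) ltr01 t0 _ _ _) _.
- exact: powR_ge0.
- move=> m; rewrite -mulr_sumr ler_wpM2l ?powR_ge0 //; exact: geo_sum_le.
- by move=> k; rewrite add0n.
- exact: ltry.
Qed.

End truncated_array.

(** * Condensation of double series *)

Lemma sum_cst_nat (R : realType) (x : \bar R) (n : nat) : (0 <= x)%E ->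
  (\sum_(0 <= m < n) x = n%:R%:E * x)%E.
Proof.
move=> x0; elim: n => [|n IH]; first by rewrite big_geq // mul0e.
by rewrite big_nat_recr //= IH -[n.+1]addn1 natrD EFinD ge0_muleDl ?lee_fin // mul1e.
Qed.

Lemma sum_cst_dyadic_block (R : realType) (x : \bar R) (K : nat) : (0 <= x)%E ->
  (\sum_(2 ^ K <= m < 2 ^ K.+1) x = (2 ^+ K)%:E * x)%E.
Proof.
move=> x0; have -> : (2 ^ K.+1 = 2 ^ K + 2 ^ K)%N by rewrite expnS; lia.
by rewrite sum_nat_shift sum_cst_nat // natrX.
Qed.

Lemma double_condensation_le (R : realType) (t u : nat -> nat -> \bar R) :
  (forall m n, 0 <= t m n)%E -> (forall K L, 0 <= u K L)%E ->
  (forall K L m n, (2 ^ K <= m < 2 ^ K.+1)%N -> (2 ^ L <= n < 2 ^ L.+1)%N ->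
     (t m n <= u K L)%E) ->
  (\sum_(1 <= m <oo) \sum_(1 <= n <oo) t m n <=
   \sum_(K <oo) \sum_(L <oo) (2 ^+ (K + L))%:E * u K L)%E.
Proof.
move=> t0 u0 tu.
have T0 m : (0 <= \sum_(1 <= n <oo) t m n)%E by apply: nneseries_ge0.
have U0 K L : (0 <= (2 ^+ L)%:E * u K L)%E by rewrite mule_ge0 // lee_fin exprn_ge0.
rewrite nneseries_dyadic //.
apply: lee_nneseries => [K _ _|K _]; first exact: sume_ge0.
have -> : (\sum_(L <oo) (2 ^+ (K + L))%:E * u K L =
    (2 ^+ K)%:E * \sum_(L <oo) (2 ^+ L)%:E * u K L)%E.
  rewrite -nneseriesZl //; apply: eq_eseriesr => L _.
  by rewrite exprD EFinM muleA.
rewrite -sum_cst_dyadic_block; last exact: nneseries_ge0.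
rewrite big_nat [leRHS]big_nat; apply: lee_sum => m hm.
rewrite nneseries_dyadic //.
apply: lee_nneseries => [L _ _|L _]; first exact: sume_ge0.
rewrite -sum_cst_dyadic_block // big_nat [leRHS]big_nat.
by apply: lee_sum => n hn; apply: tu.
Qed.

Lemma double_condensation_ge (R : realType) (t u : nat -> nat -> \bar R) :
  (forall m n, 0 <= t m n)%E -> (forall K L, 0 <= u K L)%E ->
  (forall K L m n, (2 ^ K <= m < 2 ^ K.+1)%N -> (2 ^ L <= n < 2 ^ L.+1)%N ->
     (u K L <= t m n)%E) ->
  (\sum_(K <oo) \sum_(L <oo) (2 ^+ (K + L))%:E * u K L <=
   \sum_(1 <= m <oo) \sum_(1 <= n <oo) t m n)%E.
Proof.
move=> t0 u0 tu.
have T0 m : (0 <= \sum_(1 <= n <oo) t m n)%E by apply: nneseries_ge0.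
have U0 K L : (0 <= (2 ^+ L)%:E * u K L)%E by rewrite mule_ge0 // lee_fin exprn_ge0.
rewrite (nneseries_dyadic T0).
apply: lee_nneseries => [K _ _|K _].
  by apply: nneseries_ge0 => L _ _; rewrite mule_ge0 // lee_fin exprn_ge0.
have -> : (\sum_(L <oo) (2 ^+ (K + L))%:E * u K L =
    (2 ^+ K)%:E * \sum_(L <oo) (2 ^+ L)%:E * u K L)%E.
  rewrite -nneseriesZl //; apply: eq_eseriesr => L _.
  by rewrite exprD EFinM muleA.
rewrite -sum_cst_dyadic_block; last exact: nneseries_ge0.
rewrite big_nat [leRHS]big_nat; apply: lee_sum => m hm.
rewrite (nneseries_dyadic (t0 m)).
apply: lee_nneseries => [L _ _|L _]; first exact: U0.
rewrite -sum_cst_dyadic_block // big_nat [leRHS]big_nat.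
by apply: lee_sum => n hn; apply: tu.
Qed.

Lemma powR_dyadic_bounds (R : realType) (x e N : R) :
  2 `^ N <= x <= 2 `^ (N + 2) ->
  2 `^ (- (2 * `|e|)) * 2 `^ (e * N) <= x `^ e <= 2 `^ (2 * `|e|) * 2 `^ (e * N).
Proof.
move=> /andP[Nx xN]; rewrite -!powR2D.
have x0 : 0 < x by apply: lt_le_trans Nx; exact: powR2_gt0.
have [e0|e0] := leP 0 e.
  rewrite ger0_norm //; apply/andP; split.
    apply: (@le_trans _ _ ((2 `^ N) `^ e)); last first.
      by rewrite ge0_ler_powR ?nnegrE ?powR_ge0 // ltW.
    by rewrite -powRrM ler_powR2 //; move: e0; lra.
  apply: (@le_trans _ _ ((2 `^ (N + 2)) `^ e)).
    by rewrite ge0_ler_powR ?nnegrE ?powR_ge0 // ltW.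
  by rewrite -powRrM ler_powR2 // le_eqVlt; apply/orP; left; apply/eqP; ring.
rewrite ltr0_norm //.
have -> : e = - - e by rewrite opprK.
rewrite [x `^ _]powRN; set f := - e; have f0 : 0 <= f by rewrite oppr_ge0 ltW.
rewrite opprK; apply/andP; split.
  rewrite -[leLHS]invrK -powRN lef_pV2 ?posrE ?powR_gt0 //.
  apply: (@le_trans _ _ ((2 `^ (N + 2)) `^ f)).
    by rewrite ge0_ler_powR ?nnegrE ?powR_ge0 // ltW.
  by rewrite -powRrM ler_powR2 // le_eqVlt; apply/orP; left; apply/eqP; ring.
rewrite -[leRHS]invrK -[X in _ <= X^-1]powRN lef_pV2 ?posrE ?powR_gt0 //.
apply: (@le_trans _ _ ((2 `^ N) `^ f)); last first.
  by rewrite ge0_ler_powR ?nnegrE ?powR_ge0 // ltW.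
by rewrite -powRrM ler_powR2 //; move: f0; lra.
Qed.

Lemma dyadic_product_bounds (R : realType) (K L m n : nat) :
  (2 ^ K <= m < 2 ^ K.+1)%N -> (2 ^ L <= n < 2 ^ L.+1)%N ->
  @powR R 2 (K + L)%:R <= (m * n)%:R <= @powR R 2 ((K + L)%:R + 2).
Proof.
move=> /andP[Km mK] /andP[Ln nL].
have -> : (K + L)%:R + 2 = (K.+1 + L.+1)%:R :> R by rewrite !natrD -!natr1; ring.
rewrite !powR2_nat -!natrX !ler_nat !expnD.
by rewrite !leq_mul // ltnW.
Qed.

Lemma nneseries_shift_le (R : realType) (f : nat -> \bar R) :
  (forall k, 0 <= f k)%E -> (\sum_(k <oo) f k.+1 <= \sum_(k <oo) f k)%E.
Proof.
move=> f0; have := nneseries_addn 1 f0; under eq_eseriesr do rewrite addn1.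
by move=> ->; rewrite (nneseries_recl (P := xpredT)) // leeDr.
Qed.

Lemma double_nneseries_shift_le (R : realType) (f : nat -> nat -> \bar R) :
  (forall k l, 0 <= f k l)%E ->
  (\sum_(k <oo) \sum_(l <oo) f k.+1 l.+1 <= \sum_(k <oo) \sum_(l <oo) f k l)%E.
Proof.
move=> f0.
have S0 k : (0 <= \sum_(l <oo) f k l)%E by apply: nneseries_ge0.
apply: le_trans (nneseries_shift_le S0).
apply: lee_nneseries => [k _ _|k _]; first exact: nneseries_ge0.
exact: nneseries_shift_le.
Qed.

(** * Summability under E Z^p log Z finite *)

Section dominating.
Context d (T : measurableType d) (R : realType) (Q : probability T R).
Variables (Z : T -> R) (al p : R).
Hypotheses (mZ : measurable_fun setT Z) (Z0 : forall w, 0 <= Z w).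
Hypotheses (al0 : 0 < al) (p1 : 1 <= p).
Hypothesis Zlog : (\int[Q]_w (Z w `^ p * log_max2 (Z w))%:E < +oo)%E.

Let p0 : 0 < p. Proof. exact: lt_le_trans p1. Qed.

Let mpow s : measurable_fun setT (fun w => Z w `^ s).
Proof. exact: (measurableT_comp (measurable_powR _)). Qed.

Let mZlog : measurable_fun setT (fun w => Z w `^ p * log_max2 (Z w)).
Proof.
apply: measurable_funM => //; rewrite /log_max2.
apply: (measurableT_comp (@measurable_ln R)); exact: measurable_maxr.
Qed.

Let mtrunc s r : measurable_fun setT (fun w => truncation al r (Z w) `^ s).
Proof.
by apply: (measurableT_comp (measurable_powR _)); exact: measurable_minr.
Qed.

Definition truncated_moment (s : R) (r : nat) : R :=
  fine (\int[Q]_w (truncation al r (Z w) `^ s)%:E).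

Lemma truncated_moment_ge0 s r : 0 <= truncated_moment s r.
Proof. by apply: fine_ge0; apply: int_ge0 => w; exact: powR_ge0. Qed.

Lemma truncated_momentE s r : 0 <= s ->
  (\int[Q]_w (truncation al r (Z w) `^ s)%:E)%E = (truncated_moment s r)%:E.
Proof.
move=> s0; rewrite fineK // ge0_fin_numE; last by apply: int_ge0 => w; exact: powR_ge0.
apply: (@le_lt_trans _ _ (\int[Q]_w ((2 `^ (al * r%:R)) `^ s)%:E)%E).
  apply: ge0_le_int => // w; first exact: powR_ge0.
  rewrite ge0_ler_powR ?nnegrE ?powR_ge0 ?truncation_ge0 //.
  by rewrite /truncation ge_min lexx orbT.
by rewrite integral_cst //= probability_setT mule1 ltry.
Qed.

Lemma pth_moment_finite : (\int[Q]_w (Z w `^ p)%:E < +oo)%E.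
Proof.
have l2 := ln2_gt0 R.
apply: (@le_lt_trans _ _ (\int[Q]_w (Z w `^ p * log_max2 (Z w) / ln 2)%:E)%E).
  apply: ge0_le_int => [||w|w] //.
  - by apply: measurable_funM => //; exact: measurable_funM.
  - exact: powR_ge0.
  - by rewrite -mulrA ler_peMr ?powR_ge0 // ler_pdivlMr // mul1r ln2_le_log_max2.
have -> : (\int[Q]_w (Z w `^ p * log_max2 (Z w) / ln 2)%:E =
    ((ln 2)^-1)%:E * \int[Q]_w (Z w `^ p * log_max2 (Z w))%:E)%E.
  rewrite -ge0_integralZl_EFin ?invr_ge0 ?(ltW l2) //.
  - by under [RHS]eq_integral do rewrite -EFinM mulrC.
  - by move=> w _; rewrite lee_fin mulr_ge0 ?powR_ge0 // ltW // log_max2_gt0.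
  - exact: measurable_int_EFin.
by rewrite lte_mul_pinfty // lee_fin invr_ge0 ltW.
Qed.

(** Exchange expectation and series, and use [truncated_terms_le] pointwise. *)
Lemma truncated_moment_series s : p < s ->
  (\sum_(a <oo) \sum_(b <oo)
    (2 `^ (- (al * (s - p)) * (a + b)%:R) * truncated_moment s (a + b))%:E < +oo)%E.
Proof.
move=> ps; have s0 : 0 <= s by rewrite ltW // (lt_trans p0).
have [C C0 HC] := truncated_terms_le al0 p0 ps.
have mt r : measurable_fun setT (fun w => truncated_term al p s (Z w) r).
  by apply: measurable_funM => //; exact: mtrunc.
have t0 r w : 0 <= truncated_term al p s (Z w) r by rewrite mulr_ge0 ?powR_ge0.
have tE r : ((2 `^ (- (al * (s - p)) * r%:R) * truncated_moment s r)%:E =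
    \int[Q]_w (truncated_term al p s (Z w) r)%:E)%E.
  rewrite EFinM -truncated_momentE // -ge0_integralZl_EFin ?powR_ge0 //.
  - by move=> w _; rewrite lee_fin powR_ge0.
  - by apply: measurable_int_EFin; exact: mtrunc.
have -> : (\sum_(a <oo) \sum_(b <oo)
    (2 `^ (- (al * (s - p)) * (a + b)%:R) * truncated_moment s (a + b))%:E =
   \int[Q]_w (\sum_(a <oo) \sum_(b <oo) (truncated_term al p s (Z w) (a + b)%N)%:E))%E.
  rewrite integral_nneseries //; last 2 first.
  - move=> a; apply: ge0_emeasurable_sum => //= [b w _ _|b _]; first by rewrite lee_fin.
    exact: measurable_int_EFin.
  - by move=> a w _; apply: nneseries_ge0 => b _ _; rewrite lee_fin.
  apply: eq_eseriesr => a _; rewrite integral_nneseries //.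
  - by apply: eq_eseriesr => b _; exact: tE.
  - by move=> b; exact: measurable_int_EFin.
  - by move=> b w _; rewrite lee_fin.
apply: (@le_lt_trans _ _ (\int[Q]_w (C * (Z w `^ p * log_max2 (Z w)))%:E)%E).
  apply: ge0_le_integral => //.
  - move=> w _; apply: nneseries_ge0 => a _ _; apply: nneseries_ge0 => b _ _.
    by rewrite lee_fin.
  - apply: ge0_emeasurable_sum => //= [a w _ _|a _].
      by apply: nneseries_ge0 => b _ _; rewrite lee_fin.
    apply: ge0_emeasurable_sum => //= [b w _ _|b _]; first by rewrite lee_fin.
    exact: measurable_int_EFin.
  - by apply: measurable_int_EFin; exact: measurable_funM.
  - by move=> w _; apply: HC.
have -> : (\int[Q]_w (C * (Z w `^ p * log_max2 (Z w)))%:E =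
    C%:E * \int[Q]_w (Z w `^ p * log_max2 (Z w))%:E)%E.
  rewrite -ge0_integralZl_EFin //.
  - by move=> w _; rewrite lee_fin mulr_ge0 ?powR_ge0 // ltW // log_max2_gt0.
  - exact: measurable_int_EFin.
by rewrite lte_mul_pinfty.
Qed.

(** For p < 2 and q = 1 this is the case s = 2 of the previous series. For
    2 <= p the second moments are bounded, and the condition on q makes the
    exponent negative. *)
Lemma second_moment_series (q : R) :
  1 <= q -> (p < 2 /\ q = 1) \/ 2 <= p -> 0 < q * (2 * al - 1) - (al * p - 1) ->
  (\sum_(a <oo) \sum_(b <oo)
    (2 `^ (- (q * (2 * al - 1) - (al * p - 1)) * (a + b)%:R) *
      truncated_moment 2 (a + b) `^ q)%:E < +oo)%E.
Proof.
move=> q1 [[p2 ->] _|p2 e0].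
  have := truncated_moment_series p2.
  under eq_eseriesr => a _.
    under eq_eseriesr => b _.
      have -> : - (al * (2 - p)) = - (1 * (2 * al - 1) - (al * p - 1)) by ring.
      rewrite -[truncated_moment 2 (a + b)]powRr1 ?truncated_moment_ge0 //.
    over.
  over.
  by [].
set e := _ - _ in e0 *.
pose V : R := 1 + fine (\int[Q]_w (Z w `^ p)%:E).
have I0 : (0 <= \int[Q]_w (Z w `^ p)%:E)%E by apply: int_ge0 => w; exact: powR_ge0.
have If : (\int[Q]_w (Z w `^ p)%:E)%E \is a fin_num.
  by rewrite ge0_fin_numE // pth_moment_finite.
have V0 : 0 <= V by rewrite addr_ge0 // fine_ge0.
have tV r : truncated_moment 2 r <= V.
  rewrite -lee_fin -truncated_momentE // /V EFinD fineK //.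
  apply: (@le_trans _ _ (\int[Q]_w (1 + Z w `^ p)%:E)%E).
    apply: ge0_le_int => [||w|w]; [exact: mtrunc|exact: measurable_funD|exact: powR_ge0|].
    apply: (@le_trans _ _ (Z w `^ 2)).
      rewrite ge0_ler_powR ?nnegrE ?truncation_ge0 //.
      by rewrite /truncation ge_min lexx.
    have [Z1|Z1] := leP (Z w) 1.
      rewrite -[leLHS]addr0 lerD ?powR_ge0 //.
      apply: (@le_trans _ _ (1 `^ 2)); last by rewrite powR1.
      by rewrite ge0_ler_powR ?nnegrE.
    rewrite -[leLHS]add0r lerD // ler_powR //; exact: ltW.
  under eq_integral do rewrite EFinD.
  rewrite ge0_integralD //.
  - by rewrite integral_cst //= probability_setT mule1.
  - by move=> w _; rewrite lee_fin powR_ge0.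
  - exact: measurable_int_EFin.
have q0 : 0 <= q by rewrite (le_trans _ q1).
apply: (@le_lt_trans _ _ (0%:R * (V `^ q * geo_bound e) +
    V `^ q * geo_bound e ^+ 2)%:E); last exact: ltry.
pose t (r : nat) : R := 2 `^ (- e * r%:R) * truncated_moment 2 r `^ q.
have tle r : t r <= V `^ q * 2 `^ (- e * r%:R).
  rewrite /t mulrC ler_wpM2r ?powR_ge0 // ge0_ler_powR ?nnegrE ?truncated_moment_ge0 //.
apply: (double_tail_sum (t := t)) => //.
- by move=> r; rewrite mulr_ge0 ?powR_ge0.
- exact: powR_ge0.
- move=> m; apply: (@le_trans _ _ (\sum_(0 <= r < m) V `^ q * 2 `^ (- e * r%:R))).
    exact: ler_sum.
  by rewrite -mulr_sumr ler_wpM2l ?powR_ge0 // geo_sum_le.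
Qed.

Lemma level_weights_summable (q : R) :
  1 <= q -> p < 2 * q -> (p < 2 /\ q = 1) \/ 2 <= p ->
  0 < q * (2 * al - 1) - (al * p - 1) ->
  (\sum_(a <oo) \sum_(b <oo)
    (level_weight al p q (truncated_moment (2 * q)) (truncated_moment 2) (a + b))%:E
    < +oo)%E.
Proof.
move=> q1 pq pc e0.
have h1 := truncated_moment_series pq; have h2 := second_moment_series q1 pc e0.
have n1 a b : (0 <= (2 `^ (- (al * (2 * q - p)) * (a + b)%:R) *
    truncated_moment (2 * q) (a + b))%:E)%E.
  by rewrite lee_fin mulr_ge0 ?powR_ge0 // truncated_moment_ge0.
have n2 a b : (0 <= (2 `^ (- (q * (2 * al - 1) - (al * p - 1)) * (a + b)%:R) *
      truncated_moment 2 (a + b) `^ q)%:E)%E.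
  by rewrite lee_fin mulr_ge0 ?powR_ge0.
under eq_eseriesr => a _.
  under eq_eseriesr do rewrite EFinD.
  rewrite nneseriesD //.
  over.
rewrite nneseriesD.
- exact: lte_add_pinfty.
- by move=> a _ _; apply: nneseries_ge0.
- by move=> a _ _; apply: nneseries_ge0.
Qed.

End dominating.

(** * Sufficiency in dyadic form *)

(** The positive part of x for sg = 1, the negative part for sg = -1. *)
Definition signed_part (R : realType) (sg x : R) : R := Num.max (sg * x) 0.

Lemma signed_part_ge0 (R : realType) (sg x : R) : 0 <= signed_part sg x.
Proof. by rewrite le_max lexx orbT. Qed.

Lemma signed_part_le_norm (R : realType) (sg x : R) : `|sg| = 1 ->
  signed_part sg x <= `|x|.
Proof.
move=> s1; rewrite ge_max normr_ge0 andbT.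
by apply: le_trans (ler_norm _) _; rewrite normrM s1 mul1r.
Qed.

Lemma signed_partB (R : realType) (x : R) : x = signed_part 1 x - signed_part (-1) x.
Proof.
rewrite /signed_part mul1r mulN1r; have /orP[x0|x0] := le_total 0 x.
  by rewrite max_l // max_r ?subr0 // oppr_le0.
by rewrite max_r // max_l ?oppr_ge0 // sub0r opprK.
Qed.

Section sufficiency.
Context d (T : measurableType d) (R : realType) (P : probability T R).
Context d' (T' : measurableType d') (Q : probability T' R).
Variables (X : nat * nat -> {RV P >-> R}) (Y : {RV Q >-> R}) (p al q : R).
Hypotheses (p1 : 1 <= p) (al0 : 0 < al) (alp : 1 <= al * p).
Hypotheses (q1 : 1 <= q) (pq : p < 2 * q) (pc : (p < 2 /\ q = 1) \/ 2 <= p)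
  (qe : 0 < q * (2 * al - 1) - (al * p - 1)).
Hypothesis H : condition_H2q pos_index X q.
Hypothesis dom : stochastically_dominated pos_index X Y.
Hypothesis Ylog : (\int[Q]_w (`|Y w| `^ p * log_max2 `|Y w|)%:E < +oo)%E.

Let Z (w : T') : R := `|Y w|.
Let mZ : measurable_fun setT Z. Proof. exact: measurableT_comp. Qed.
Let Z0 w : 0 <= Z w. Proof. exact: normr_ge0. Qed.
Let Zp : (\int[Q]_w (Z w `^ p)%:E < +oo)%E.
Proof. exact: (pth_moment_finite mZ Ylog). Qed.

Let zeta r : R := fine (\int[Q]_w (Num.max (Z w - 2 `^ (al * r%:R)) 0)%:E)%E.

Let zetaE r : (\int[Q]_w (Num.max (Z w - 2 `^ (al * r%:R)) 0)%:E)%E = (zeta r)%:E.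
Proof. by rewrite /zeta fineK // (excess_fin_num mZ Z0 alp p1 Zp). Qed.

Let small (del : R) : 0 < del -> exists N0 : nat, forall K L, (N0 <= K + L)%N ->
    \sum_(0 <= a < K.+1) \sum_(0 <= b < L.+1) 2 ^+ (a + b) * zeta (a + b)%N
    <= del * 2 `^ (al * (K + L)%:R).
Proof.
apply: (weighted_null_sum (B := fine (\int[Q]_w (Z w `^ p)%:E)%E)) => //.
- by move=> r; exact: excess_ge0.
- by move=> r; exact: (excess_bounded mZ Z0 alp p1 Zp).
- exact: (excess_limit mZ Z0 al0 alp p1 Zp).
Qed.

Section sign.
Variable sg : R.
Hypothesis s1 : `|sg| = 1.

Let W (l : nat * nat) (w : T) : R := signed_part sg (X l w).

Let mW l : measurable_fun setT (W l).
Proof. by apply: measurable_maxr => //; exact: measurable_funM. Qed.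

Let W0 l w : 0 <= W l w. Proof. exact: signed_part_ge0. Qed.

Let domW l : pos_index l -> forall x : R, 0 <= x ->
  (P [set w | (x < W l w)%R] <= Q [set w | (x < Z w)%R])%E.
Proof.
move=> hl x x0; apply: le_trans (dom x).
apply: (@le_trans _ _ (P [set w | (x < `|X l w|)%R])).
  apply: le_measure; rewrite ?inE.
  - exact: measurable_gt.
  - by apply: measurable_gt; exact: measurableT_comp.
  - by move=> w /= h; apply: lt_le_trans h _; exact: signed_part_le_norm.
by apply: ereal_sup_ubound; exists l.
Qed.

Let mtr r l : measurable_fun setT (fun w => truncation al r (W l w)).
Proof. exact: measurable_minr. Qed.

Let mex r l : measurable_fun setT (fun w => Num.max (W l w - 2 `^ (al * r%:R)) 0).
Proof. by apply: measurable_maxr => //; exact: measurable_funB. Qed.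

Let tr0 r l w : 0 <= truncation al r (W l w). Proof. exact: truncation_ge0. Qed.

Let trunc_fin r l : (\int[P]_w (truncation al r (W l w))%:E)%E \is a fin_num.
Proof.
rewrite ge0_fin_numE; last exact: int_ge0.
apply: (@le_lt_trans _ _ (\int[P]_w (2 `^ (al * r%:R))%:E)%E).
  by apply: ge0_le_int => // w; rewrite /truncation ge_min lexx orbT.
by rewrite integral_cst //= probability_setT mule1 ltry.
Qed.

Let ex0 r l w : 0 <= Num.max (W l w - 2 `^ (al * r%:R)) 0.
Proof. by rewrite le_max lexx orbT. Qed.

Let excess_le r l : pos_index l ->
  (\int[P]_w (Num.max (W l w - 2 `^ (al * r%:R)) 0)%:E <= (zeta r)%:E)%E.
Proof.
by move=> hl; rewrite -zetaE; apply: dominated_excess => //; exact: domW.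
Qed.

Let split_mean r l : (\int[P]_w (W l w)%:E = \int[P]_w (truncation al r (W l w))%:E
  + \int[P]_w (Num.max (W l w - 2 `^ (al * r%:R)) 0)%:E)%E.
Proof.
rewrite -ge0_integralD //; last 4 first.
- by move=> w _; rewrite lee_fin.
- exact: measurable_int_EFin.
- by move=> w _; rewrite lee_fin.
- exact: measurable_int_EFin.
apply: eq_integral => w _; rewrite -EFinD; congr (_%:E).
rewrite /truncation; set c := 2 `^ _; have [h|h] := leP (W l w) c.
  by rewrite max_r ?addr0 // subr_le0.
by rewrite max_l ?subr_ge0 ?(ltW h) // addrC subrK.
Qed.

Let mean_tail l r : pos_index l ->
  `|full_mean P W l - truncated_mean P W al r l| <= zeta r.
Proof.
move=> hl; rewrite /full_mean (split_mean r l) /truncated_mean.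
have h := excess_le r hl; have h0 := int_ge0 P (ex0 r l).
have hf : (\int[P]_w (Num.max (W l w - 2 `^ (al * r%:R)) 0)%:E)%E \is a fin_num.
  by rewrite ge0_fin_numE //; apply: le_lt_trans h _; exact: ltry.
rewrite fineD // addrC addKr ger0_norm ?fine_ge0 //.
by rewrite -lee_fin fineK.
Qed.

Lemma full_mean_fin l : pos_index l -> (\int[P]_w (W l w)%:E)%E \is a fin_num.
Proof.
move=> hl; rewrite (split_mean 0 l) fin_numD trunc_fin /=.
rewrite ge0_fin_numE; last exact: int_ge0.
by apply: le_lt_trans (excess_le 0 hl) _; exact: ltry.
Qed.

Let mean_step l r : pos_index l ->
  truncated_mean P W al r.+1 l - truncated_mean P W al r l <= zeta r.
Proof.
move=> hl; apply: le_trans (le_trans (ler_norm _) (mean_tail r hl)).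
rewrite lerD2r /truncated_mean /full_mean fine_le ?full_mean_fin //.
by apply: ge0_le_int => // w; rewrite /truncation ge_min lexx.
Qed.

Let trunc_mono r : {homo (fun x => truncation al r (signed_part sg x)) : x y / x <= y} \/
  {homo (fun x => truncation al r (signed_part sg x)) : x y /~ x <= y}.
Proof.
have key (x y : R) : sg * x <= sg * y ->
    truncation al r (signed_part sg x) <= truncation al r (signed_part sg y).
  move=> h; rewrite /truncation le_min; apply/andP; split.
    by rewrite ge_min /signed_part ge_max !le_max h lexx !orbT.
  by rewrite ge_min lexx orbT.
have [sg0|sg0] := leP 0 sg; [left|right] => x y xy; apply: key.
  exact: ler_wpM2l.
by apply: ler_wnM2l => //; exact: ltW.
Qed.

Let q0 : 0 < q. Proof. exact: lt_le_trans q1. Qed.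

(** The truncation of [signed_part sg x] is a monotone function of x, nonincreasing if
    sg = -1, so that Condition (H_2q) applies to it. *)
Lemma signed_part_series (eps : R) : 0 < eps ->
  (\sum_(K <oo) \sum_(L <oo) ((2 `^ ((al * p - 1) * (K + L)%:R))%:E *
    P [set w | (eps * 2 `^ (al * (K + L)%:R) <
      max_rect_sum (fun ij => W ij w - full_mean P W ij) (2 ^ K) (2 ^ L))%R]) < +oo)%E.
Proof.
move=> eps0; have [C C0 HC] := condition_H2q_bound q1 H.
have tq0 : 0 < 2 * q by rewrite mulr_gt0.
apply: (dyadic_maximal_series (C := C) (q := q) (zeta := zeta)
  (M := truncated_moment Q Z al (2 * q)) (V := truncated_moment Q Z al 2)) => //.
- by move=> r; exact: truncated_moment_ge0.
- by move=> r; exact: excess_ge0.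
- move=> I r Ipos.
  apply: (HC I (fun x => truncation al r (signed_part sg x))) => //.
  + by move=> x; rewrite truncation_ge0 ?signed_part_ge0.
  + exact: truncated_moment_ge0.
  + exact: truncated_moment_ge0.
  + move=> l lI; rewrite -truncated_momentE ?(ltW tq0) //.
    exact: (dominated_truncated_moment (mW l) mZ (W0 l) Z0 (domW (Ipos l lI)) (powR_ge0 _ _) tq0).
  + move=> l lI; rewrite -truncated_momentE //.
    under eq_integral do rewrite -powR_mulrn ?truncation_ge0 ?signed_part_ge0 //.
    exact: (dominated_truncated_moment (mW l) mZ (W0 l) Z0 (domW (Ipos l lI)) (powR_ge0 _ _)).
- move=> l r hl; rewrite -truncated_momentE ?(ltW tq0) //.
  exact: (dominated_truncated_moment (mW l) mZ (W0 l) Z0 (domW hl) (powR_ge0 _ _)).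
- exact: lt_le_trans p1.
- exact: level_weights_summable.
Qed.

End sign.

Let mean_decomp l : pos_index l -> fine 'E_P[X l]%E =
  full_mean P (fun l w => signed_part 1 (X l w)) l
  - full_mean P (fun l w => signed_part (-1) (X l w)) l.
Proof.
move=> hl.
have f1 := @full_mean_fin 1 (normr1 R) l hl.
have f2 := @full_mean_fin (-1) (normrN1 R) l hl.
have m (sg : R) : measurable_fun setT (fun w => signed_part sg (X l w)).
  by apply: measurable_maxr => //; exact: measurable_funM.
have i (sg : R) : (\int[P]_w (signed_part sg (X l w))%:E)%E \is a fin_num ->
    P.-integrable setT (EFin \o (fun w => signed_part sg (X l w))).
  move=> f; apply/integrableP; split; first exact: measurable_int_EFin.
  under eq_integral do rewrite /= ger0_norm ?signed_part_ge0 //.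
  by rewrite -ge0_fin_numE // int_ge0 // => w; exact: signed_part_ge0.
rewrite /full_mean -fineB // unlock; congr fine.
rewrite -integralB_EFin //; [|exact: i|exact: i].
by apply: eq_integral => w _; rewrite -EFinB -signed_partB.
Qed.

(** Split X into its positive and negative parts. *)
Lemma centered_dyadic_series (eps : R) : 0 < eps ->
  (\sum_(K <oo) \sum_(L <oo) ((2 `^ ((al * p - 1) * (K + L)%:R))%:E *
    P [set w | (eps * 2 `^ (al * (K + L)%:R) <
      max_rect_sum (fun ij => X ij w - fine 'E_P[X ij]%E) (2 ^ K) (2 ^ L))%R]) < +oo)%E.
Proof.
move=> eps0; have e2 : 0 < eps / 2 by rewrite divr_gt0.
pose c sg := full_mean P (fun l w => signed_part sg (X l w)).
pose E (sg : R) K L := [set w | (eps / 2 * 2 `^ (al * (K + L)%:R) <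
  max_rect_sum (fun ij => signed_part sg (X ij w) - c sg ij) (2 ^ K) (2 ^ L))%R].
pose t (sg : R) K L : \bar R := ((2 `^ ((al * p - 1) * (K + L)%:R))%:E * P (E sg K L))%E.
have mE sg K L : measurable (E sg K L).
  apply: measurable_gt; apply: (measurable_max_rect_sum (a := fun ij w => _)) => ij.
  by apply: measurable_funB => //; apply: measurable_maxr => //; exact: measurable_funM.
have t0 sg K L : (0 <= t sg K L)%E by rewrite mule_ge0 // lee_fin powR_ge0.
have s1 : (\sum_(K <oo) \sum_(L <oo) t 1%R K L < +oo)%E.
  exact: (@signed_part_series 1 (normr1 R)).
have s2 : (\sum_(K <oo) \sum_(L <oo) t (-1)%R K L < +oo)%E.
  exact: (@signed_part_series (-1) (normrN1 R)).
apply: (@le_lt_trans _ _ (\sum_(K <oo) \sum_(L <oo) (t 1%R K L + t (-1)%R K L))%E); last first.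
  have -> : (\sum_(K <oo) \sum_(L <oo) (t 1%R K L + t (-1)%R K L) =
      \sum_(K <oo) (\sum_(L <oo) t 1%R K L + \sum_(L <oo) t (-1)%R K L))%E.
    by apply: eq_eseriesr => K _; rewrite nneseriesD.
  rewrite nneseriesD; first exact: (lte_add_pinfty s1 s2).
  - by move=> K _ _; apply: nneseries_ge0.
  - by move=> K _ _; apply: nneseries_ge0.
have u0 (K L : nat) (A : set T) : (0 <= (2 `^ ((al * p - 1) * (K + L)%:R))%:E * P A)%E.
  by rewrite mule_ge0 // lee_fin powR_ge0.
apply: lee_nneseries => [K _ _|K _]; first exact: nneseries_ge0.
apply: lee_nneseries => [L _ _|L _]; first exact: u0.
rewrite /t -ge0_muleDr //; apply: lee_wpmul2l; first by rewrite lee_fin powR_ge0.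
apply: le_trans (measureU2 _ (mE 1 K L) (mE (-1) K L)).
apply: le_measure; rewrite ?inE.
- apply: measurable_gt; apply: (measurable_max_rect_sum (a := fun ij w => _)) => ij.
  exact: measurable_funB.
- exact: measurableU.
move=> w /= hw; apply/orP; rewrite !ltNge -negb_and; apply/negP => /andP[h1 h2].
move: hw; rewrite ltNge => /negP; apply.
rewrite (@max_rect_sum_ext _ _ (fun ij => (signed_part 1 (X ij w) - c 1 ij) -
   (signed_part (-1) (X ij w) - c (-1) ij))).
  apply: le_trans (max_rect_sumB_le _ _ _ _) _.
  by apply: le_trans (lerD h1 h2) _; rewrite -mulrDl -splitr.
move=> ij hij; rewrite mean_decomp // {1}(signed_partB (X ij w)) /c.
by set x1 := signed_part 1 _; set x2 := signed_part (-1) _; ring.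
Qed.

End sufficiency.

(** * The rate series and its dyadic form *)

Section condensation.
Context d (T : measurableType d) (R : realType) (P : probability T R).
Variables (X : nat * nat -> {RV P >-> R}) (c : nat * nat -> R) (p al : R).
Hypothesis al0 : 0 < al.

Let D (m n : nat) (w : T) : R := max_rect_sum (fun ij => X ij w - c ij) m n.

Definition dyadic_term (eps : R) (K L : nat) : \bar R :=
  ((2 `^ ((al * p - 1) * (K + L)%:R))%:E *
    P [set w | (eps * 2 `^ (al * (K + L)%:R) <
      max_rect_sum (fun ij => X ij w - c ij) (2 ^ K) (2 ^ L))%R])%E.

Let mD m n : measurable_fun setT (D m n).
Proof.
apply: (measurable_max_rect_sum (a := fun ij w => X ij w - c ij)) => ij.
exact: measurable_funB.
Qed.

Lemma dyadic_term_ge0 eps K L : (0 <= dyadic_term eps K L)%E.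
Proof. by rewrite mule_ge0 // lee_fin powR_ge0. Qed.

Let prod_lb K L m n : (2 ^ K <= m < 2 ^ K.+1)%N -> (2 ^ L <= n < 2 ^ L.+1)%N ->
  2 `^ (al * (K + L)%:R) <= (m * n)%:R `^ al.
Proof.
move=> hm hn; have /andP[h _] := dyadic_product_bounds R hm hn.
by rewrite mulrC powRrM ge0_ler_powR ?nnegrE ?powR_ge0 // ltW.
Qed.

Let prod_ub K L m n : (2 ^ K <= m < 2 ^ K.+1)%N -> (2 ^ L <= n < 2 ^ L.+1)%N ->
  (m * n)%:R `^ al <= 2 `^ (al * ((K + L)%:R + 2)).
Proof.
move=> hm hn; have /andP[_ h] := dyadic_product_bounds R hm hn.
by rewrite mulrC powRrM ge0_ler_powR ?nnegrE ?powR_ge0 // ltW.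
Qed.

Lemma rate_series_of_dyadic (eps : R) : 0 < eps ->
  (\sum_(K <oo) \sum_(L <oo) dyadic_term (eps * 2 `^ (- (al * 2))) K L < +oo)%E ->
  (rate_series X c al p eps < +oo)%E.
Proof.
move=> eps0 hS; set e' := eps * _ in hS.
pose e := al * p - 2.
pose u (K L : nat) : \bar R := ((2 `^ (2 * `|e|) * 2 `^ (e * (K + L)%:R))%:E *
  P [set w | (eps * 2 `^ (al * (K + L)%:R) < D (2 ^ K.+1) (2 ^ L.+1) w)%R])%E.
have u0 K L : (0 <= u K L)%E.
  by rewrite mule_ge0 // lee_fin mulr_ge0 ?powR_ge0.
rewrite /rate_series.
apply: le_lt_trans (double_condensation_le (u := u) _ u0 _) _.
- by move=> m n; rewrite mule_ge0 // lee_fin powR_ge0.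
- move=> K L m n hm hn; apply: lee_pmul => //.
  + rewrite lee_fin; have := powR_dyadic_bounds e (dyadic_product_bounds R hm hn).
    by case/andP.
  apply: le_measure; rewrite ?inE; [exact: (measurable_gt _ (mD _ _))|exact: (measurable_gt _ (mD _ _))|].
  move=> w /= h; apply: le_lt_trans (lt_le_trans h _).
    by rewrite ler_pM2l //; exact: prod_lb hm hn.
  by apply: max_rect_sum_mono; apply: ltnW; [case/andP: hm|case/andP: hn].
pose k := 2 `^ (2 * `|e|) * 2 `^ (- (2 * (al * p - 1))).
have k0 : 0 <= k by rewrite mulr_ge0 ?powR_ge0.
have uE K L : ((2 ^+ (K + L))%:E * u K L = k%:E * dyadic_term e' K.+1 L.+1)%E.
  rewrite /u /dyadic_term !muleA -!EFinM; congr ((_)%:E * P _)%E.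
    rewrite /k -powR2_nat -!powR2D; congr (2 `^ _).
    by rewrite /e addnS addSn -[(K + L).+2%:R]natr1 -natr1; ring.
  apply/seteqP; split => w /=; rewrite /e' addnS addSn -mulrA -powR2D;
    by have -> : - (al * 2) + al * (K + L).+2%:R = al * (K + L)%:R
      by rewrite -[(K + L).+2%:R]natr1 -natr1; ring.
have -> : (\sum_(K <oo) \sum_(L <oo) (2 ^+ (K + L))%:E * u K L =
    k%:E * \sum_(K <oo) \sum_(L <oo) dyadic_term e' K.+1 L.+1)%E.
  rewrite -nneseriesZl; last by move=> K _; apply: nneseries_ge0 => L _ _; exact: dyadic_term_ge0.
  apply: eq_eseriesr => K _; rewrite -nneseriesZl; last by move=> L _; exact: dyadic_term_ge0.
  by apply: eq_eseriesr => L _; exact: uE.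
apply: lte_mul_pinfty; [by rewrite lee_fin|by []|apply: le_lt_trans hS].
by apply: double_nneseries_shift_le => K L; exact: dyadic_term_ge0.
Qed.

Lemma dyadic_of_rate_series (eps : R) : 0 < eps ->
  (rate_series X c al p eps < +oo)%E ->
  (\sum_(K <oo) \sum_(L <oo) dyadic_term (eps * 2 `^ (al * 2)) K L < +oo)%E.
Proof.
move=> eps0 hS; set e' := eps * _.
pose e := al * p - 2.
pose u (K L : nat) : \bar R := ((2 `^ (- (2 * `|e|)) * 2 `^ (e * (K + L)%:R))%:E *
  P [set w | (e' * 2 `^ (al * (K + L)%:R) < D (2 ^ K) (2 ^ L) w)%R])%E.
have u0 K L : (0 <= u K L)%E.
  by rewrite mule_ge0 // lee_fin mulr_ge0 ?powR_ge0.
have := double_condensation_ge (u := u)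
  (t := fun m n => (((m * n)%:R `^ (al * p - 2))%R)%:E *
    P [set w | (eps * (m * n)%:R `^ al < D m n w)%R])%E _ u0 _.
move=> /(_ _ _)/le_lt_trans h.
have {h} : (\sum_(K <oo) \sum_(L <oo) (2 ^+ (K + L))%:E * u K L < +oo)%E.
  apply: h hS.
  - by move=> m n; rewrite mule_ge0 // lee_fin powR_ge0.
  - move=> K L m n hm hn; apply: lee_pmul => //.
    + rewrite lee_fin; have := powR_dyadic_bounds e (dyadic_product_bounds R hm hn).
      by case/andP.
    apply: le_measure; rewrite ?inE; [exact: (measurable_gt _ (mD _ _))|exact: (measurable_gt _ (mD _ _))|].
    move=> w /= h; apply: le_lt_trans (lt_le_trans h _).
      rewrite /e' -mulrA ler_pM2l // -powR2D.
      by apply: le_trans (prod_ub hm hn) _; rewrite ler_powR2 // mulrDr addrC.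
    by apply: max_rect_sum_mono; [case/andP: hm|case/andP: hn].
pose k := 2 `^ (2 * `|e|) : R.
have uE K L : (dyadic_term e' K L = k%:E * ((2 ^+ (K + L))%:E * u K L))%E.
  rewrite /u /dyadic_term !muleA -!EFinM; congr ((_)%:E * P _)%E.
  by rewrite /k -powR2_nat -!powR2D; congr (2 `^ _); rewrite /e; ring.
have U0 K L : (0 <= (2 ^+ (K + L))%:E * u K L)%E by rewrite mule_ge0 // lee_fin exprn_ge0.
move=> h.
have -> : (\sum_(K <oo) \sum_(L <oo) dyadic_term e' K L =
    k%:E * \sum_(K <oo) \sum_(L <oo) (2 ^+ (K + L))%:E * u K L)%E.
  rewrite -nneseriesZl; last by move=> K _; apply: nneseries_ge0.
  apply: eq_eseriesr => K _; rewrite -nneseriesZl //.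
  by apply: eq_eseriesr => L _; exact: uE.
by apply: lte_mul_pinfty; [rewrite lee_fin powR_ge0| |exact: h].
Qed.

End condensation.

(** * Counting variables with controlled central moments *)

(** S is a nonnegative variable, typically a number of occurrences, that vanishes
    outside B. If its central moment of order 2q is at most C (x + x^q), where x is
    its mean, then bounds on x reduce to bounds on the probability of B. *)
Section counting.
Context d (T : measurableType d) (R : realType) (P : probability T R).
Variables (S : T -> R) (B : set T) (x C q : R).
Hypotheses (mS : measurable_fun setT S) (mB : measurable B) (S0 : forall w, 0 <= S w).
Hypotheses (x0 : 0 <= x) (C0 : 0 <= C) (q1 : 1 <= q).
Hypothesis mean : (\int[P]_w (S w)%:E = x%:E)%E.
Hypothesis var : (\int[P]_w (`|S w - x| `^ (2 * q))%:E <= (C * (x + x `^ q))%:E)%E.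
Hypothesis SB : forall w, ~ B w -> S w = 0.

Let PB : R := fine (P B).
Let PBE : (P B = PB%:E)%E. Proof. by rewrite /PB fineK // fin_num_measure. Qed.
Let q0 : 0 < q. Proof. exact: lt_le_trans q1. Qed.
Let mdev : measurable_fun setT (fun w => `|S w - x| `^ (2 * q)).
Proof.
apply: (measurableT_comp (measurable_powR _)); apply: measurableT_comp => //.
exact: measurable_funB.
Qed.

(** Outside B the deviation |S - x| equals x. If that has probability at least 1/2,
    then x^(2q) is of the order of x + x^q, and x is bounded. *)
Lemma count_mean_bounded : PB <= 1 / 2 -> x <= Num.max 1 (4 * C).
Proof.
move=> PB2; rewrite le_max; have [//|x1] := leP x 1; rewrite orFb.
have xq0 : 0 < x `^ q by rewrite powR_gt0 // (lt_trans _ x1).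
have xxq : x <= x `^ q by apply: le1r_powR => //; exact: ltW.
have h1 : x `^ (2 * q) * (1 - PB) <= C * (x + x `^ q).
  rewrite -lee_fin; apply: le_trans var.
  have -> : (x `^ (2 * q) * (1 - PB))%:E =
      (\int[P]_w (x `^ (2 * q) * \1_(~` B) w)%:E)%E.
    under eq_integral do rewrite EFinM.
    rewrite ge0_integralZl_EFin ?powR_ge0 //.
    - have -> : (\int[P]_w (\1_(~` B) w)%:E = P (~` B))%E.
        by rewrite integral_indic ?setIT //; exact: measurableC.
      by rewrite probability_setC // PBE -EFinB.
    - by apply: measurable_int_EFin; apply: measurable_indic; exact: measurableC.
  apply: ge0_le_int => //.
  - by apply: measurable_funM => //; apply: measurable_indic; exact: measurableC.
  - by move=> w; rewrite mulr_ge0 ?powR_ge0.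
  move=> w; rewrite indicE; case: (boolP (w \in ~` B)) => [/set_mem/= nB|_].
    by rewrite mulr1 SB // sub0r normrN ger0_norm.
  by rewrite mulr0 powR_ge0.
have h2 : x `^ q * x `^ q <= x `^ q * (4 * C).
  move: h1; have -> : 2 * q = q + q by ring.
  rewrite powRD; last by apply/implyP => _; rewrite gt_eqF // (lt_trans _ x1).
  set y := x `^ q in xq0 xxq *.
  have y2 : 0 <= y * y by rewrite mulr_ge0 // ltW.
  have cy : C * x <= C * y by rewrite ler_wpM2l.
  nra.
by apply: le_trans xxq _; rewrite ler_pM2l in h2.
Qed.

(** On B one has S <= del |S - x|^(2q) + 1/del + 1 + x. Taking means, the moment term is
    at most x / 2 when del is small and x is bounded. *)
Lemma count_mean_le (x1 del : R) : x <= x1 -> 0 < del ->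
  del * (C * (1 + x1 `^ (q - 1))) <= 1 / 2 ->
  x <= 2 * (del^-1 + 1 + x1) * PB.
Proof.
move=> xx1 del0 hdel.
have di : 0 < del^-1 by rewrite invr_gt0.
have PB0 : 0 <= PB by rewrite fine_ge0.
have h : x <= del * (C * (x + x `^ q)) + (del^-1 + 1 + x) * PB.
  rewrite -lee_fin -mean.
  apply: (@le_trans _ _ (\int[P]_w (del * `|S w - x| `^ (2 * q) +
      (del^-1 + 1 + x) * \1_B w)%:E)%E).
    apply: ge0_le_int => //.
      by apply: measurable_funD; apply: measurable_funM => //; exact: measurable_indic.
    move=> w; rewrite indicE; case: (boolP (w \in B)) => [/set_mem/= wB|wB].
      rewrite mulr1; set s := `|S w - x|.
      have hs : S w <= s + x by rewrite -lerBlDr /s ler_norm.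
      have s0 : 0 <= s by exact: normr_ge0.
      suff : s <= del * s `^ (2 * q) + del^-1 + 1 by move: hs; lra.
      have [s1|s1] := leP s 1.
        by rewrite -[leLHS]add0r lerD // addr_ge0 ?mulr_ge0 ?powR_ge0 // ltW.
      have ss : s ^+ 2 <= s `^ (2 * q).
        rewrite -powR_mulrn // ler_powR ?(ltW s1) //.
        by rewrite ler_peMr.
      have : del * s ^+ 2 <= del * s `^ (2 * q) by rewrite ler_pM2l.
      have : 0 <= del^-1 * (del * s - 1) ^+ 2 by rewrite mulr_ge0 ?sqr_ge0 // ltW.
      have -> : del^-1 * (del * s - 1) ^+ 2 = del * s ^+ 2 - 2 * s + del^-1.
        by field; rewrite gt_eqF.
      lra.
    rewrite mulr0 addr0 SB ?mulr_ge0 ?powR_ge0 ?(ltW del0) //.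
    by move=> /mem_set; apply/negP.
  under eq_integral do rewrite EFinD !EFinM.
  rewrite ge0_integralD //; last 4 first.
  - by move=> w _; rewrite -EFinM lee_fin mulr_ge0 ?powR_ge0 // ltW.
  - by apply: measurable_int_EFin; exact: measurable_funM.
  - by move=> w _; rewrite -EFinM lee_fin mulr_ge0 // !addr_ge0 // ltW.
  - by apply: measurable_int_EFin; apply: measurable_funM => //; exact: measurable_indic.
  rewrite [leRHS]EFinD; apply: leeD.
    rewrite ge0_integralZl_EFin ?(ltW del0) //.
      by rewrite EFinM lee_wpmul2l // lee_fin ltW.
    exact: measurable_int_EFin.
  rewrite ge0_integralZl_EFin.
  - have -> : (\int[P]_w (\1_B w)%:E = PB%:E)%E by rewrite -PBE integral_indic // setIT.
    by rewrite EFinM.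
  - by [].
  - by move=> w _; rewrite lee_fin.
  - by apply: measurable_int_EFin; exact: measurable_indic.
  - by rewrite !addr_ge0 // ltW.
have xq : x `^ q <= x * x1 `^ (q - 1).
  rewrite -(mulr_powRB1 x0 q0) ler_wpM2l // ge0_ler_powR ?nnegrE ?subr_ge0 //.
  exact: le_trans xx1.
have h3 : del * (C * (x + x `^ q)) <= x / 2.
  apply: (@le_trans _ _ (del * (C * (1 + x1 `^ (q - 1))) * x)); last first.
    by rewrite mulrC ler_wpM2l // -[leRHS]mul1r.
  rewrite -mulrA ler_pM2l // -mulrA ler_wpM2l // mulrDl mul1r lerD2l.
  by rewrite [leRHS]mulrC.
have h4 : (del^-1 + 1 + x) * PB <= (del^-1 + 1 + x1) * PB.
  by rewrite ler_wpM2r // lerD2l.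
move: h h3 h4; rewrite -mulrA; set a := del * _; set b := _ * PB; set b' := _ * PB.
lra.
Qed.

End counting.

(** * Tail probabilities bounded by maxima *)

Lemma nneseries_eventually_le (R : realType) (f : nat -> \bar R) (x : R) :
  (forall k, 0 <= f k)%E -> (\sum_(k <oo) f k < +oo)%E -> 0 < x ->
  exists N0 : nat, forall k, (N0 <= k)%N -> (f k <= x%:E)%E.
Proof.
move=> f0 fS x0; have := nneseries_tail_cvg fS (fun k _ => f0 k).
move=> /fine_cvgP[[N1 _ h1]] /cvgr_le/(_ _ x0) [N2 _ h2].
exists (maxn N1 N2) => k; rewrite geq_max => /andP[k1 k2].
have h := h1 k k1; have h' := h2 k k2; rewrite /= in h h'.
have : (f k <= \sum_(k <= i <oo) f i)%E.
  have := nneseries_lim_ge k.+1 (fun i (_ : (k <= i)%N) (_ : true) => f0 i).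
  by rewrite big_nat1.
by move=> /le_trans; apply; rewrite -(fineK h) lee_fin.
Qed.

Section tail_bounds.
Context d (T : measurableType d) (R : realType) (P : probability T R).
Context d' (T' : measurableType d') (Q : probability T' R).
Variables (X : nat * nat -> {RV P >-> R}) (Y : {RV Q >-> R}) (p al q mu : R).
Hypotheses (p1 : 1 <= p) (al0 : 0 < al) (alp : 1 <= al * p) (q1 : 1 <= q).
Hypothesis H : condition_H2q pos_index X q.
Hypothesis same : forall mn, pos_index mn -> same_distribution (X mn) Y.

Let p0 : 0 < p. Proof. exact: lt_le_trans p1. Qed.
Let q0 : 0 < q. Proof. exact: lt_le_trans q1. Qed.

Let ev (K L : nat) : set T := [set w | (8^-1 * 2 `^ (al * (K + L)%:R) <
      max_rect_sum (fun ij => X ij w - mu) (2 ^ K) (2 ^ L))%R].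

Let mev K L : measurable (ev K L).
Proof.
apply: measurable_gt; apply: (measurable_max_rect_sum (a := fun ij w => _)) => ij.
exact: measurable_funB.
Qed.

(** For each sign, count the entries (i, j) of the rectangle 2^K by 2^L such that
    sg (X_ij - mu) is at least 2^(al (K + L)). If there is one, a corner sum is
    at least a quarter of this value, which exceeds the constant 1/8 of [ev]. *)
Section sign.
Variable sg : R.
Hypothesis s1 : `|sg| = 1.

Let hit (N : nat) (x : R) : R := (2 `^ (al * N%:R) <= sg * (x - mu))%R%:R.

Let tail (N : nat) : R := fine (Q [set w | (2 `^ (al * N%:R) <= sg * (Y w - mu))%R]).

Let tailE N : Q [set w | (2 `^ (al * N%:R) <= sg * (Y w - mu))%R] = (tail N)%:E.
Proof.
rewrite fineK // fin_num_measure //.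
by apply: measurable_ge; apply: measurable_funM => //; exact: measurable_funB.
Qed.

Let tail_ge0 N : 0 <= tail N. Proof. exact: fine_ge0. Qed.

Let tail_le1 N : tail N <= 1.
Proof.
rewrite -lee_fin -tailE; apply: probability_le1.
by apply: measurable_ge; apply: measurable_funM => //; exact: measurable_funB.
Qed.

Let hit_ge0 N x : 0 <= hit N x. Proof. exact: ler0n. Qed.

Let hit_powR N x (s : R) : s != 0 -> hit N x `^ s = hit N x.
Proof. by rewrite /hit; case: (_ <= _) => s0; rewrite ?powR1 // powR0. Qed.

Let hit_sqr N x : hit N x ^+ 2 = hit N x.
Proof. by rewrite /hit; case: (_ <= _); rewrite ?expr1n // expr0n. Qed.

Let mhit N l : measurable_fun setT (fun w => hit N (X l w)).
Proof.
have -> : (fun w => hit N (X l w)) =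
    \1_[set w | (2 `^ (al * N%:R) <= sg * (X l w - mu))%R].
  apply/funext => w; rewrite indicE /hit; congr (_%:R); congr nat_of_bool.
  by apply/idP/idP => [h|/set_mem//]; rewrite inE.
apply: measurable_indic.
by apply: measurable_ge; apply: measurable_funM => //; exact: measurable_funB.
Qed.

Let hit_mean N l : pos_index l -> (\int[P]_w (hit N (X l w))%:E = (tail N)%:E)%E.
Proof.
move=> hl; pose A := [set x : R | (2 `^ (al * N%:R) <= sg * (x - mu))%R].
have mA : measurable A.
  by apply: measurable_ge; apply: measurable_funM => //; exact: measurable_funB.
transitivity (P (X l @^-1` A)).
  have mXA : measurable (X l @^-1` A).
    by rewrite -[_ @^-1` _]setTI; exact: measurable_funPT.
  have <- : (\int[P]_w (\1_(X l @^-1` A) w)%:E = P (X l @^-1` A))%E.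
    by rewrite integral_indic // setIT.
  apply: eq_integral => w _; rewrite indicE /hit; congr (_%:R%:E); congr nat_of_bool.
  by apply/idP/idP => [h|/set_mem//]; rewrite inE.
by rewrite -tailE; exact: (same hl mA).
Qed.

Let hit_mono N : {homo (hit N) : x y / x <= y} \/ {homo (hit N) : x y /~ x <= y}.
Proof.
have key (x y : R) : sg * (x - mu) <= sg * (y - mu) -> hit N x <= hit N y.
  move=> h; rewrite /hit ler_nat; case: (boolP (_ <= sg * (x - mu))) => // hx.
  by rewrite (le_trans hx h).
have [sg0|sg0] := leP 0 sg; [left|right] => x y xy; apply: key.
  by rewrite ler_wpM2l // lerD2r.
by apply: ler_wnM2l; [exact: ltW|rewrite lerD2r].
Qed.

Let count (K L : nat) (w : T) : R :=
  \sum_(l <- rect_index 0 (2 ^ K) 0 (2 ^ L)) hit (K + L) (X l w).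

Let mcount K L : measurable_fun setT (count K L).
Proof. by apply: measurable_sum => l. Qed.

Let count_ge0 K L w : 0 <= count K L w. Proof. exact: sumr_ge0. Qed.

Let expected (N : nat) : R := 2 ^+ N * tail N.

Let expected_ge0 N : 0 <= expected N.
Proof. by rewrite mulr_ge0 // exprn_ge0. Qed.

Let count_mean K L : (\int[P]_w (count K L w)%:E = (expected (K + L))%:E)%E.
Proof.
under eq_integral do rewrite -sumEFin.
rewrite ge0_integral_sum //; last first.
- by move=> l w _; rewrite lee_fin.
- by move=> l; exact: measurable_int_EFin.
rewrite big_seq (eq_bigr (fun _ => (tail (K + L))%:E)); last first.
  by move=> l hl; exact: hit_mean (rect_index_pos hl).
rewrite -big_seq sumEFin; congr (_%:E).
rewrite big_rect_index !add0n !sumr_const_nat !subn0 -mulrnA /expected.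
by rewrite -natrX mulr_natl mulnC -expnD.
Qed.

Let count_supp K L w : ~ ev K L w -> count K L w = 0.
Proof.
move=> nev; rewrite /count big_rect_index !add0n big_nat big1 // => i /andP[_ iK].
rewrite big_nat big1 // => j /andP[_ jL].
rewrite /hit; have [h|//] := boolP (_ <= _); exfalso; apply: nev; rewrite /ev /=.
have := entry_le_max (fun ij => X ij w - mu) iK jL.
have : 2 `^ (al * (K + L)%:R) <= `|X (i.+1, j.+1) w - mu|.
  by apply: le_trans h _; apply: le_trans (ler_norm _) _; rewrite normrM s1 mul1r.
by have := powR2_gt0 (al * (K + L)%:R); set y := 2 `^ _; set D := max_rect_sum _ _ _; lra.
Qed.

(** The expected count depends on K + L only. The rectangles with L = 0, for which
    the probability of [ev] tends to 0, therefore give a bound on it for all rectangles,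
    by [count_mean_bounded], and [count_mean_le] then applies to every (K, L). *)
Lemma expected_count_le :
  (\sum_(K <oo) P (ev K 0) < +oo)%E ->
  exists2 C : R, 0 <= C & forall K L, ((expected (K + L))%:E <= C%:E * P (ev K L))%E.
Proof.
move=> rowS; have [C C0 HC] := condition_H2q_bound q1 H.
have tq0 : 2 * q != 0 by rewrite gt_eqF // mulr_gt0.
have var K L : (\int[P]_w (`|count K L w - expected (K + L)| `^ (2 * q))%:E <=
    (C * (expected (K + L) + expected (K + L) `^ q))%:E)%E.
  have := HC (rect_index 0 (2 ^ K) 0 (2 ^ L)) (hit (K + L)) (tail (K + L)) (tail (K + L))
    (@rect_index_pos _ _ _ _) (hit_mono (K + L)) (hit_ge0 (K + L)) (tail_ge0 _) (tail_ge0 _).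
  rewrite card_rect_index -expnD natrX -powRM ?exprn_ge0 // -/(expected (K + L)).
  move=> /(_ _ _)/le_trans h; apply: le_trans (h _ _ _ _); last exact: lexx.
  - rewrite le_eqVlt; apply/orP; left; apply/eqP; apply: eq_integral => w _.
    congr ((`|_| `^ _)%:E); rewrite big_split /= -/(count K L w); congr (_ + _).
    rewrite big_seq (eq_bigr (fun _ => - tail (K + L))); last first.
      by move=> l hl; rewrite (hit_mean _ (rect_index_pos hl)).
    rewrite -big_seq sumrN; congr (- _).
    rewrite big_rect_index !add0n !sumr_const_nat !subn0 -mulrnA /expected.
    by rewrite -natrX mulr_natl mulnC -expnD.
  - move=> l hl; under eq_integral do rewrite hit_powR //.
    by rewrite (hit_mean _ (rect_index_pos hl)).
  - move=> l hl; under eq_integral do rewrite hit_sqr.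
    by rewrite (hit_mean _ (rect_index_pos hl)).
have half0 : 0 < 1 / 2 :> R by rewrite divr_gt0.
have [N0 hN0] := nneseries_eventually_le (fun k => measure_ge0 P (ev k 0)) rowS half0.
pose x1 : R := Num.max 1 (4 * C) + 2 ^+ N0.
have m0 : 0 <= Num.max 1 (4 * C) by rewrite le_max ler01.
have bounded N : expected N <= x1.
  have [hN|hN] := leqP N0 N.
    apply: (@le_trans _ _ (Num.max 1 (4 * C))); last by rewrite lerDl exprn_ge0.
    rewrite -[N]addn0.
    apply: (count_mean_bounded (mcount N 0) (mev N 0) (expected_ge0 _) C0 q1 (var N 0)
      (@count_supp N 0)).
    rewrite -lee_fin fineK ?fin_num_measure //; exact: hN0.
  apply: (@le_trans _ _ (2 ^+ N0)); last by rewrite lerDr.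
  rewrite /expected -[leRHS]mulr1; apply: ler_pM; rewrite ?exprn_ge0 //.
  by rewrite -!natrX ler_nat leq_exp2l // ltnW.
have x10 : 0 <= x1 by rewrite addr_ge0 ?exprn_ge0.
pose del : R := (2 * (C * (1 + x1 `^ (q - 1)) + 1))^-1.
have b0 : 0 <= C * (1 + x1 `^ (q - 1)) by rewrite mulr_ge0 ?addr_ge0 ?powR_ge0.
have del0 : 0 < del by rewrite invr_gt0 mulr_gt0 // ltr_wpDl.
exists (2 * (del^-1 + 1 + x1)).
  by rewrite mulr_ge0 // !addr_ge0 // invr_ge0 ltW.
move=> K L.
have -> : P (ev K L) = (fine (P (ev K L)))%:E by rewrite fineK // fin_num_measure.
rewrite -EFinM lee_fin.
apply: (count_mean_le (mcount K L) (mev K L) (count_ge0 K L) _ C0 q1 (count_mean K L)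
  (var K L) (@count_supp K L) (bounded _) del0) => //.
rewrite /del; set b := C * _ in b0 *.
rewrite mulrC ler_pdivrMr ?mulr_gt0 ?ltr_wpDl // mulrA divfK ?mul1r //.
by rewrite lerDl.
Qed.

End sign.
End tail_bounds.

(** * Necessity *)

Lemma ler_log_max2 (R : realType) (x y : R) : x <= y -> log_max2 x <= log_max2 y.
Proof.
move=> xy; have m0 (z : R) : 0 < Num.max z 2 by rewrite lt_max ltr0n orbT.
rewrite /log_max2 ler_ln ?posrE //.
by rewrite ge_max !le_max xy lexx orbT.
Qed.

Lemma log_max2_double (R : realType) (x : R) : log_max2 (2 * x) <= 2 * log_max2 x.
Proof.
have m0 (z : R) : 0 < Num.max z 2 by rewrite lt_max ltr0n orbT.
have -> : 2 * log_max2 x = ln (Num.max x 2 `^ 2) by rewrite ln_powR.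
have h2 : 2 <= Num.max x 2 by rewrite le_max lexx orbT.
have hx : x <= Num.max x 2 by rewrite le_max lexx.
rewrite /log_max2 ler_ln ?posrE ?powR_gt0 // powR_mulrn ?(ltW (m0 x)) // expr2.
move: h2 hx; set y := Num.max x 2 => h2 hx.
have y2 : 2 * y <= y * y by rewrite ler_pM2r // (lt_le_trans _ h2).
rewrite ge_max; apply/andP; split; first by apply: le_trans y2; rewrite ler_pM2l.
apply: le_trans y2; lra.
Qed.

Lemma moment_shift (R : realType) (p y mu : R) : 1 <= p ->
  `|y| `^ p * log_max2 `|y| <=
  2 `^ p * 2 * (`|y - mu| `^ p * log_max2 `|y - mu|)
  + 2 `^ p * 2 * (`|mu| `^ p * log_max2 `|mu|).
Proof.
move=> p1; have p0 : 0 <= p by rewrite (le_trans _ p1).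
pose g (z : R) := z `^ p * log_max2 z.
have l0 (z : R) : 0 <= log_max2 z by rewrite ltW // log_max2_gt0.
have g0 z : 0 <= g z by rewrite mulr_ge0 ?powR_ge0.
have gm a b : 0 <= a -> a <= b -> g a <= g b.
  move=> a0 ab; apply: ler_pM; rewrite ?powR_ge0 ?ler_log_max2 //.
  by rewrite ge0_ler_powR ?nnegrE // (le_trans a0).
have g2 a : 0 <= a -> g (2 * a) <= 2 `^ p * 2 * g a.
  move=> a0; rewrite /g powRM // -!mulrA ler_wpM2l ?powR_ge0 // mulrCA.
  by rewrite ler_wpM2l ?powR_ge0 // log_max2_double.
rewrite -!/(g _) -mulrDr.
set m := Num.max `|y - mu| `|mu|.
have m0 : 0 <= m by rewrite le_max normr_ge0.
have ym : `|y| <= 2 * m.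
  rewrite -[y in `|y|](subrK mu); apply: le_trans (ler_normD _ _) _.
  by rewrite mulr_natl mulr2n; apply: lerD; rewrite /m le_max lexx ?orbT.
apply: le_trans (gm _ _ _ ym) _ => //; apply: le_trans (g2 _ m0) _.
rewrite ler_wpM2l ?mulr_ge0 ?powR_ge0 //.
rewrite /m; have [h|h] := leP `|y - mu| `|mu|.
  by rewrite lerDr.
by rewrite lerDl.
Qed.

Section necessity.
Context d (T : measurableType d) (R : realType) (P : probability T R).
Context d' (T' : measurableType d') (Q : probability T' R).
Variables (X : nat * nat -> {RV P >-> R}) (Y : {RV Q >-> R}) (p al q mu : R).
Hypotheses (p1 : 1 <= p) (al0 : 0 < al) (al1 : al <= 1) (alp : 1 <= al * p) (q1 : 1 <= q).
Hypotheses (pq : p < 2 * q) (pc : (p < 2 /\ q = 1) \/ 2 <= p)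
  (qe : 0 < q * (2 * al - 1) - (al * p - 1)).
Hypothesis H : condition_H2q pos_index X q.
Hypothesis same : forall mn, pos_index mn -> same_distribution (X mn) Y.
Hypothesis series : forall eps : R, 0 < eps ->
  (rate_series X (fun=> mu) al p eps < +oo)%E.

Let p0 : 0 < p. Proof. exact: lt_le_trans p1. Qed.

Let ev (c : R) (eps : R) (K L : nat) : set T :=
  [set w | (eps * 2 `^ (al * (K + L)%:R) <
      max_rect_sum (fun ij => X ij w - c) (2 ^ K) (2 ^ L))%R].

Let mev c eps K L : measurable (ev c eps K L).
Proof.
apply: measurable_gt; apply: (measurable_max_rect_sum (a := fun ij w => _)) => ij.
exact: measurable_funB.
Qed.

Let first_column (c eps : R) :
  (\sum_(K <oo) \sum_(L <oo) dyadic_term X (fun=> c) p al eps K L < +oo)%E ->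
  (\sum_(K <oo) P (ev c eps K 0) < +oo)%E.
Proof.
apply: le_lt_trans; apply: lee_nneseries => [K _ _|K _]; first exact: measure_ge0.
apply: (@le_trans _ _ (dyadic_term X (fun=> c) p al eps K 0)).
  rewrite /dyadic_term -[leLHS]mul1e lee_wpmul2r // lee_fin.
  have := @ler_powR2 R 0 ((al * p - 1) * (K + 0)%:R); rewrite powRr0; apply.
  by rewrite mulr_ge0 // subr_ge0.
have := @nneseries_lim_ge R (fun L => dyadic_term X (fun=> c) p al eps K L) xpredT 0 1
  (fun L _ _ => dyadic_term_ge0 _ _ _ _ _ _ _).
by rewrite big_nat1.
Qed.

Let dyadic_series (eps : R) : 0 < eps ->
  (\sum_(K <oo) \sum_(L <oo) dyadic_term X (fun=> mu) p al eps K L < +oo)%E.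
Proof.
move=> eps0; have e0 : 0 < eps * 2 `^ (- (al * 2)) by rewrite mulr_gt0 // powR2_gt0.
have := dyadic_of_rate_series al0 e0 (series e0).
by rewrite -mulrA -powR2D addNr powRr0 mulr1.
Qed.

Let tail_sum :
  (\sum_(K <oo) \sum_(L <oo) (2 `^ (al * p * (K + L)%:R))%:E *
    Q [set w | (2 `^ (al * (K + L)%:R) <= `|Y w - mu|)%R] < +oo)%E.
Proof.
have e0 : 0 < 8^-1 :> R by rewrite invr_gt0.
have S := dyadic_series e0; have row := first_column S.
have [C1 C10 h1] := expected_count_le q1 H same (normr1 R) row.
have [C2 C20 h2] := expected_count_le q1 H same (normrN1 R) row.
have C12 : 0 <= C1 + C2 by rewrite addr_ge0.
pose A (sg : R) N := [set w | (2 `^ (al * N%:R) <= sg * (Y w - mu))%R].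
have mA sg N : measurable (A sg N).
  by apply: measurable_ge; apply: measurable_funM => //; exact: measurable_funB.
have mN N : measurable [set w | (2 `^ (al * N%:R) <= `|Y w - mu|)%R].
  by apply: measurable_ge; apply: measurableT_comp => //; exact: measurable_funB.
have term K L : ((2 `^ (al * p * (K + L)%:R))%:E *
    Q [set w | (2 `^ (al * (K + L)%:R) <= `|Y w - mu|)%R] <=
    (C1 + C2)%:E * dyadic_term X (fun=> mu) p al 8^-1 K L)%E.
  set N := (K + L)%N.
  have -> : (2 `^ (al * p * N%:R))%:E = ((2 `^ ((al * p - 1) * N%:R))%:E * (2 ^+ N)%:E)%E :> \bar R.
    by rewrite -EFinM -powR2_nat -powR2D; congr ((2 `^ _)%:E); ring.
  rewrite /dyadic_term -/N muleCA -muleA; apply: lee_wpmul2l; first by rewrite lee_fin powR_ge0.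
  apply: (@le_trans _ _ ((2 ^+ N)%:E * (Q (A 1%R N) + Q (A (-1)%R N)))%E).
    apply: lee_wpmul2l; first by rewrite lee_fin exprn_ge0.
    apply: le_trans (measureU2 _ (mA 1 N) (mA (-1) N)).
    apply: le_measure; rewrite ?inE //; first exact: measurableU.
    by move=> w /=; rewrite ler_normr => /orP[h|h]; [left|right]; rewrite /A /= ?mul1r ?mulN1r.
  rewrite ge0_muleDr // EFinD ge0_muleDl ?lee_fin //.
  have E sg : (Q (A sg N) = (fine (Q (A sg N)))%:E)%E by rewrite fineK // fin_num_measure.
  by apply: leeD; [rewrite (E 1); exact: h1|rewrite (E (-1)); exact: h2].
have t0 K L : (0 <= (2 `^ (al * p * (K + L)%:R))%:E *
    Q [set w | (2 `^ (al * (K + L)%:R) <= `|Y w - mu|)%R])%E.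
  by rewrite mule_ge0 // lee_fin powR_ge0.
apply: (@le_lt_trans _ _ (\sum_(K <oo) \sum_(L <oo)
    (C1 + C2)%:E * dyadic_term X (fun=> mu) p al 8^-1 K L)%E).
  apply: lee_nneseries => [K _ _|K _]; first exact: nneseries_ge0.
  by apply: lee_nneseries => [L _ _|L _]; [exact: t0|exact: term].
have -> : (\sum_(K <oo) \sum_(L <oo)
    (C1 + C2)%:E * dyadic_term X (fun=> mu) p al 8^-1 K L =
   (C1 + C2)%:E * \sum_(K <oo) \sum_(L <oo) dyadic_term X (fun=> mu) p al 8^-1 K L)%E.
  rewrite -nneseriesZl; last first.
    by move=> K _; apply: nneseries_ge0 => L _ _; exact: dyadic_term_ge0.
  apply: eq_eseriesr => K _; rewrite -nneseriesZl //.
  by move=> L _; exact: dyadic_term_ge0.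
by apply: lte_mul_pinfty; [rewrite lee_fin| |exact: S].
Qed.

Let mg c : measurable_fun setT (fun w => `|Y w - c| `^ p * log_max2 `|Y w - c|).
Proof.
have mY : measurable_fun setT (fun w => `|Y w - c|).
  by apply: measurableT_comp => //; exact: measurable_funB.
apply: measurable_funM; first exact: (measurableT_comp (measurable_powR _)).
rewrite /log_max2; apply: (measurableT_comp (@measurable_ln R)).
exact: measurable_maxr.
Qed.

Let g_ge0 (z : R) : 0 <= `|z| `^ p * log_max2 `|z|.
Proof. by rewrite mulr_ge0 ?powR_ge0 // ltW // log_max2_gt0. Qed.

Let centered_moment :
  (\int[Q]_w (`|Y w - mu| `^ p * log_max2 `|Y w - mu|)%:E < +oo)%E.
Proof.
have [C C0 hC] := moment_le_dyadic al0 p0.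
pose t (K L : nat) (w : T') : R :=
  2 `^ (al * p * (K + L)%:R) * (2 `^ (al * (K + L)%:R) <= `|Y w - mu|)%R%:R.
have mN N : measurable [set w | (2 `^ (al * N%:R) <= `|Y w - mu|)%R].
  by apply: measurable_ge; apply: measurableT_comp => //; exact: measurable_funB.
have tE K L w : t K L w = 2 `^ (al * p * (K + L)%:R) *
    \1_[set w | (2 `^ (al * (K + L)%:R) <= `|Y w - mu|)%R] w.
  rewrite /t indicE; congr (_ * _%:R); congr nat_of_bool.
  by apply/idP/idP => [h|/set_mem//]; rewrite inE.
have mt K L : measurable_fun setT (t K L).
  rewrite (funext (tE K L)).
  by apply: measurable_funM => //; exact: measurable_indic.
have t0 K L w : 0 <= t K L w by rewrite mulr_ge0 ?powR_ge0.
have mT K : measurable_fun setT (fun w => \sum_(L <oo) (t K L w)%:E)%E.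
  apply: ge0_emeasurable_sum => //= [L w _ _|L _]; first by rewrite lee_fin.
  exact: measurable_int_EFin.
have T0 K w : (0 <= \sum_(L <oo) (t K L w)%:E)%E.
  by apply: nneseries_ge0 => L _ _; rewrite lee_fin.
have mTT : measurable_fun setT (fun w => \sum_(K <oo) \sum_(L <oo) (t K L w)%:E)%E.
  by apply: ge0_emeasurable_sum => //= K w _ _.
have tint K L : (\int[Q]_w (t K L w)%:E = (2 `^ (al * p * (K + L)%:R))%:E *
    Q [set w | (2 `^ (al * (K + L)%:R) <= `|Y w - mu|)%R])%E.
  under eq_integral do rewrite tE EFinM.
  rewrite ge0_integralZl_EFin ?powR_ge0 //.
    congr (_ * _)%E.
    by rewrite integral_indic // setIT.
  by apply: measurable_int_EFin; exact: measurable_indic.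
apply: (@le_lt_trans _ _ (\int[Q]_w (C%:E + C%:E *
    \sum_(K <oo) \sum_(L <oo) (t K L w)%:E))%E).
  apply: ge0_le_integral => //.
  - by move=> w _; rewrite lee_fin.
  - by apply: measurable_int_EFin; exact: mg.
  - by apply: emeasurable_funD => //; exact: measurable_funeM.
  - by move=> w _; apply: hC.
have TT0 w : (0 <= \sum_(K <oo) \sum_(L <oo) (t K L w)%:E)%E.
  exact: nneseries_ge0.
rewrite ge0_integralD //; last 2 first.
- by move=> w _; rewrite mule_ge0 // lee_fin.
- exact: measurable_funeM.
rewrite integral_cst //= probability_setT mule1 ge0_integralZl_EFin //.
have -> : (\int[Q]_w (\sum_(K <oo) \sum_(L <oo) (t K L w)%:E) =
  \sum_(K <oo) \sum_(L <oo) (2 `^ (al * p * (K + L)%:R))%:E *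
    Q [set w | (2 `^ (al * (K + L)%:R) <= `|Y w - mu|)%R])%E.
  rewrite integral_nneseries //.
  apply: eq_eseriesr => K _; rewrite integral_nneseries //.
  - by apply: eq_eseriesr => L _; exact: tint.
  - by move=> L; exact: measurable_int_EFin.
  - by move=> L w _; rewrite lee_fin.
apply: lte_add_pinfty; first exact: ltry.
by apply: lte_mul_pinfty; [rewrite lee_fin| |exact: tail_sum].
Qed.

(** The centred moment is finite by [moment_le_dyadic]; comparing Y with
    Y - mu costs a constant, as z^p log z grows at most polynomially. *)
Lemma necessary_moment : (\int[Q]_w (`|Y w| `^ p * log_max2 `|Y w|)%:E < +oo)%E.
Proof.
pose k : R := 2 `^ p * 2.
have k0 : 0 <= k by rewrite mulr_ge0 ?powR_ge0.
pose g (z : R) := `|z| `^ p * log_max2 `|z|.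
apply: (@le_lt_trans _ _ (\int[Q]_w (k * g (Y w - mu) + k * g mu)%:E)%E).
  apply: ge0_le_int => [||w|w]; last exact: moment_shift.
  - have -> : (fun w => `|Y w| `^ p * log_max2 `|Y w|) =
      (fun w => `|Y w - 0| `^ p * log_max2 `|Y w - 0|) by apply/funext => w; rewrite subr0.
    exact: mg.
  - by apply: measurable_funD => //; apply: measurable_funM => //; exact: mg.
  - exact: g_ge0.
under eq_integral do rewrite EFinD EFinM.
rewrite ge0_integralD //; last 3 first.
- by move=> w _; rewrite -EFinM lee_fin mulr_ge0 // g_ge0.
- by apply: measurable_int_EFin; apply: measurable_funM => //; exact: mg.
- by move=> w _; rewrite lee_fin mulr_ge0 // g_ge0.
rewrite integral_cst //= probability_setT mule1 ge0_integralZl_EFin //.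
- apply: lte_add_pinfty; last exact: ltry.
  by apply: lte_mul_pinfty; [rewrite lee_fin| |exact: centered_moment].
- by move=> w _; rewrite lee_fin g_ge0.
- by apply: measurable_int_EFin; exact: mg.
Qed.

Let abs_mean_finite : (\int[Q]_w (`|Y w|)%:E < +oo)%E.
Proof.
have mY : measurable_fun setT (fun w => `|Y w|) by exact: measurableT_comp.
apply: (@le_lt_trans _ _ (\int[Q]_w (1 + `|Y w| `^ p)%:E)%E).
  apply: ge0_le_int => //.
    by apply: measurable_funD => //; exact: (measurableT_comp (measurable_powR _)).
  move=> w; have [h|h] := leP `|Y w| 1.
    by rewrite -[leLHS]addr0 lerD // powR_ge0.
  rewrite -[leLHS]add0r lerD //; apply: le1r_powR => //; exact: ltW.
under eq_integral do rewrite EFinD.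
rewrite ge0_integralD //; last first.
- by apply: measurable_int_EFin; exact: (measurableT_comp (measurable_powR _)).
rewrite integral_cst //= probability_setT mule1.
apply: lte_add_pinfty; first exact: ltry.
exact: (pth_moment_finite mY necessary_moment).
Qed.

Let integrableY : Q.-integrable setT (EFin \o Y).
Proof.
by apply/integrableP; split; [exact: measurable_int_EFin|].
Qed.

Let mean_eq l : pos_index l -> 'E_P[X l]%E = 'E_Q[Y]%E.
Proof.
move=> hl.
have dist (f : R -> \bar R) :
    (\int[distribution P (X l)]_x f x = \int[distribution Q Y]_x f x)%E.
  by apply: eq_measure_integral => A mA _; exact: (same hl mA).
have mabs : measurable_fun setT (fun x : R => `|x|%:E).
  by apply: measurable_int_EFin; exact: normr_measurable.
have integrableX : P.-integrable setT (EFin \o X l).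
  apply/integrableP; split; first exact: measurable_int_EFin.
  have := ge0_integral_distribution (X l) mabs (fun x => normr_ge0 x : (0 <= `|x|%:E)%E).
  rewrite /comp /= => <-; rewrite dist.
  by rewrite (ge0_integral_distribution Y mabs).
have mE : measurable_fun [set: R] (@EFin R) by exact: EFin_measurable.
rewrite !expectation_def.
have -> : (\int[P]_w (X l w)%:E = \int[distribution P (X l)]_x x%:E)%E.
  by rewrite integral_distribution.
by rewrite dist integral_distribution.
Qed.

(** The moment being finite, the sufficiency part gives the same convergence
    with the true mean nu in place of mu. On the first column of the array
    the two centred sums differ by 2^K (nu - mu), so that for every K one of the two
    maxima exceeds |nu - mu| 2^(al K) / 4, because al <= 1. Both probabilities
    tend to 0, hence nu = mu. *)
Lemma necessary_mean : 'E_Q[Y]%E = mu%:E.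
Proof.
have Ef : 'E_Q[Y]%E \is a fin_num.
  by rewrite expectation_def; exact: integrable_fin_num.
set nu := fine 'E_Q[Y]%E; rewrite -(fineK Ef) -/nu; congr (_%:E).
apply/eqP; apply/negPn/negP => neq.
have del0 : 0 < `|nu - mu| by rewrite normr_gt0 subr_eq0.
set eps := `|nu - mu| / 4; have eps0 : 0 < eps by rewrite divr_gt0.
have dom : stochastically_dominated pos_index X Y.
  move=> x; apply: ge_ereal_sup => _ [l hl <-].
  pose A := [set z : R | (x < `|z|)%R].
  have mA : measurable A by apply: measurable_gt; exact: normr_measurable.
  by have := same hl mA; rewrite /distribution /pushforward /= => ->.
have S1 := first_column (dyadic_series eps0).
have S2 : (\sum_(K <oo) P (ev nu eps K 0) < +oo)%E.
  apply: first_column.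
  have h := centered_dyadic_series p1 al0 alp q1 pq pc qe H dom necessary_moment eps0.
  apply: le_lt_trans h; apply: lee_nneseries => [K _ _|K _].
    by apply: nneseries_ge0 => L _ _; exact: dyadic_term_ge0.
  apply: lee_nneseries => [L _ _|L _]; first exact: dyadic_term_ge0.
  apply: lee_wpmul2l; first by rewrite lee_fin powR_ge0.
  have e w : max_rect_sum (fun ij => X ij w - fine 'E_P[X ij]%E) (2 ^ K) (2 ^ L) =
      max_rect_sum (fun ij => X ij w - nu) (2 ^ K) (2 ^ L).
    by apply: max_rect_sum_ext => ij hij; rewrite mean_eq.
  apply: le_measure; rewrite ?inE; [exact: mev| |by move=> w /=; rewrite e].
  apply: measurable_gt; apply: (measurable_max_rect_sum (a := fun ij w => _)) => ij.
  exact: measurable_funB.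
have q40 : 0 < 1 / 4 :> R by rewrite divr_gt0.
have [N1 hN1] := nneseries_eventually_le (fun k => measure_ge0 P (ev mu eps k 0)) S1 q40.
have [N2 hN2] := nneseries_eventually_le (fun k => measure_ge0 P (ev nu eps k 0)) S2 q40.
set K := maxn N1 N2.
have b1 := hN1 K (leq_maxl _ _); have b2 := hN2 K (leq_maxr _ _).
have : (1 <= P (ev mu eps K 0) + P (ev nu eps K 0))%E.
  rewrite -(probability_setT P).
  apply: le_trans (measureU2 _ (mev mu eps K 0) (mev nu eps K 0)).
  apply: le_measure; rewrite ?inE //; first exact: measurableU.
  move=> w _; apply/orP; rewrite /ev /= !ltNge -negb_and; apply/negP => /andP[h1 h2].
  have := corner_sum_le_max (fun ij => X ij w - mu) (leqnn (2 ^ K)) (leqnn (2 ^ 0)).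
  have := corner_sum_le_max (fun ij => X ij w - nu) (leqnn (2 ^ K)) (leqnn (2 ^ 0)).
  have -> : corner_sum (fun ij => X ij w - nu) (2 ^ K) (2 ^ 0) =
      corner_sum (fun ij => X ij w - mu) (2 ^ K) (2 ^ 0) - 2 ^+ K * (nu - mu).
    rewrite /corner_sum expn0.
    under eq_bigr do rewrite big_ord1.
    under [X in _ = X - _]eq_bigr do rewrite big_ord1.
    rewrite !sumrB !sumr_const !card_ord -[nu *+ _]mulr_natl -[mu *+ _]mulr_natl natrX.
    by ring.
  set s := corner_sum _ _ _ => k1 k2.
  have tri : 2 ^+ K * `|nu - mu| <= `|s| + `|s - 2 ^+ K * (nu - mu)|.
    have -> : 2 ^+ K * `|nu - mu| = `|s - (s - 2 ^+ K * (nu - mu))|.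
      by rewrite subKr normrM; congr (_ * _); rewrite ger0_norm ?exprn_ge0.
    exact: ler_normB.
  have hpow : 2 `^ (al * (K + 0)%:R) <= 2 ^+ K :> R.
    by rewrite addn0 -powR2_nat ler_powR2 // ler_piMl.
  have bound : eps * 2 `^ (al * (K + 0)%:R) <= eps * 2 ^+ K by rewrite ler_pM2l.
  have : 0 < 2 ^+ K * `|nu - mu| by rewrite mulr_gt0 // exprn_gt0.
  have : eps * 2 ^+ K = 2 ^+ K * `|nu - mu| / 4 by rewrite /eps; field.
  by move: (le_trans k1 h2) (le_trans k2 h1) tri bound; lra.
apply/negP; rewrite -ltNge; apply: le_lt_trans (leeD b1 b2) _.
by rewrite -EFinD lte_fin; lra.
Qed.

End necessity.

Theorem theorem1p3 (R : realType)
    (d : measure_display) (T : measurableType d) (P : probability T R)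
    (X : nat * nat -> {RV P >-> R})
    (d' : measure_display) (T' : measurableType d') (Q : probability T' R)
    (Y : {RV Q >-> R})
    (p alpha : R)
    (hp : 1 <= p) (halpha : 1 / 2 < alpha <= 1) (halphap : 1 <= alpha * p)
    (hH2 : p < 2 -> condition_H2q pos_index X 1)
    (hH2q : 2 <= p -> exists q : R,
       [/\ 1 <= q, (alpha * p - 1) / (2 * alpha - 1) < q
         & condition_H2q pos_index X q]) :
  (stochastically_dominated pos_index X Y ->
   ('E_Q[fun w => (`|Y w| `^ p * log_max2 `|Y w|)%R] < +oo)%E ->
   forall eps : R, 0 < eps ->
     (rate_series X (fun ij => fine 'E_P[X ij]%E) alpha p eps < +oo)%E)
  /\
  ((forall mn, pos_index mn -> same_distribution (X mn) Y) ->
   forall mu : R,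
   (forall eps : R, 0 < eps ->
     (rate_series X (fun _ => mu) alpha p eps < +oo)%E) ->
   'E_Q[Y]%E = mu%:E /\
   ('E_Q[fun w => (`|Y w| `^ p * log_max2 `|Y w|)%R] < +oo)%E).
Proof.
have /andP[al2 al1] := halpha.
have al0 : 0 < alpha by apply: lt_trans al2; rewrite divr_gt0.
(* both cases give an exponent with p < 2 q and alpha p - 1 < q (2 alpha - 1) *)
have [q [q1 pq pc qe H]] : exists q : R, [/\ 1 <= q, p < 2 * q,
    (p < 2 /\ q = 1) \/ 2 <= p, 0 < q * (2 * alpha - 1) - (alpha * p - 1)
    & condition_H2q pos_index X q].
  have [p2|p2] := ltP p 2.
    exists 1; split => //; [by rewrite mulr1|by left| |exact: hH2].
    have -> : 1 * (2 * alpha - 1) - (alpha * p - 1) = alpha * (2 - p) by ring.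
    by rewrite mulr_gt0 // subr_gt0.
  have [q [q1 qlt H]] := hH2q p2.
  have a1 : 0 < 2 * alpha - 1 by move: al2; lra.
  rewrite ltr_pdivrMr // in qlt.
  exists q; split => //; [|by right|by rewrite subr_gt0].
  rewrite ltNge; apply/negP => qp.
  have : q * (2 * alpha - 1) <= p / 2 * (2 * alpha - 1).
    by rewrite ler_pM2r //; move: qp; lra.
  by move: qlt p2; lra.
split.
  move=> dom EY eps eps0.
  have Ylog : (\int[Q]_w (`|Y w| `^ p * log_max2 `|Y w|)%:E < +oo)%E.
    by move: EY; rewrite unlock.
  have e0 : 0 < eps * 2 `^ (- (alpha * 2)) by rewrite mulr_gt0 // powR2_gt0.
  apply: rate_series_of_dyadic => //.
  exact: (centered_dyadic_series hp al0 halphap q1 pq pc qe H dom Ylog e0).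
move=> same mu series; split.
  exact: (necessary_mean hp al0 al1 halphap q1 pq pc qe H same series).
by rewrite unlock; exact: (necessary_moment hp al0 halphap q1 H same series).
Qed.
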